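(* Let $X$ be a fractional Brownian motion in $\mathbb{R}^d$ of Hurst index $H$, let $f:[0,1]\to\mathbb{R}^d$ be a Borel measurable function and let $A$ be a Borel subset of $[0,1]$. Set $\alpha=\dim_{\Psi,H}(\mathrm{Gr}_A(f))$. Then almost surely \[ \dim\big(\mathrm{Gr}_A(X+f)\big)=\min\{\alpha/H,\ \alpha+d(1-H)\}\quad\text{and}\quad \dim\big(\mathcal{R}_A(X+f)\big)=\min\{\alpha/H,\ d\}. \]
   Context: $\dim$ denotes Hausdorff dimension. A fractional Brownian motion $X=(X_t)_{t\ge 0}$ in $\mathbb{R}^d$ of Hurst index $H\in(0,1)$ is the process with $d$ independent components, each a centered Gaussian process with continuous sample paths and covariance $\mathbb{E}[X^i_sX^i_t]=\frac12(s^{2H}+t^{2H}-|t-s|^{2H})$. For $h:[0,1]\to\mathbb{R}^d$ and $A\subseteq[0,1]$, $\mathrm{Gr}_A(h)=\{(t,h(t)):t\in A\}$ is the graph of $h$ over $A$ and $\mathcal{R}_A(h)=\{h(t):t\in A\}$ is the image of $A$ under $h$. $H$-parabolic Hausdorff dimension: for $E\subseteq\mathbb{R}_+\times\mathbb{R}^d$ and $\beta>0$ let \[ \Psi^\beta_H(E)=\inf\Big\{\sum_j\delta_j^\beta:\ E\subseteq\bigcup_j[a_j,a_j+\delta_j]\times[b_{j,1},b_{j,1}+\delta_j^H]\times\cdots\times[b_{j,d},b_{j,d}+\delta_j^H]\Big\}, \] the infimum being over all countable covers of $E$ by sets of this form; then $\dim_{\Psi,H}(E)=\inf\{\beta>0:\Psi^\beta_H(E)=0\}$.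 *)

(* Defs.v *)
From HB Require Import structures.
From mathcomp Require Import all_boot all_order all_algebra.
From mathcomp Require Import all_classical all_reals all_analysis.

Set Implicit Arguments.
Unset Strict Implicit.
Unset Printing Implicit Defensive.

Import Order.TTheory GRing.Theory Num.Theory.
Import numFieldNormedType.Exports.

Local Open Scope classical_set_scope.
Local Open Scope ring_scope.

Section hausdorff_dimension.
Context {R : realType} {T : Type}.
Variable dist : T -> T -> R.
Local Open Scope ereal_scope.

(* The maximum with 0 gives the empty set diameter 0, since
   ereal_sup set0 = -oo. *)
Definition diameter (U : set T) : \bar R :=
  Order.max 0 (ereal_sup [set (dist p.1 p.2)%:E | p in U `*` U]).

(* Sequences of sets also represent finite covers, padded with set0. *)
Definition hausdorff_premeasure (s delta : R) (E : set T) : \bar R :=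
  ereal_inf [set \sum_(0 <= j <oo) (diameter (U j) `^ s)
            | U in [set U : nat -> set T |
                E `<=` \bigcup_j U j /\
                forall j, diameter (U j) <= delta%:E]].

(* The premeasure is nonincreasing in delta, so that the supremum is the limit
   as delta tends to 0. *)
Definition hausdorff_measure (s : R) (E : set T) : \bar R :=
  ereal_sup [set hausdorff_premeasure s delta E
            | delta in [set delta : R | (0 < delta)%R]].

Definition hausdorff_dim (E : set T) : \bar R :=
  ereal_inf [set s%:E
            | s in [set s : R | (0 < s)%R /\ hausdorff_measure s E = 0]].

End hausdorff_dimension.

Section euclidean.
Context {R : realType} {d : nat}.

(* The norms that the library puts on 'rV[R]_d and on R * 'rV[R]_d are
   maximum norms. *)
Definition euclidean_dist (x y : 'rV[R]_d) : R :=
  Num.sqrt (\sum_(i < d) (x ord0 i - y ord0 i) ^+ 2).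

Definition spacetime_dist (p q : R * 'rV[R]_d) : R :=
  Num.sqrt ((p.1 - q.1) ^+ 2 + \sum_(i < d) (p.2 ord0 i - q.2 ord0 i) ^+ 2).

Definition graph_on (A : set R) (h : R -> 'rV[R]_d) : set (R * 'rV[R]_d) :=
  [set (t, h t) | t in A].

(* Measurability with respect to the sigma-algebra generated by the open sets
   of R^d; on the real line the canonical sigma-algebra is the Borel one. *)
Definition borel_measurable_on (D : set R) (f : R -> 'rV[R]_d) : Prop :=
  measurable_fun D (f : R -> g_sigma_algebraType (@open 'rV[R]_d)).

End euclidean.

Section parabolic_dimension.
Context {R : realType} {d : nat}.
Variable H : R.

Definition parabolic_box (a : R) (b : 'rV[R]_d) (delta : R) :
    set (R * 'rV[R]_d) :=
  [set p : R * 'rV[R]_d | a <= p.1 <= a + delta /\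
    forall i, b ord0 i <= p.2 ord0 i <= b ord0 i + delta `^ H].

(* Allowing delta j = 0 makes sequences of boxes include finite covers. *)
Definition parabolic_content (beta : R) (E : set (R * 'rV[R]_d)) : \bar R :=
  ereal_inf [set S | exists (a : nat -> R) (b : nat -> 'rV[R]_d)
                            (delta : nat -> R),
    [/\ forall j, 0 <= delta j,
        E `<=` \bigcup_j parabolic_box (a j) (b j) (delta j) &
        S = (\sum_(0 <= j <oo) (delta j `^ beta)%:E)%E]].

Definition parabolic_dim (E : set (R * 'rV[R]_d)) : \bar R :=
  ereal_inf [set beta%:E
            | beta in [set beta : R |
                0 < beta /\ parabolic_content beta E = 0%E]].

End parabolic_dimension.

Section fractional_brownian_motion.
Context {R : realType} {disp : measure_display} {Omega : measurableType disp}.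
Variable P : probability Omega R.

(* Constants count as Gaussian. They need a separate case because
   normal_prob m 0 is not the Dirac mass at m. *)
Definition gaussian_rv (Y : Omega -> R) : Prop :=
  measurable_fun [set: Omega] Y /\
  exists m s : R, 0 <= s /\
    forall B : set R, measurable B ->
      P (Y @^-1` B) = if s == 0 then \d_m B else normal_prob m s B.

(* Only the times t >= 0 of a process indexed by R are relevant. *)
Definition gaussian_process (Y : R -> Omega -> R) : Prop :=
  forall (n : nat) (t a : 'I_n -> R), (forall k, 0 <= t k) ->
    gaussian_rv (fun w => \sum_(k < n) a k * Y (t k) w).

Definition process_sigma_algebra (Y : R -> Omega -> R) : set (set Omega) :=
  <<s [set F | exists (t : R) (B : set R),
         [/\ 0 <= t, measurable B & F = Y t @^-1` B]] >>.

(* Subfamilies are covered by taking F i = setT for the other indices. *)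
Definition independent_processes (d : nat) (Y : 'I_d -> R -> Omega -> R) :
    Prop :=
  forall F : 'I_d -> set Omega,
    (forall i, process_sigma_algebra (Y i) (F i)) ->
    P (\bigcap_i F i) = (\prod_(i < d) P (F i))%E.

Record fractional_brownian_motion_1d (H : R) (Y : R -> Omega -> R) : Prop := {
  fbm_gaussian : gaussian_process Y ;
  fbm_centered : forall t : R, 0 <= t -> 'E_P[Y t]%E = 0%E ;
  fbm_covariance : forall s t : R, 0 <= s -> 0 <= t ->
    'E_P[Y s \* Y t]%E =
      (2^-1 * (s `^ (2 * H) + t `^ (2 * H) - `|t - s| `^ (2 * H)))%:E ;
  fbm_continuous : forall w, {within `[0, +oo[, continuous (Y ^~ w)} }.

Definition fractional_brownian_motion (d : nat) (H : R)
    (X : R -> Omega -> 'rV[R]_d) : Prop :=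
  let component i := fun t w => X t w ord0 i in
  independent_processes component /\
  forall i, fractional_brownian_motion_1d H (component i).

End fractional_brownian_motion.

(* Main.v *)
Require Import Defs.
From HB Require Import structures.
From mathcomp Require Import all_boot all_order all_algebra.
From mathcomp Require Import all_classical all_reals all_analysis.
From mathcomp Require Import ring lra.
From mathcomp Require Import measurable_realfun zify.

Set Implicit Arguments.
Unset Strict Implicit.
Unset Printing Implicit Defensive.

Import Order.TTheory GRing.Theory Num.Theory.
Import numFieldNormedType.Exports.

Local Open Scope classical_set_scope.
Local Open Scope ring_scope.

(* Upper bounds. A cover of Gr_A(f) by parabolic boxes of sides delta and delta^H
   is mapped by a g-Hölder path (g < H) to sets of diameter O(delta^g); the graph
   pieces can moreover be cut into O(delta^(d (g - 1))) sets of diameter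
   O(delta). Let g tend to H.

   Lower bounds. If the parabolic content of order beta does not vanish, the
   graph carries a Frostman measure: Borel sets are analytic, a net content on a
   tree of parabolic cells is a Choquet capacity, and the limiting content of
   compact approximations directs a flow down the tree. It is enough to have a
   finite measure mu on an auxiliary space U and a measurable time tau : U -> A
   such that tau and f o tau satisfy the parabolic ball condition. For two
   points of U at parabolic scale M, that is
   M = max(|t - s|^H, |f(t) - f(s)|), Gaussian estimates bound the probability
   that X + f moves by at most r between the times s and t by
   C r^e M^(-q), where e = q if q <= d (image), and e = H q + d (1 - H) if
   q >= d and |t - s| <= r (graph). As M^(-q) is integrable for mu x mu when
   H q < beta, Fubini's theorem shows that almost surely the image of some part
   of mu gives mass O(2^(-k s)) to balls of radius 2^(-k), for any s < e, and the
   mass distribution principle applies. *)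

(** * Analytic sets of sequences *)

(** Since [f] is only Borel, its graph need not be closed, and a compactness proof of Frostman's
    lemma does not reach it; this is why the cover problem is moved to sequences over a finite
    alphabet, where words are cells. A second obstacle is that [gaussian_rv] provides a law
    [normal_prob m s] whose parameters are not tied to the moments. They are compared with mean and
    variance only up to numerical factors, whence the constants 6, 60, 120 and 720. The two
    exponents e answer to the terms of the minima. With q close to alpha / H, the image exponent e =
    q gives alpha / H, cut off at d, and it serves the graph as well, because distances in the graph
    dominate distances in the image. When alpha > d H this only gives d for the graph, and the graph
    exponent takes over, with H q + d (1 - H) close to alpha + d (1 - H). Hölder exponents and
    lower-bound parameters run through the rationals, so that countably many null sets are
    discarded. *)

Lemma dependent_choice_seq {T : Type} (P : seq T -> Prop) :
  P [::] -> (forall y, P y -> exists a, P (rcons y a)) ->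
  exists f : nat -> T, forall k, P (mkseq f k).
Proof.
move=> P0 PS; have [a0 _] := PS _ P0.
pose next (y : {y | P y}) : {y | P y} :=
  let a := cid (PS _ (projT2 y)) in exist P (rcons (projT1 y) (projT1 a)) (projT2 a).
pose Y k := projT1 (iter k next (exist P _ P0)).
have YS k : exists a, Y k.+1 = rcons (Y k) a by rewrite /Y /=; eexists.
exists (fun k => last a0 (Y k.+1)) => k.
rewrite (_ : mkseq _ k = Y k); first exact: projT2.
elim: k => // k IH; rewrite mkseqS IH; have [a ->] := YS k.
by rewrite last_rcons.
Qed.

Section analytic.
Variable S : Type.
Implicit Types (b : nat -> S) (x : nat -> nat).

Definition agree {T : Type} (n : nat) (b b' : nat -> T) : Prop :=
  forall i, (i < n)%N -> b i = b' i.

Lemma agreeS {T : Type} (m n : nat) (b b' : nat -> T) :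
  (m <= n)%N -> agree n b b' -> agree m b b'.
Proof. by move=> mn a i im; apply: a; exact: leq_trans mn. Qed.

(** Closedness for the product of discrete topologies: the complement contains a cylinder around
    each of its points. Analytic sets are then the projections of closed sets along Baire space. *)
Definition closed_rel (F : (nat -> S) -> (nat -> nat) -> Prop) : Prop :=
  forall b x, ~ F b x -> exists N, forall b' x',
    agree N b b' -> agree N x x' -> ~ F b' x'.

Definition analytic (E : set (nat -> S)) : Prop :=
  exists2 F, closed_rel F & E = [set b | exists x, F b x].

(** The first entry of the witness names the member of the union, and the tail is a witness for
    it. *)
Lemma analytic_bigcup (E : (set (nat -> S))^nat) :
  (forall n, analytic (E n)) -> analytic (\bigcup_n E n).
Proof.
move=> aE; have /choice[F HF] : forall n, exists F, closed_rel F /\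
    E n = [set b | exists x, F b x].
  by move=> n; have [F ? ?] := aE n; exists F.
exists (fun b x => F (x 0%N) b (fun k => x k.+1)).
  move=> b x /(proj1 (HF (x 0%N)))[N HN]; exists N.+1 => b' x' bb' xx'.
  rewrite -(xx' 0%N)//; apply: HN; first exact: agreeS bb'.
  by move=> i iN; exact: xx'.
apply/seteqP; split=> [b [n _]|b [x Fb]].
- rewrite (HF n).2 => -[x Fb].
  by exists (fun k => if k is k'.+1 then x k' else n).
- by exists (x 0%N) => //; rewrite (HF _).2; exists (fun k => x k.+1).
Qed.

(** The witnesses of all members are interleaved into one sequence through a pairing of indices. *)
Lemma analytic_bigcap (E : (set (nat -> S))^nat) :
  (forall n, analytic (E n)) -> analytic (\bigcap_n E n).
Proof.
move=> aE; have /choice[F HF] : forall n, exists F, closed_rel F /\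
    E n = [set b | exists x, F b x].
  by move=> n; have [F ? ?] := aE n; exists F.
pose sub (x : nat -> nat) (n k : nat) := x (pickle (n, k)).
exists (fun b x => forall n, F n b (sub x n)).
  move=> b x /existsNP[n] /(proj1 (HF n))[N HN].
  (* Far enough to contain the positions at which the first [N] entries of the [n]-th witness are
     stored. *)
  exists (maxn N (\max_(k < N) (pickle (n, nat_of_ord k)).+1)) => b' x' bb' xx'.
  apply/existsNP; exists n; apply: HN.
    by apply: agreeS bb'; rewrite leq_maxl.
  move=> i iN; apply: xx'; rewrite leq_max; apply/orP; right.
  exact: (@leq_bigmax _ (fun k : 'I_N => (pickle (n, nat_of_ord k)).+1)
    (Ordinal iN)).
apply/seteqP; split=> [b bE|b [x Fb] n _]; last first.
  by rewrite (HF n).2; exists (sub x n).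
have /choice[x Hx] : forall n, exists x, F n b x.
  by move=> n; move: (bE n Logic.I); rewrite (HF n).2.
exists (fun i => if (unpickle i : option (nat * nat)) is Some (n, k)
                 then x n k else 0%N) => n.
rewrite (_ : sub _ n = x n)//; apply/funext => k.
by rewrite /sub pickleK.
Qed.

Lemma analytic_coord n (P : set S) : analytic [set b | P (b n)].
Proof.
exists (fun b _ => P (b n)); last first.
  by apply/seteqP; split=> [b Pb|b [] //]; exists (fun=> 0%N).
by move=> b x nP; exists n.+1 => b' x' bb' _; rewrite -bb'.
Qed.

(** Requiring analyticity of the complement too makes closure under complements automatic. The
    result is a sigma-algebra that contains the coordinate sets, so every set measurable for the
    coordinates is analytic. *)
Definition bianalytic : set (set (nat -> S)) :=
  [set E | analytic E /\ analytic (~` E)].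

Lemma bianalytic_sigma_algebra : sigma_algebra setT bianalytic.
Proof.
split.
- split.
    exists (fun _ _ => False); first by move=> b x _; exists 0%N => ? ? _ _ [].
    by rewrite predeqE => b; split=> // -[].
  exists (fun _ _ => True); first by move=> b x [].
  by rewrite setC0 predeqE => b; split=> // _; exists (fun=> 0%N).
- by move=> E [aE aCE]; rewrite setTD; split=> //; rewrite setCK.
- move=> E aE; split.
    by apply: analytic_bigcup => n; have [] := aE n.
  by rewrite setC_bigcup; apply: analytic_bigcap => n; have [] := aE n.
Qed.

Lemma bianalytic_coord n (P : set S) : bianalytic [set b | P (b n)].
Proof.
split; first exact: (@analytic_coord n P).
have := @analytic_coord n (~` P); congr analytic.
Qed.

(** Compactness of the bounded part of Baire space: a word that starts witnesses at every precision
    has finitely many admissible extensions, and one of them keeps this property. The infinite word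
    so obtained is a witness for [b] because [F] is closed. *)
Lemma konig (F : (nat -> S) -> (nat -> nat) -> Prop) (n : nat -> nat) b :
    closed_rel F ->
    (forall m, exists b' x', [/\ agree m b b',
       forall i, (i < m)%N -> (x' i <= n i)%N & F b' x']) ->
  exists x, F b x.
Proof.
move=> clF HF.
pose P (y : seq nat) := forall m, exists b' x', [/\ agree m b b',
    forall i, (i < m)%N -> (x' i <= n i)%N, F b' x' &
    forall i, (i < size y)%N -> x' i = nth 0%N y i].
have P0 : P [::].
  by move=> m; have [b' [x' [? ? ?]]] := HF m; exists b', x'; split.
have PS y : P y -> exists a, P (rcons y a).
  move=> Py; apply: contrapT => /forallNP nP.
  have /choice[M HM] : forall a, exists m, ~ exists b' x', [/\ agree m b b',
      forall i, (i < m)%N -> (x' i <= n i)%N, F b' x' &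
      forall i, (i < size (rcons y a))%N -> x' i = nth 0%N (rcons y a) i].
    by move=> a; have /existsNP := nP a.
  (* The first term bounds the next entry of the witness, which leaves finitely many candidates; the
     second passes every precision at which one of them fails. *)
  pose m := maxn (size y).+1 (\max_(a < (n (size y)).+1) M a).
  have [b' [x' [bb' x'n Fbx yx']]] := Py m.
  have x'y : (x' (size y) < (n (size y)).+1)%N.
    by rewrite ltnS x'n// leq_max ltnSn.
  have Mm : (M (x' (size y)) <= m)%N.
    by rewrite leq_max; apply/orP; right; exact: (@leq_bigmax _
      (fun a : 'I_(n (size y)).+1 => M a) (Ordinal x'y)).
  apply: (HM (x' (size y))); exists b', x'; split => //.
  - exact: agreeS bb'.
  - by move=> i iM; apply: x'n; exact: leq_trans Mm.
  - move=> i; rewrite size_rcons ltnS leq_eqVlt nth_rcons.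
    case/predU1P => [->|iy]; first by rewrite ltnn eqxx.
    by rewrite iy yx'.
have [x Px] := dependent_choice_seq P0 PS.
exists x; apply: contrapT => /clF[N HN].
have [b' [x' [bb' _ Fbx yx']]] := Px N N.
apply: (HN b' x') => // i iN; rewrite yx' ?size_mkseq//.
by rewrite nth_mkseq.
Qed.

End analytic.

(** * Sums over countable index sets *)

Section esum_lemmas.
Context {R : realType}.
Local Open Scope ereal_scope.

Lemma subset_esum {T : choiceType} (I J : set T) (a : T -> \bar R) :
  I `<=` J -> \esum_(t in I) a t <= \esum_(t in J) a t.
Proof.
move=> IJ; apply: ereal_sup_le => _ [X [fX XI] <-].
by exists X => //; split=> //; exact: subset_trans IJ.
Qed.

(** Each point is assigned to a single set that contains it, so the pairs (index, point) embed [U]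
    in the disjoint union of the [D i]. *)
Lemma esum_le_cover {I T : choiceType} (J : set I) (D : I -> set T) (U : set T)
    (a : T -> \bar R) :
  (forall t, 0 <= a t) -> U `<=` \bigcup_(i in J) D i ->
  \esum_(t in U) a t <= \esum_(i in J) \esum_(t in D i) a t.
Proof.
move=> a0 UD; have [U0|/set0P[t0 /UD[i0 _ _]]] := eqVneq U set0.
  by rewrite U0 esum_set0 esum_ge0// => i _; exact: esum_ge0.
have /choice[g gP] : forall t, exists i, U t -> J i /\ D i t.
  move=> t; have [/UD[i Ji Dit]|nU] := pselect (U t); first by exists i.
  by exists i0.
rewrite esum_esum//.
have <- : \esum_(k in (fun t => (g t, t)) @` U) a k.2 = \esum_(t in U) a t.
  by rewrite esum_image// => x y _ _ [].
by apply: subset_esum => _ [t /gP[Jt Dt] <-].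
Qed.

Lemma esumZl {T : choiceType} (I : set T) (a : T -> \bar R) (k : R) :
  (0 < k)%R -> (forall t, 0 <= a t) ->
  \esum_(t in I) (k%:E * a t) = k%:E * \esum_(t in I) a t.
Proof.
have leZ (l : R) (b : T -> \bar R) : (0 < l)%R -> (forall t, 0 <= b t) ->
    \esum_(t in I) (l%:E * b t) <= l%:E * \esum_(t in I) b t.
  move=> l0 b0; apply: ge_ereal_sup => _ [X [fX XI] <-].
  rewrite -ge0_mule_fsumr//; apply: lee_wpmul2l; first by rewrite lee_fin ltW.
  by apply: ereal_sup_ubound; exists X.
move=> k0 a0; apply/eqP; rewrite eq_le leZ//=.
rewrite -lee_pdivlMl//.
rewrite -[leLHS](_ : \esum_(t in I) (k^-1%:E * (k%:E * a t)) = _).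
  apply: leZ; first by rewrite invr_gt0.
  by move=> t; rewrite mule_ge0// lee_fin ltW.
apply: eq_esum => t _.
by rewrite muleA -EFinM mulVf ?mul1e// lt0r_neq0.
Qed.

Lemma esum_fin {T : finType} (a : T -> \bar R) :
  (forall t, 0 <= a t) -> \esum_(t in [set: T]) a t = \sum_t a t.
Proof.
move=> a0; rewrite esum_fset//; last exact: finite_finset.
rewrite [RHS]fsbig_seq ?index_enum_uniq//; apply: eq_fsbigl.
by apply/seteqP; split=> // t _ /=; rewrite mem_index_enum.
Qed.

Lemma esum_epsilon {I : countType} (J : set I) (e : R) : (0 <= e)%R ->
  \esum_(i in J) (e / (2 ^ (pickle i).+1)%:R)%:E <= e%:E.
Proof.
move=> e0.
have <- : \esum_(n in pickle @` J) (e / (2 ^ n.+1)%:R)%:E =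
    \esum_(i in J) (e / (2 ^ (pickle i).+1)%:R)%:E.
  by rewrite esum_image// => x y _ _; exact: (pcan_inj pickleK).
apply: le_trans (epsilon_trick0 xpredT e0).
rewrite nneseries_esumT; last by move=> n; rewrite lee_fin divr_ge0.
exact: subset_esum.
Qed.

End esum_lemmas.

(** * Net contents and capacitability *)

Section net_content.
Context {R : realType} {S : finType} (w : nat -> R).
Hypothesis w_ge0 : forall n, 0 <= w n.
Local Open Scope ereal_scope.
Implicit Types (b : nat -> S) (s t u : seq S) (E : set (nat -> S)) (D : set (seq S)).

Definition cyl s : set (nat -> S) := [set b | mkseq b (size s) = s].

Lemma cyl_mkseq b n : cyl (mkseq b n) b.
Proof. by rewrite /cyl/= size_mkseq. Qed.

Lemma take_mkseq b n m : (n <= m)%N -> take n (mkseq b m) = mkseq b n.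
Proof.
move=> nm; rewrite /mkseq -map_take take_iota.
by rewrite (minn_idPl nm).
Qed.

Lemma cylS s t : seq.prefix s t -> cyl t `<=` cyl s.
Proof.
move=> st b; rewrite /cyl/= => bt.
by move: (st); rewrite prefixE -bt take_mkseq ?size_prefix// => /eqP.
Qed.

Lemma prefix_antisize s t : seq.prefix s t -> size s = size t -> s = t.
Proof. by rewrite prefixE => /eqP + st; rewrite st take_size. Qed.

Lemma prefix_rconsP s t : seq.prefix s t -> s != t -> exists a, seq.prefix (rcons s a) t.
Proof.
move=> /prefixP[[|a r] ->]; first by rewrite cats0 eqxx.
by exists a; rewrite -cat_rcons prefix_prefix.
Qed.

Lemma prefix_rcons_inj s a a' t :
  seq.prefix (rcons s a) t -> seq.prefix (rcons s a') t -> a = a'.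
Proof.
by rewrite !prefixE !size_rcons => /eqP-> /eqP /rcons_inj[].
Qed.

Definition cost D : \bar R := \esum_(t in D) (w (size t))%:E.

Definition net_cover E s D : Prop :=
  (forall t, D t -> seq.prefix s t) /\ E `&` cyl s `<=` \bigcup_(t in D) cyl t.

(** A Hausdorff content on the tree, localised at the node [s]. Lengths of covering words are
    unrestricted, so [s] itself is a competitor. *)
Definition content E s : \bar R := ereal_inf [set cost D | D in net_cover E s].

Lemma cost_ge0 D : 0 <= cost D.
Proof. by apply: esum_ge0 => t _; rewrite lee_fin. Qed.

Lemma content_ge0 E s : 0 <= content E s.
Proof. by apply: le_ereal_inf_tmp => _ [D _ <-]; exact: cost_ge0. Qed.

Lemma content_le_cost E s D : net_cover E s D -> content E s <= cost D.
Proof. by move=> ED; apply: ereal_inf_lbound; exists D. Qed.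

Lemma content_le E s : content E s <= (w (size s))%:E.
Proof.
apply: le_trans (content_le_cost (D := [set s]) _) _.
  split; first by move=> _ ->; exact: prefix_refl.
  by move=> b [_ bs]; exists s.
by rewrite /cost esum_set1// lee_fin.
Qed.

Lemma content_fin_num E s : content E s \is a fin_num.
Proof.
by rewrite ge0_fin_numE ?content_ge0//; apply: le_lt_trans (content_le E s) _; exact: ltry.
Qed.

Lemma content0 E s : E `&` cyl s = set0 -> content E s = 0.
Proof.
move=> Es0; apply/eqP; rewrite eq_le content_ge0 andbT.
apply: le_trans (content_le_cost (D := set0) _) _; first by split => //; rewrite Es0.
by rewrite /cost esum_set0.
Qed.

(** Sets and roots vary together, so that splitting into children, taking unions and refining a
    cover word by word are all instances. *)
Lemma content_subadd {I : countType} (J : set I) E s (F : I -> set (nat -> S))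
    (r : I -> seq S) :
  (forall i, J i -> seq.prefix s (r i)) ->
  E `&` cyl s `<=` \bigcup_(i in J) (F i `&` cyl (r i)) ->
  content E s <= \esum_(i in J) content (F i) (r i).
Proof.
move=> sr EF; apply/lee_addgt0Pr => e e0.
have /choice[D DP] : forall i, exists D, net_cover (F i) (r i) D /\
    cost D <= content (F i) (r i) + (e / (2 ^ (pickle i).+1)%:R)%:E.
  move=> i; have e'0 : (0 < e / (2 ^ (pickle i).+1)%:R)%R.
    by rewrite divr_gt0// ltr0n expn_gt0.
  have [_ [D ? <-] /ltW ?] := lb_ereal_inf_adherent e'0 (content_fin_num (F i) (r i)).
  by exists D.
apply: (@le_trans _ _ (cost (\bigcup_(i in J) D i))).
  apply: content_le_cost; split.
    move=> t [i Ji Dt]; apply: prefix_trans (sr _ Ji) _.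
    exact: (DP i).1.1.
  move=> b /EF[i Ji /(DP i).1.2[t Dt bt]]; exists t => //; by exists i.
apply: le_trans (esum_le_cover (J := J) (D := D) _ _) _ => //.
  by move=> t; rewrite lee_fin.
apply: (@le_trans _ _ (\esum_(i in J)
    (content (F i) (r i) + (e / (2 ^ (pickle i).+1)%:R)%:E)%E)).
  by apply: le_esum => i Ji; exact: (DP i).2.
rewrite esumD; [|by move=> i _; exact: content_ge0|by move=> i _; rewrite lee_fin divr_ge0// ltW].
by rewrite leeD2l// esum_epsilon// ltW.
Qed.

Lemma content_mono E E' s : E `<=` E' -> content E s <= content E' s.
Proof.
move=> EE'; apply: le_ereal_inf_tmp => _ [D [sD E'D] <-].
apply: content_le_cost; split=> //.
by apply: subset_trans E'D; exact: setSI.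
Qed.

Lemma content_children E s : content E s <= \sum_(a : S) content E (rcons s a).
Proof.
rewrite -esum_fin; last by move=> a; exact: content_ge0.
apply: (content_subadd (F := fun=> E) (r := rcons s)).
  by move=> a _; exact: prefix_rcons.
move=> b [Eb bs]; exists (b (size s)) => //; split => //.
by rewrite /cyl/= size_rcons mkseqS bs.
Qed.

(** A cover cheaper than the word [s] cannot contain [s]. Each of its words then passes through
    exactly one child, and the cover splits into covers of the children. *)
Lemma content_superadd E s : content E s < (w (size s))%:E ->
  \sum_(a : S) content E (rcons s a) <= content E s.
Proof.
move=> Esw; rewrite leNgt; apply/negP => Es.
have : content E s < Order.min (w (size s))%:E (\sum_(a : S) content E (rcons s a)).
  by rewrite lt_min Esw.
move=> /ereal_inf_lt[_ [D [sD ED] <-]]; rewrite lt_min => /andP[Dw]; apply/negP; rewrite -leNgt.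
have nDs : ~ D s.
  move=> Ds; move: Dw; rewrite ltNge => /negP; apply.
  rewrite -[leLHS](@esum_set1 R _ s (fun t => (w (size t))%:E)) ?lee_fin//.
  by apply: subset_esum => _ ->.
pose P a : set (seq S) := [set t | seq.prefix (rcons s a) t].
apply: (@le_trans _ _ (\sum_(a : S) cost (D `&` P a))).
  apply: lee_sum => a _; apply: content_le_cost; split; first by move=> t [].
  move=> b [Eb bsa].
  have bs : cyl s b by apply: cylS bsa; exact: prefix_rcons.
  have [t Dt bt] := ED b (conj Eb bs); exists t => //; split => //.
  have ts : s != t by apply/negP => /eqP st; apply: nDs; rewrite st.
  have [a' a't] := prefix_rconsP (sD _ Dt) ts.
  have -> // : a = a'.
  by have := cylS a't bt; move: bsa; rewrite /cyl/= !size_rcons => -> /rcons_inj[].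
rewrite /cost; under eq_bigr do rewrite esum_mkcondr.
rewrite -esum_sum; last by move=> t a _ _; case: ifP; rewrite ?lee_fin.
apply: le_esum => t Dt.
have ts : s != t by apply/negP => /eqP st; apply: nDs; rewrite st.
have [a' a't] := prefix_rconsP (sD _ Dt) ts.
rewrite (bigD1 a')//= big1 ?adde0.
  by case: ifP; rewrite ?lee_fin.
move=> a aa'; case: ifPn => //; rewrite inE => /prefix_rcons_inj - /(_ _ a't) aa.
by rewrite aa eqxx in aa'.
Qed.

End net_content.

Section net_content_continuity.
Context {R : realType} {S : finType} (w : nat -> R).
Hypothesis w_ge0 : forall n, 0 <= w n.
Local Open Scope ereal_scope.
Implicit Types (b : nat -> S) (s t u : seq S).

Local Notation content := (content w).

Lemma contentU (E E' : set (nat -> S)) s :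
  content (E `|` E') s <= content E s + content E' s.
Proof.
apply: le_trans (content_subadd w_ge0 (J := [set: bool])
    (F := fun i => if i then E else E') (r := fun=> s) _ _) _.
- by move=> _ _; exact: prefix_refl.
- by move=> b [[Eb|Eb] bs]; [exists true|exists false].
- rewrite esum_fin; last by move=> i; exact: content_ge0.
  by rewrite big_bool.
Qed.

Section increasing.
Variables (E : (set (nat -> S))^nat) (k : R).
Hypothesis ndE : forall m n, (m <= n)%N -> E m `<=` E n.
Hypothesis k01 : (0 < k < 1)%R.

Let k0 : (0 < k)%R. Proof. by case/andP: k01. Qed.

Let L s : \bar R := ereal_sup (range (fun n => content (E n) s)).

Let L_ub n s : content (E n) s <= L s.
Proof. by apply: ereal_sup_ubound; exists n. Qed.

Let L_cvg s : (fun n => content (E n) s) @ \oo --> L s.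
Proof.
by apply: ereal_nondecreasing_cvgn => m n mn; apply: content_mono; exact: ndE.
Qed.

Let L_superadd s : L s < (w (size s))%:E -> \sum_(a : S) L (rcons s a) <= L s.
Proof.
move=> Lw.
have cL : (fun n => \sum_(a : S) content (E n) (rcons s a)) @ \oo -->
    \sum_(a : S) L (rcons s a).
  apply: cvg_nnesum => a _; last exact: L_cvg.
  by near=> n; exact: content_ge0.
rewrite -(cvg_lim _ cL)//; apply: lime_le; first by apply/cvg_ex; eexists; exact: cL.
near=> n; apply: le_trans (L_ub n s).
by apply: content_superadd => //; apply: le_lt_trans Lw; exact: L_ub.
Unshelve. all: by end_near. Qed.

(* The minimal saturated words cost at most L / k in total. On the part N of E that
   avoids them every cover can be refined by the factor k < 1, so that N has
   content 0. *)
Let sat s : bool := k%:E * (w (size s))%:E <= L s.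

Let D s n : set (seq S) := [set t | [/\ seq.prefix s t, (size t <= n)%N, sat t &
  forall u, seq.prefix s u -> seq.prefix u t -> sat u -> u = t]].

(** Induction on the depth [n]. A saturated [s] is its own only minimal word and is paid for by
    saturation. Otherwise L s < k w <= w, so the limit is superadditive at [s] and the bounds of the
    children add up. *)
Let D_cost n s : \esum_(t in D s (size s + n)) (k%:E * (w (size t))%:E) <= L s.
Proof.
have kw t : 0 <= k%:E * (w (size t))%:E by rewrite -EFinM lee_fin mulr_ge0// ltW.
elim: n s => [|n IH] s; have [ss|nss] := boolP (sat s).
1,3: apply: (@le_trans _ _ (\esum_(t in [set s]) (k%:E * (w (size t))%:E)));
  [ by apply: subset_esum => t [st _ _ /(_ s (prefix_refl _) st ss)]
  | by rewrite esum_set1].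
- rewrite [leLHS](_ : _ = 0) ?(le_trans _ (L_ub 0 s)) ?content_ge0//.
  rewrite (_ : D _ _ = set0) ?esum_set0// -subset0 => t [st sizet tt _].
  move: nss; rewrite (prefix_antisize st) ?tt//.
  by apply/eqP; rewrite eqn_leq size_prefix//= -(addn0 (size s)).
- apply: le_trans (esum_le_cover (J := [set: S])
      (D := fun a => D (rcons s a) (size (rcons s a) + n)) kw _) _.
    move=> t [st sizet tt tmin].
    have sNt : s != t by apply: contraNneq nss => ->.
    have [a at_] := prefix_rconsP st sNt; exists a => //; split => //.
      by rewrite size_rcons addSnnS.
    move=> u su; apply: tmin; apply: prefix_trans su; exact: prefix_rcons.
  rewrite esum_fin; last by move=> a; exact: esum_ge0.
  apply: le_trans (L_superadd _); first by apply: lee_sum => a _; exact: IH.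
  move: nss; rewrite /sat -ltNge => /lt_le_trans; apply.
  by rewrite -EFinM lee_fin ler_piMl// ltW//; case/andP: k01.
Qed.

Let Dmin : set (seq S) := \bigcup_n D [::] n.

Let Dmin_cost : k%:E * cost w Dmin <= L [::].
Proof.
rewrite -esumZl//; last by move=> t; rewrite lee_fin.
apply: ge_ereal_sup => _ [X [fX XD] <-].
have [n Xn] : exists n, X `<=` D [::] n.
  exists (\max_(t <- finmap.enum_fset (fset_set X)) size t)%N => t Xt.
  have [m _ [? ? ? ?]] := XD _ Xt; split => //.
  by apply: leq_bigmax_seq => //; rewrite in_fset_set// inE.
apply: le_trans (D_cost n [::]); rewrite add0n.
by apply: ereal_sup_ubound; exists X.
Qed.

Let N : set (nat -> S) := [set b | forall n, ~~ sat (mkseq b n)].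

Let content_N n : content (E n `&` N) [::] = 0.
Proof.
set c := content _ _; have c0 : 0 <= c by exact: content_ge0.
have cfin : c \is a fin_num by exact: content_fin_num.
have ck : c <= k%:E * c.
  rewrite -lee_pdivrMl//; apply: le_ereal_inf_tmp => _ [X [_ NX] <-].
  rewrite lee_pdivrMl// -esumZl//; last by move=> t; rewrite lee_fin.
  apply: le_trans (content_subadd w_ge0 (J := X)
    (F := fun=> E n `&` N) (r := id) _ _) _; first by move=> t _; exact: prefix0s.
    by move=> b [Nb b0]; have [|t Xt bt] := NX b; [by split|by exists t].
  apply: le_esum => t Xt.
  have [t0|/set0P[b [[Eb Nb] bt]]] := eqVneq ((E n `&` N) `&` cyl t) set0.
    by rewrite content0// mule_ge0// lee_fin// ltW.
  apply: le_trans (content_mono _ _ _) _; first exact: subIsetl.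
  apply: le_trans (L_ub n t) _.
  by move: (Nb (size t)); rewrite (_ : mkseq b _ = t)// /sat -ltNge => /ltW.
apply/eqP; rewrite eq_le c0 andbT leNgt; apply/negP => cgt0.
move: ck; rewrite leNgt => /negP; apply.
rewrite -[ltRHS]mul1e lte_pmul2r// lte_fin.
by case/andP: k01.
Qed.

Lemma content_bigcup_approx (x : \bar R) : (forall n, content (E n) [::] <= x) ->
  k%:E * content (\bigcup_n E n) [::] <= x.
Proof.
move=> Ex; have -> : \bigcup_n E n = (\bigcup_n (E n `&` N)) `|` ((\bigcup_n E n) `\` N).
  apply/seteqP; split=> [b [n _ Eb]|b [[n _ [Eb _]]|[//]]]; last by exists n.
  by have [Nb|nNb] := pselect (N b); [left; exists n|right; split=> //; exists n].
(* The part inside [N] is a countable union of sets of content 0; every other point has a shortest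
   saturated prefix, which belongs to [Dmin]. *)
apply: (@le_trans _ _ (k%:E * (0 + cost w Dmin))).
  apply: lee_wpmul2l; first by rewrite lee_fin ltW.
  apply: le_trans (contentU _ _ _) _; apply: leeD.
    apply: le_trans (content_subadd w_ge0 (J := [set: nat])
      (F := fun n => E n `&` N) (r := fun=> [::]) _ _) _ => //.
      by move=> b [[n _ ENb] b0]; exists n.
    by rewrite esum1// => n _; exact: content_N.
  apply: content_le_cost; split; first by move=> t _; exact: prefix0s.
  move=> b [[_ /existsNP[n /negP sn]] _]; move: sn; rewrite ?negbK => sn.
  have ex : exists n, sat (mkseq b n) by exists n.
  exists (mkseq b (ex_minn ex)); last exact: cyl_mkseq.
  exists (ex_minn ex) => //; case: ex_minnP => m sm mmin; split => //.
    exact: prefix0s.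
    by rewrite size_mkseq.
  move=> u _ um su; apply: prefix_antisize => //; apply/eqP.
  rewrite eqn_leq size_prefix//= size_mkseq mmin//.
  have := size_prefix um; rewrite size_mkseq => su_m.
  by move: um; rewrite prefixE take_mkseq// => /eqP ->.
rewrite add0e; apply: le_trans Dmin_cost _.
by apply: ge_ereal_sup => _ [n _ <-].
Qed.

End increasing.

Lemma content_bigcup (E : (set (nat -> S))^nat) (x : \bar R) :
  (forall m n, (m <= n)%N -> E m `<=` E n) ->
  (forall n, content (E n) [::] <= x) -> content (\bigcup_n E n) [::] <= x.
Proof.
move=> ndE Ex; set c := content _ _.
have c0 : 0 <= c by exact: content_ge0.
have x0 : 0 <= x by apply: le_trans (Ex 0%N); exact: content_ge0.
have cfin : c \is a fin_num by exact: content_fin_num.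
have kc k : (0 < k < 1)%R -> k%:E * c <= x.
  by move=> k01; exact: content_bigcup_approx.
move: kc c0; rewrite -(fineK cfin) => kc c0.
case: x x0 {Ex} kc => [x| |]// x0 kc; last by rewrite leey.
rewrite lee_fin leNgt; apply/negP => xc.
move: xc kc; set r := fine c => xc kc.
have cgt0 : (0 < r)%R by rewrite (le_lt_trans _ xc)// -lee_fin.
(* Halfway between [x / r] and 1, so that [k * r] still exceeds [x]. *)
pose k := ((x / r + 1) / 2)%R.
have xc1 : (x / r < 1)%R by rewrite ltr_pdivrMr// mul1r.
have xc0 : (0 <= x / r)%R by rewrite divr_ge0// -lee_fin.
have /kc : (0 < k < 1)%R by rewrite /k; apply/andP; split; lra.
rewrite -EFinM lee_fin -ler_pdivlMr// leNgt => /negP; apply.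
rewrite /k; lra.
Qed.

End net_content_continuity.

Section choquet.
Context {R : realType} {S : finType} (w : nat -> R).
Hypothesis w_ge0 : forall n, 0 <= w n.
Local Open Scope ereal_scope.

(** Entries of the witness are bounded one at a time. As the bound on the next entry grows, the sets
    increase to the one without that bound, and continuity from below yields a bound that keeps the
    content above [e]. *)
Lemma choquet (F : (nat -> S) -> (nat -> nat) -> Prop) (e : \bar R) :
  e < content w [set b | exists x, F b x] [::] ->
  exists n : nat -> nat, forall k,
    e < content w [set b | exists x, (forall i, (i < k)%N -> (x i <= n i)%N) /\ F b x] [::].
Proof.
move=> eE.
pose G (y : seq nat) : set (nat -> S) := [set b | exists x,
  (forall i, (i < size y)%N -> (x i <= nth 0%N y i)%N) /\ F b x].
have [||n Hn] := @dependent_choice_seq nat (fun y => e < content w (G y) [::]).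
- rewrite (_ : G [::] = [set b | exists x, F b x])//.
  by apply/seteqP; split=> b [x]; [case|]; exists x.
- move=> y ey; apply: contrapT => /forallNP nG.
  suff: content w (G y) [::] <= e by rewrite leNgt ey.
  rewrite (_ : G y = \bigcup_a G (rcons y a)).
    apply: content_bigcup => //; last by move=> a; rewrite leNgt; apply/negP.
    move=> a a' aa' b [x [xy Fbx]]; exists x; split=> // i.
    rewrite size_rcons => iy; have := xy i; rewrite size_rcons iy !nth_rcons => /(_ isT).
    move: iy; rewrite ltnS leq_eqVlt; have [//|//|_ _ xa] := ltngtP i (size y).
    exact: leq_trans aa'.
  apply/seteqP; split=> [b [x [xy Fbx]]|b [a _ [x [xy Fbx]]]].
    exists (x (size y)) => //; exists x; split=> // i.
    rewrite size_rcons ltnS leq_eqVlt nth_rcons => /predU1P[->|iy].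
      by rewrite ltnn eqxx.
    by rewrite iy xy.
  exists x; split=> // i iy; have := xy i; rewrite size_rcons nth_rcons iy => H.
  by apply: H; exact: ltnW.
- exists n => k; have := Hn k; congr (_ < content w _ _).
  apply/seteqP; split=> b [x [xy Fbx]]; exists x; split=> // i.
    by move=> ik; have := xy i; rewrite size_mkseq nth_mkseq//; apply.
  by rewrite size_mkseq => ik; rewrite nth_mkseq// xy.
Qed.

End choquet.

(** * Distributing a mass along the branches of a tree *)

Section flow.
Context {R : realType} {S : finType} (g : seq S -> R).
Hypothesis g_ge0 : forall s, 0 <= g s.
Hypothesis g_children : forall s, g s <= \sum_(a : S) g (rcons s a).
Hypothesis g_gt0 : 0 < g [::].
Variable a0 : S.

(* Nodes of the tree are reversed words; the mass of a node is divided between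
   its children in proportion to g, and nodes are laid out as half-open
   intervals in the order of the enumeration of S. *)
Fixpoint mass (r : seq S) : R :=
  if r is a :: r' then mass r' * g (rev r) / \sum_(c : S) g (rcons (rev r') c)
  else g [::].

Definition offset (r : seq S) (j : nat) : R :=
  \sum_(c : S | (enum_rank c < j)%N) mass (c :: r).

Fixpoint left_end (r : seq S) : R :=
  if r is a :: r' then left_end r' + offset r' (enum_rank a) else 0.

Definition node (r : seq S) : set R :=
  [set u | left_end r <= u < left_end r + mass r].

Lemma mass_ge0 r : 0 <= mass r.
Proof.
elim: r => [|a r IH] /=; first exact: ltW.
by rewrite !mulr_ge0// invr_ge0 sumr_ge0.
Qed.

Lemma mass_le r : mass r <= g (rev r).
Proof.
elim: r => [|a r IH] //.
have [s0|s0] := eqVneq (\sum_(c : S) g (rcons (rev r) c)) 0.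
  by rewrite /= s0 invr0 mulr0.
have sp : 0 < \sum_(c : S) g (rcons (rev r) c) by rewrite lt_neqAle eq_sym s0 sumr_ge0.
rewrite /= ler_pdivrMr// mulrC ler_wpM2l//.
exact: le_trans (g_children _).
Qed.

Lemma mass_children r : mass r = \sum_(a : S) mass (a :: r).
Proof.
rewrite /= -mulr_suml -mulr_sumr.
under [X in _ * X / _]eq_bigr do rewrite rev_cons.
have [s0|s0] := eqVneq (\sum_(c : S) g (rcons (rev r) c)) 0; last by rewrite mulfK.
(* If [g] vanishes on all children, division by zero gives them mass 0. No mass is lost, since mass
   r <= g (rev r) <= 0. *)
rewrite s0 mulr0 mul0r; apply/eqP; rewrite eq_le mass_ge0 andbT.
by rewrite (le_trans (mass_le r))// -s0.
Qed.

Lemma offset_le r i j : (i <= j)%N -> offset r i <= offset r j.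
Proof.
move=> ij; rewrite /offset [leRHS]big_mkcond [leLHS]big_mkcond/=.
apply: ler_sum => c _; case: ifPn => ci; first by rewrite (leq_trans ci).
by case: ifPn => // _; exact: (mass_ge0 (c :: r)).
Qed.

Lemma offsetS r a : offset r (enum_rank a).+1 = offset r (enum_rank a) + mass (a :: r).
Proof.
rewrite /offset (bigD1 a)//= addrC; congr (_ + _); apply: eq_bigl => c.
by rewrite ltnS ltn_neqAle andbC (inj_eq val_inj) (inj_eq enum_rank_inj).
Qed.

Lemma offset_max r : offset r #|S| = mass r.
Proof. by rewrite mass_children; apply: eq_bigl => c; rewrite ltn_ord. Qed.

Lemma node_consE a r u : node (a :: r) u =
  (left_end r + offset r (enum_rank a) <= u
    < left_end r + offset r (enum_rank a).+1) :> Prop.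
Proof. by rewrite offsetS addrA. Qed.

Lemma node_sub a r : node (a :: r) `<=` node r.
Proof.
move=> u; rewrite node_consE => /andP[lu ul].
have := offset_le r (leq0n (enum_rank a)); rewrite {1}/offset big_pred0// => o0.
have := offset_le r (ltn_ord (enum_rank a)); rewrite offset_max => om.
by apply/andP; split; lra.
Qed.

Lemma node_child u r : node r u -> exists a, node (a :: r) u.
Proof.
move=> /andP[lu ul].
have ex : exists j, u < left_end r + offset r j by exists #|S|; rewrite offset_max.
have jS : (ex_minn ex <= #|S|)%N.
  by case: ex_minnP => j _; apply; rewrite offset_max.
(* The least partial sum beyond [u] is not the empty one, so it has an index of the form [j.+1], and
   the child number [j] contains [u]. *)
move: jS; case: ex_minnP => -[|j] uj jmin.
  by move: uj; rewrite /offset big_pred0// addr0 ltNge lu.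
move=> jS; exists (enum_val (Ordinal jS)).
rewrite node_consE enum_valK.
apply/andP; split=> //; rewrite leNgt; apply/negP => /jmin.
by rewrite ltnn.
Qed.

Lemma node_inj u r r' : size r = size r' -> node r u -> node r' u -> r = r'.
Proof.
elim: r r' => [|a r IH] [|a' r']// [sr] ra ra'.
have rr' : r = r' by apply: IH; [|exact: node_sub ra|exact: node_sub ra'].
subst r'; congr (_ :: _); apply: contrapT => aa'.
wlog : a a' ra ra' aa' / (enum_rank a < enum_rank a')%N.
  move=> H; have [?|?|] := ltngtP (enum_rank a) (enum_rank a').
  - exact: (H a a').
  - by apply: (H a' a) => // e; exact: aa'.
  - by move/val_inj/enum_rank_inj.
move: ra ra'; rewrite !node_consE.
by move=> /andP[_ ua] /andP[ua' _] /(offset_le r); lra.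
Qed.

Fixpoint route (u : R) (n : nat) : seq S :=
  if n is n'.+1 then
    odflt a0 [pick a | (left_end (a :: route u n') <= u <
                        left_end (a :: route u n') + mass (a :: route u n'))]
    :: route u n'
  else [::].

Lemma size_route u n : size (route u n) = n.
Proof. by elim: n => //= n ->. Qed.

Lemma node_route u n : node [::] u -> node (route u n) u.
Proof.
move=> u0; elim: n => // n IH; rewrite [route _ _]/=.
case: pickP => [a //|H]; have [a] := node_child IH.
by rewrite /node /= H.
Qed.

(** Sends stray points to the left end of the root interval, so that every real number, and not
    merely almost every one, determines a branch on which [g] is positive. *)
Definition clamp (u : R) : R := if u \in node [::] then u else 0.

Lemma node_clamp u : node [::] (clamp u).
Proof.
rewrite /clamp; case: ifPn => [/[!inE]//|_].
by rewrite /node /= add0r lexx.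
Qed.

Lemma nodeE r : node r = `[left_end r, left_end r + mass r[%classic.
Proof. by apply/seteqP; split=> u /=; rewrite in_itv. Qed.

Lemma measurable_clamp : measurable_fun [set: R] clamp.
Proof.
apply: measurable_fun_ifT => //; apply: (measurable_fun_bool true).
rewrite setTI (_ : _ @^-1` _ = node [::]); first by rewrite nodeE.
by apply/seteqP; split=> u; [move=> /set_mem|move=> /mem_set].
Qed.

Definition ray (u : R) (n : nat) : S := head a0 (route (clamp u) n.+1).

Lemma mkseq_ray u n : mkseq (ray u) n = rev (route (clamp u) n).
Proof. by elim: n => // n IH; rewrite mkseqS IH /ray [route _ n.+1]/= rev_cons. Qed.

(** A half-open interval that contains a point has positive length, and this length is at most
    [g]. *)
Lemma g_ray u n : 0 < g (mkseq (ray u) n).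
Proof.
have /andP[] := node_route n (node_clamp u).
rewrite mkseq_ray; have := mass_le (route (clamp u) n); lra.
Qed.

Lemma ray_preimage s : [set u | mkseq (ray u) (size s) = s] = clamp @^-1` node (rev s).
Proof.
apply/seteqP; split=> u /=; rewrite mkseq_ray.
  by move=> <-; rewrite revK; apply: node_route; exact: node_clamp.
move=> us; apply: (can_inj revK); rewrite revK.
apply: (@node_inj (clamp u)) => //; last by apply: node_route; exact: node_clamp.
by rewrite size_route size_rev.
Qed.

Lemma measurable_ray s : measurable [set u | mkseq (ray u) (size s) = s].
Proof.
by rewrite ray_preimage -[X in measurable X]setTI; apply: measurable_clamp => //;
  rewrite nodeE.
Qed.

Lemma measure_ray s : (lebesgue_measure
  ([set u | mkseq (ray u) (size s) = s] `&` `[0%R, g [::]%R[%classic) <= (g s)%:E)%E.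
Proof.
apply: (@le_trans _ _ (lebesgue_measure (node (rev s)))).
  apply: le_measure; rewrite ?inE.
  - by apply: measurableI => //; exact: measurable_ray.
  - by rewrite nodeE.
  - move=> u []; rewrite ray_preimage/= => + u0.
    by rewrite /clamp ifT// inE nodeE /= add0r.
rewrite nodeE lebesgue_measure_itv/= lte_fin; case: ifPn => _; last by rewrite lee_fin.
by rewrite -EFinB addrAC subrr add0r lee_fin -[in leRHS](revK s) mass_le.
Qed.

End flow.

Section frostman_cantor.
Context {R : realType} {S : finType} (w : nat -> R).
Hypothesis w_ge0 : forall n, 0 <= w n.

(* Choquet's argument provides finitely branching approximations G k of E whose
   contents stay bounded below; the flow along their limiting content g only
   charges rays that meet every G k, and these lie in E by König's lemma. *)
Lemma frostman_cantor (E : set (nat -> S)) :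
  analytic E -> (0 < content w E [::])%E ->
  exists (M : R) (p : R -> nat -> S), [/\ 0 < M, forall u, E (p u),
    forall s, measurable [set u | mkseq (p u) (size s) = s] &
    forall s, (lebesgue_measure ([set u | mkseq (p u) (size s) = s] `&`
      `[0%R, M[%classic) <= (w (size s))%:E)%E].
Proof.
move=> [F clF ->] E0; set E' := [set b | _] in E0.
have Efin : content w E' [::] \is a fin_num by exact: content_fin_num.
pose e := fine (content w E' [::]) / 2.
have e0 : 0 < e by rewrite divr_gt0// fine_gt0// E0 ltey_eq Efin.
have : (e%:E < content w E' [::])%E.
  rewrite -(fineK Efin) lte_fin; move: e0; rewrite /e; lra.
move=> /(choquet w_ge0)[n Hn].
pose G k : set (nat -> S) :=
  [set b | exists x, (forall i, (i < k)%N -> (x i <= n i)%N) /\ F b x].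
have Gdec k k' : (k <= k')%N -> G k' `<=` G k.
  by move=> kk' b [x [xn Fb]]; exists x; split=> // i ik; apply: xn; exact: leq_trans kk'.
(* Contents decrease in [k], and finite sums over children commute with the limit, so the inequality
   between a node and its children survives. *)
pose c s := ereal_inf (range (fun k => content w (G k) s)).
have c_lb s k : (c s <= content w (G k) s)%E by apply: ereal_inf_lbound; exists k.
have c_ge0 s : (0 <= c s)%E.
  by apply: le_ereal_inf_tmp => _ [k _ <-]; exact: content_ge0.
have c_cvg s : (fun k => content w (G k) s) @ \oo --> c s.
  apply: ereal_nonincreasing_cvgn => k k' kk'.
  by apply: content_mono; exact: Gdec.
have c_le s : (c s <= (w (size s))%:E)%E.
  by apply: le_trans (c_lb s 0%N) _; exact: content_le.
have c_fin s : c s \is a fin_num.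
  by rewrite ge0_fin_numE// (le_lt_trans (c_le s))// ltry.
have c_children s : (c s <= \sum_(a : S) c (rcons s a))%E.
  have cL : (fun k => \sum_(a : S) content w (G k) (rcons s a))%E @ \oo -->
      (\sum_(a : S) c (rcons s a))%E.
    apply: cvg_nnesum => a _; last exact: c_cvg.
    by near=> k; exact: content_ge0.
  rewrite -(cvg_lim _ cL)//; apply: lime_ge; first by apply/cvg_ex; eexists; exact: cL.
  by near=> k; apply: le_trans (c_lb s k) _; exact: content_children.
pose g s := fine (c s).
have g_ge0 s : 0 <= g s by exact: fine_ge0.
have g_children s : g s <= \sum_(a : S) g (rcons s a).
  rewrite -lee_fin fineK//; apply: le_trans (c_children s) _.
  by rewrite -sumEFin; apply: lee_sum => a _; rewrite fineK.
have g_gt0 : 0 < g [::].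
  apply: (lt_le_trans e0); rewrite -lee_fin fineK//.
  by apply: le_ereal_inf_tmp => _ [k _ <-]; exact/ltW/Hn.
have [a0 _] : exists a : S, True.
  apply: contrapT => /forallNP nS; move: (g_children [::]).
  by rewrite big1 ?leNgt ?g_gt0// => a; case: (nS a).
exists (g [::]), (ray g a0); split => //.
(* Positive [g] at the prefix of length [m] prevents the cylinder from missing [G m]; a common point
   is the witness at precision [m]. *)
- move=> u; apply: (konig clF (n := n)) => m.
  have : 0 < g (mkseq (ray g a0 u) m) by exact: g_ray.
  rewrite -lte_fin fineK// => /lt_le_trans /(_ (c_lb _ m)).
  have [G0|/set0P[b [[x [xn Fb]] bu]] _] := eqVneq (G m `&` cyl (mkseq (ray g a0 u) m)) set0.
    by rewrite content0// ltxx.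
  exists b, x; split => // i im.
  move: bu; rewrite /cyl /= size_mkseq => /(congr1 (nth a0 ^~ i)).
  by rewrite !nth_mkseq.
- by move=> s; exact: measurable_ray.
- move=> s; apply: le_trans (measure_ray g_ge0 g_children g_gt0 a0 s) _.
  by rewrite fineK.
Unshelve. all: by end_near. Qed.

End frostman_cantor.

(** * Frostman's lemma for the parabolic content of a Borel graph *)

HB.instance Definition _ (aT : finType) (rT : pointedType) :=
  isPointed.Build {ffun aT -> rT} [ffun=> point].

(** The parity of the integer part of 2 x is the next binary digit of x; both the coding of points
    and the chaining argument rest on it. *)
Lemma truncn_double {R : realType} (x : R) : 0 <= x ->
  Num.truncn (2 * x) = ((Num.truncn x).*2 + odd (Num.truncn (2 * x)))%N.
Proof.
move=> x0; rewrite -[LHS]odd_double_half addnC; congr (_.*2 + _)%N.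
have /andP[a b] := truncn_itv x0.
have x20 : 0 <= 2 * x by rewrite mulr_ge0.
set k := Num.truncn x in a b *.
have ub : (Num.truncn (2 * x) < k.*2.+2)%N.
  by rewrite truncn_lt_nat// -doubleS -muln2 natrM mulrC ltr_pM2r.
have lb : (k.*2 <= Num.truncn (2 * x))%N.
  by rewrite truncn_ge_nat// -muln2 natrM mulrC ler_pM2l.
move: ub lb; set n := Num.truncn (2 * x) => ub lb.
have [->|->] : n = k.*2 \/ n = k.*2.+1 by clearbody n k; lia.
  by rewrite doubleK.
by rewrite -uphalfE uphalf_double.
Qed.

Lemma half_exp_small {R : realType} (e : R) : 0 < e -> exists n, 2^-1 ^+ n < e.
Proof.
move=> e0; exists (Num.truncn e^-1).+1.
rewrite exprVn invf_plt ?posrE ?exprn_gt0//.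
apply: lt_le_trans (truncnS_gt e^-1) _.
by rewrite -natrX ler_nat ltnW// ltn_expl.
Qed.

(* A point of space-time has one time coordinate (None) and d space coordinates
   (Some i). A word of length m fixes the first floor(m) = m binary digits of the
   time coordinate and the first floor(m H) digits of each space coordinate, so
   that its cell is comparable to a parabolic box of size 2^-m. *)
Section parabolic_code.
Context {R : realType} {d : nat}.
Variable H : R.
Hypothesis H01 : 0 < H < 1.

Local Notation J := (option 'I_d).
Local Notation S := {ffun J -> bool}.
Implicit Types (j : J) (b : nat -> S) (m : nat).

Definition expo j : R := if j is Some _ then H else 1.

Definition level j m : nat := Num.truncn (m%:R * expo j).

Lemma expo_gt0 j : 0 < expo j.
Proof. by case/andP: H01; case: j. Qed.

Lemma expo_le1 j : expo j <= 1.
Proof. by case/andP: H01 => _ /ltW; case: j. Qed.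

Lemma level0 j : level j 0 = 0%N.
Proof. by rewrite /level mul0r truncn0. Qed.

Lemma level_time m : level None m = m.
Proof. by rewrite /level mulr1 natrK. Qed.

Lemma level_itv j m : (level j m)%:R <= m%:R * expo j < (level j m)%:R + 1.
Proof.
have := @truncn_itv R (m%:R * expo j); rewrite -natr1; apply.
by rewrite mulr_ge0// ltW// expo_gt0.
Qed.

Lemma level_leS j m : (level j m <= level j m.+1)%N.
Proof.
by apply: le_truncn; rewrite ler_pM2r ?expo_gt0// ler_nat.
Qed.

(** Exponents are at most 1, so a further letter refines each coordinate by at most one binary
    digit, and an alphabet of bit vectors suffices. *)
Lemma level_ltS j m : (level j m.+1 <= (level j m).+1)%N.
Proof.
have /andP[_ lm] := level_itv j m; have /andP[ml _] := level_itv j m.+1.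
rewrite -ltnS -(ltr_nat R) -!natr1; have := expo_le1 j.
move: ml lm; rewrite -natr1 mulrDl mul1r; lra.
Qed.

Lemma level_unbounded j n : exists m, (n <= level j m)%N.
Proof.
exists (Num.truncn (n%:R / expo j)).+1.
rewrite /level truncn_ge_nat ?mulr_ge0 ?(ltW (expo_gt0 j))//.
rewrite -ler_pdivrMr ?expo_gt0// ltW// truncnS_gt//.
Qed.

Definition refines j m : bool := level j m.+1 != level j m.

Lemma levelS j m : level j m.+1 = (level j m + refines j m)%N.
Proof.
rewrite /refines; have := level_leS j m; have := level_ltS j m.
by case: eqP => [->|]; rewrite ?addn0//= addn1 => ? ? ?; apply/eqP; lia.
Qed.

Fixpoint index_of j m b : nat :=
  if m is m'.+1 then
    if refines j m' then ((index_of j m' b).*2 + b m' j)%N else index_of j m' b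
  else 0%N.

Definition lower j m b : R := (index_of j m b)%:R * 2^-1 ^+ level j m.

Lemma index_of_agree j m b b' : agree m b b' -> index_of j m b = index_of j m b'.
Proof.
elim: m => //= m IH bb'; rewrite IH; last exact: agreeS bb'.
by rewrite bb'.
Qed.

Lemma lower_leS j m b : lower j m b <= lower j m.+1 b.
Proof.
rewrite /lower levelS /=; case: refines => /=; last by rewrite addn0.
rewrite addn1 exprSr mulrA [X in _ <= X]mulrAC ler_pM2r ?exprn_gt0//.
by rewrite ler_pdivlMr// -natrM ler_nat muln2 leq_addr.
Qed.

Lemma upper_leS j m b :
  lower j m.+1 b + 2^-1 ^+ level j m.+1 <= lower j m b + 2^-1 ^+ level j m.
Proof.
rewrite /lower levelS /=; case: refines => /=; last by rewrite addn0.
rewrite addn1 exprSr; set e := 2^-1 ^+ _; have e0 : 0 < e by rewrite exprn_gt0.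
have nb : ((index_of j m b).*2 + b m j)%:R + 1 <= 2 * ((index_of j m b)%:R + 1) :> R.
  by rewrite -muln2 natrD natrM; case: (b m j) => /=; lra.
rewrite mulrA -mulrDl -[X in X <= _](_ : (((index_of j m b).*2 + b m j)%:R + 1) * (e / 2) = _).
  rewrite mulrA ler_pdivrMr// mulrC.
  apply: le_trans (ler_wpM2l (ltW e0) nb) _; rewrite le_eqVlt; apply/orP; left; apply/eqP; ring.
by ring.
Qed.

Definition coord j b : R := sup (range (fun m => lower j m b)).

Lemma lower_mono j m n b : (m <= n)%N -> lower j m b <= lower j n b.
Proof.
move=> /subnK <-; elim: (n - m)%N => // k IH.
by rewrite addSn; apply: le_trans IH (lower_leS _ _ _).
Qed.

Lemma upper_mono j m n b : (m <= n)%N ->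
  lower j n b + 2^-1 ^+ level j n <= lower j m b + 2^-1 ^+ level j m.
Proof.
move=> /subnK <-; elim: (n - m)%N => // k IH.
by rewrite addSn; apply: le_trans (upper_leS _ _ _) IH.
Qed.

Lemma lower_le_upper j m n b : lower j n b <= lower j m b + 2^-1 ^+ level j m.
Proof.
have [mn|/ltnW nm] := leqP m n.
  by apply: le_trans (upper_mono j b mn); rewrite lerDl exprn_ge0// ltW.
by apply: le_trans (lower_mono j b nm) _; rewrite lerDl exprn_ge0// ltW.
Qed.

Lemma lower_ub j b : has_ubound (range (fun m => lower j m b)).
Proof. by exists (lower j 0 b + 2^-1 ^+ level j 0) => _ [n _ <-]; exact: lower_le_upper. Qed.

Lemma coord_itv j m b : lower j m b <= coord j b <= lower j m b + 2^-1 ^+ level j m.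
Proof.
apply/andP; split; first by apply: ub_le_sup; [exact: lower_ub|exists m].
apply: ge_sup; first by exists (lower j 0 b), 0%N.
by move=> _ [n _ <-]; exact: lower_le_upper.
Qed.

Lemma cvg_lower j b : (fun m => lower j m b) @ \oo --> coord j b.
Proof.
apply: nondecreasing_cvgn; last exact: lower_ub.
by move=> m n mn; exact: lower_mono.
Qed.

(* Unrefined coordinates carry the digit false, so that a word is determined by
   the dyadic cells of its coordinates. *)
Definition canonical : set (nat -> S) :=
  [set b | forall m j, ~~ refines j m -> b m j = false].

Lemma canonical_inj m b b' : canonical b -> canonical b' ->
  (forall j, index_of j m b = index_of j m b') -> mkseq b m = mkseq b' m.
Proof.
move=> cb cb'; elim: m => // m IH bb'; rewrite !mkseqS.
have half j : index_of j m b = index_of j m b' /\ b m j = b' m j.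
  have := bb' j; rewrite /=; case: ifPn => [_ e|rj ->]; last by rewrite cb// cb'.
  have := congr1 odd e; rewrite !oddD !odd_double !oddb /= => bj; split => //.
  by move: e; rewrite bj => /addIn /double_inj.
by rewrite IH => [|j]; [congr rcons; apply/ffunP => j|]; have [] := half j.
Qed.

Definition digits (x : J -> R) (m : nat) : S :=
  [ffun j => refines j m && odd (Num.truncn (2 ^+ level j m.+1 * x j))].

Lemma canonical_digits x : canonical (digits x).
Proof. by move=> m j /negbTE rj; rewrite ffunE rj. Qed.

Lemma index_of_digits x j m : 0 <= x j < 1 ->
  index_of j m (digits x) = Num.truncn (2 ^+ level j m * x j).
Proof.
move=> /andP[x0 x1]; elim: m => [|m IH] /=.
  by rewrite level0 mul1r; apply/esym/eqP; rewrite -leqn0 -ltnS truncn_lt_nat.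
rewrite IH ffunE levelS; have [rj|rj] := boolP (refines j m); last by rewrite addn0.
by rewrite addn1 /= exprS -mulrA -truncn_double// mulr_ge0// exprn_ge0.
Qed.

(** Both numbers lie in the same dyadic intervals, whose lengths tend to 0 because levels are
    unbounded. *)
Lemma coord_digits x j : 0 <= x j < 1 -> coord j (digits x) = x j.
Proof.
move=> /[dup] xj /andP[x0 x1]; apply/eqP; rewrite -subr_eq0 -normr_le0.
apply/ler_addgt0Pr => e e0; rewrite add0r.
have [n ne] := half_exp_small e0; have [m nm] := level_unbounded j n.
have le2 : 2^-1 ^+ level j m <= e.
  apply: le_trans (ltW ne); apply: ler_wiXn2l => //; rewrite ?invr_ge0// invf_le1//; lra.
apply: le_trans le2.
have /andP[c1 c2] := coord_itv j m (digits x).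
have lx : lower j m (digits x) <= x j <= lower j m (digits x) + 2^-1 ^+ level j m.
  rewrite /lower index_of_digits//.
  set p := 2 ^+ level j m; have p0 : 0 < p :> R by rewrite exprn_gt0.
  have /andP[t1 t2] := truncn_itv (mulr_ge0 (ltW p0) x0).
  rewrite exprVn -/p ler_pdivrMr// [x j * p]mulrC t1/= -[X in _ <= _ + X]mul1r -mulrDl.
  by rewrite ler_pdivlMr// [x j * p]mulrC natr1 ltW.
rewrite ler_norml; apply/andP; split; case/andP: lx; lra.
Qed.

End parabolic_code.

Lemma measurable_word_fun {R : realType} {S : finType} {dU : measure_display}
    {U : measurableType dU} (p : U -> nat -> S) (phi : seq S -> R) (m : nat) :
  (forall s, measurable [set u | mkseq (p u) (size s) = s]) ->
  measurable_fun [set: U] (fun u => phi (mkseq (p u) m)).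
Proof.
move=> mp _ B mB; rewrite setTI.
rewrite (_ : _ @^-1` B = \bigcup_(s in [set: seq S])
   (if (size s == m) && (phi s \in B) then [set u | mkseq (p u) (size s) = s] else set0)).
  apply: countable_bigcupT_measurable; first exact: countableP.
  by move=> s; case: ifP.
apply/seteqP; split=> [u uB|u [s _]].
  by exists (mkseq (p u) m) => //; rewrite size_mkseq eqxx /= mem_set//= size_mkseq.
by case: ifPn => //= /andP[/eqP<- /set_mem Bs] ->.
Qed.

Section parabolic_frostman.
Context {R : realType} {d : nat}.
Variable H : R.
Hypothesis H01 : 0 < H < 1.

Local Notation J := (option 'I_d).
Local Notation S := {ffun J -> bool}.

Lemma measurable_coord {dU : measure_display} {U : measurableType dU}
    (p : U -> nat -> S) (j : J) :
  (forall s, measurable [set u | mkseq (p u) (size s) = s]) ->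
  measurable_fun [set: U] (fun u => coord H j (p u)).
Proof.
move=> mp; apply: (measurable_fun_cvg (h := fun m u => lower H j m (p u))).
  move=> m; pose phi (s : seq S) := lower H j m (nth point s).
  apply: eq_measurable_fun (measurable_word_fun phi m mp) => u _ /=.
  rewrite /phi /lower; congr (_%:R * _); apply: index_of_agree => i im.
  by rewrite nth_mkseq.
by move=> u _; exact: cvg_lower.
Qed.

Variables (f : R -> 'rV[R]_d) (A : set R).
Hypothesis mA : measurable A.
Hypothesis mf : forall i, measurable_fun A (fun t => f t ord0 i).

(** Sequences encode fractional parts; the integer vector [l] selects one of countably many unit
    cubes. *)
Definition decode (l : {ffun J -> int}) (j : J) (b : nat -> S) : R :=
  (l j)%:~R + coord H j b.

Definition codes (l : {ffun J -> int}) : set (nat -> S) :=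
  [set b | [/\ canonical H b, A (decode l None b) &
    forall i, f (decode l None b) ord0 i = decode l (Some i) b]].

(** Bianalytic sets serve as the measurable sets of a measurable type on which [decode] is
    measurable. Measurability of [f] on [A] then makes the set of codes bianalytic. *)
Lemma codes_analytic l : analytic (codes l).
Proof.
have gE := sigma_algebra_id (@bianalytic_sigma_algebra S).
pose T := g_sigma_algebraType (@bianalytic S).
suff : measurable (codes l : set T) by rewrite /measurable/= gE => -[].
have mcoordinate n (P : set S) : measurable ([set b | P (b n)] : set T).
  by rewrite /measurable/= gE; exact: bianalytic_coord.
have mcyl s : measurable ([set b | mkseq (b : nat -> S) (size s) = s] : set T).
  rewrite (_ : mkset _ = \bigcap_i [set b | (i < size s)%N -> b i = nth point s i]).
    by apply: bigcapT_measurable => i;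
      exact: (mcoordinate i (fun a => (i < size s)%N -> a = nth point s i)).
  apply/seteqP; split=> [b <- i _ im|b bs]; first by rewrite nth_mkseq// -(size_mkseq b (size s)).
  apply: (@eq_from_nth _ point); rewrite size_mkseq// => i im.
  by rewrite nth_mkseq// bs.
have mdecode j : measurable_fun [set: T] (decode l j).
  by apply: measurable_funD => //; exact: measurable_coord.
pose D : set T := decode l None @^-1` A.
have mD : measurable D by rewrite -[D]setTI; exact: mdecode.
(* The set [D] occurs inside the intersection because [f] is measurable only on [A], and outside
   because the intersection is everything when d = 0. *)
rewrite (_ : codes l = canonical H `&` \bigcap_(i in [set: 'I_d])
    (D `&` [set b | f (decode l None b) ord0 i == decode l (Some i) b]) `&` D).
  apply: measurableI => //; apply: measurableI.
    rewrite (_ : canonical H = \bigcap_m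
        [set b | forall j, ~~ refines H j m -> b m j = false]).
      apply: bigcapT_measurable => m.
      exact: (mcoordinate m (fun a => forall j, ~~ refines H j m -> a j = false)).
    by apply/seteqP; split=> [b cb m _|b cb m]; [exact: cb|exact: (cb m)].
  apply: fin_bigcap_measurable; [exact: finite_finset|move=> i _].
  have mfi : measurable_fun D (fun b => f (decode l None b) ord0 i).
    apply: (@measurable_comp _ _ _ T R R A (fun t => f t ord0 i) D (decode l None)
      mA _ (mf i)); first by move=> _ [b Db <-].
    exact: measurable_funTS.
  have me := measurable_fun_eqr mfi (measurable_funTS (mdecode (Some i))).
  exact: (me mD [set true]).
apply/seteqP; split=> [b [cb Db fb]|b [[cb fb] Db]].
  by split=> //; split=> // i _; split=> //; rewrite /= fb.
by split=> // i; have [_ /eqP] := fb i Logic.I.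
Qed.

End parabolic_frostman.

Section parabolic_frostman_lemma.
Context {R : realType} {d : nat}.
Variable H : R.
Hypothesis H01 : 0 < H < 1.
Variables (f : R -> 'rV[R]_d) (A : set R).
Hypothesis mA : measurable A.
Hypothesis mf : forall i, measurable_fun A (fun t => f t ord0 i).
Variable beta : R.
Hypothesis beta_gt0 : 0 < beta.

Local Notation J := (option 'I_d).
Local Notation S := {ffun J -> bool}.

Definition weight (m : nat) : R := (2^-1 ^+ m) `^ beta.

Lemma weight_ge0 m : 0 <= weight m. Proof. exact: powR_ge0. Qed.

Let H0 : 0 < H. Proof. by case/andP: H01. Qed.
Let half0 : 0 < (2^-1 : R). Proof. by rewrite invr_gt0. Qed.
Let halfX m : 0 < (2^-1 : R) ^+ m. Proof. by rewrite exprn_gt0. Qed.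

Lemma half_level_le (j : J) m : 2^-1 ^+ level H j m <= (2 * (2^-1 ^+ m) `^ expo H j : R).
Proof.
rewrite -!powR_mulrn ?(ltW half0)// -powRrM.
rewrite [X in _ <= X * _](_ : 2 = 2^-1 `^ (-1)); last first.
  by rewrite powR_inv1 ?(ltW half0)// invrK.
rewrite -powRD; last by rewrite (gt_eqF half0)/= implybT.
apply: ger_powR; first by rewrite half0 invf_le1//; lra.
by have /andP[_] := level_itv H01 j m; lra.
Qed.

Lemma half_level_ge (j : J) m : ((2^-1 ^+ m) `^ expo H j : R) <= 2^-1 ^+ level H j m.
Proof.
rewrite -!powR_mulrn ?(ltW half0)// -powRrM.
apply: ger_powR; first by rewrite half0 invf_le1//; lra.
by have /andP[] := level_itv H01 j m.
Qed.

Lemma graph_decode p : graph_on A f p -> exists l b, [/\ codes H f A l b,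
  p.1 = decode H l None b & forall i, p.2 ord0 i = decode H l (Some i) b].
Proof.
move=> [t At <-].
pose x (j : J) := if j is Some i then f t ord0 i else t.
pose l := [ffun j => Num.floor (x j)].
have frac j : 0 <= x j - (l j)%:~R < 1.
  by rewrite ffunE subr_ge0 ltrBlDl floor_le_tmp/= -intrD1 floorD1_gt.
have dec j : decode H l j (digits H (fun j => x j - (l j)%:~R)) = x j.
  by rewrite /decode coord_digits// addrC subrK.
exists l, (digits H (fun j => x j - (l j)%:~R)).
split; [|by rewrite dec|by move=> i; rewrite dec].
split; [exact: canonical_digits|by rewrite dec|by move=> i; rewrite !dec].
Qed.

(** Cheap word covers of all unit cubes are merged into one cover by boxes. Rounding in [level]
    leaves space sides of up to 2 * 2^(-m H), so the cell of a word of length m fits into a box of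
    size 2^(1/H) * 2^(-m), and [c] is the price of this enlargement. *)
Lemma parabolic_content_eq0 :
  (forall l, content weight (codes H f A l) [::] = 0%E) ->
  parabolic_content H beta (graph_on A f) = 0%E.
Proof.
move=> c0; apply/eqP; rewrite eq_le; apply/andP; split; last first.
  apply: le_ereal_inf_tmp => _ [a [b [delta [delta0 _ ->]]]].
  by apply: nneseries_ge0 => n _ _; rewrite lee_fin powR_ge0.
apply/lee_addgt0Pr => e e0; rewrite add0e.
pose c : R := (2 `^ H^-1) `^ beta.
have c_gt0 : 0 < c by rewrite !powR_gt0.
have /choice[D DP] : forall l, exists D, net_cover (codes H f A l) [::] D /\
    (cost weight D <= (e / c / (2 ^ (pickle l).+1)%:R)%:E)%E.
  move=> l; have [||_ [D cD <-] Dl] := @lb_ereal_inf_adherent R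
      [set cost weight D | D in net_cover (codes H f A l) [::]]
      (e / c / (2 ^ (pickle l).+1)%:R).
  - by rewrite !divr_gt0// ltr0n expn_gt0.
  - by have := content_fin_num weight_ge0 (codes H f A l) [::].
  - exists D; split => //; apply: ltW; apply: lt_le_trans Dl _.
    by rewrite -/(content _ _ _) c0 add0e.
pose Q := ({ffun J -> int} * seq S)%type.
pose X : set Q := [set q | D q.1 q.2].
pose lo (q : Q) (j : J) : R := (q.1 j)%:~R + lower H j (size q.2) (nth point q.2).
pose size_of (q : Q) : R := 2 `^ H^-1 * 2^-1 ^+ size q.2.
(* Numbers that code no word of the covers receive a box of size 0, which costs nothing because
   [beta] is positive. *)
pose sel (k : nat) : option Q := if pickle_inv k is Some q then
  (if q \in X then Some q else None) else None.
pose delta k : R := if sel k is Some q then size_of q else 0.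
have selK q : X q -> sel (pickle q) = Some q.
  by move=> Xq; rewrite /sel pickleK_inv mem_set.
have size_of_ge0 q : 0 <= size_of q by rewrite mulr_ge0 ?powR_ge0// ltW.
apply: ge_ereal_inf; exists (\sum_(0 <= k <oo) (delta k `^ beta)%:E)%E.
  exists (fun k => if sel k is Some q then lo q None else 0).
  exists (fun k => \row_i if sel k is Some q then lo q (Some i) else 0).
  exists delta; split => //; first by move=> k; rewrite /delta; case: (sel k).
  move=> p /graph_decode[l [b [bl p1 p2]]].
  have [|t Dt bt] := (DP l).1.2 b; first by [].
  exists (pickle ((l, t) : Q)) => //; rewrite /parabolic_box /delta /= selK//.
  have lob j : lo (l, t) j <= decode H l j b <= lo (l, t) j + 2^-1 ^+ level H j (size t).
    have -> : lo (l, t) j = (l j)%:~R + lower H j (size t) b.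
      rewrite /lo /lower /=; congr (_ + _%:R * _); apply: index_of_agree => i it.
      by rewrite -[in LHS]bt nth_mkseq.
    rewrite /decode -addrA !lerD2l; exact: coord_itv.
  split.
    have /andP[l1 l2] := lob None; rewrite p1 l1/=; apply: le_trans l2 _.
    rewrite lerD2l level_time /size_of ler_peMl ?(ltW (halfX _))//.
    by rewrite -[leLHS](powRr0 2) ler_powR ?ler1n// invr_ge0 ltW.
  move=> i; have /andP[l1 l2] := lob (Some i).
  rewrite mxE p2 l1/=; apply: le_trans l2 _; rewrite lerD2l.
  rewrite /size_of powRM ?powR_ge0 ?(ltW (halfX _))// -powRrM mulVf ?gt_eqF// powRr1//.
  exact: (half_level_le (Some i)).
rewrite nneseries_esumT; last by move=> k; rewrite lee_fin powR_ge0.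
rewrite (_ : (\esum_(k in _) _)%E = (\esum_(k in pickle @` X) (delta k `^ beta)%:E)%E); last first.
  rewrite [RHS]esum_mkcond; apply: eq_esum => k _; case: ifPn => // /negP kX.
  rewrite /delta; case E : (sel k) => [q|]; last by rewrite powR0// gt_eqF.
  exfalso; apply: kX; rewrite inE; move: E; rewrite /sel.
  case Ek : (pickle_inv k) => [q'|//]; case: ifPn => // /set_mem Xq' _.
  exists q' => //; have := @pickle_invK Q k; rewrite /= Ek; exact.
rewrite esum_image; last by move=> x y _ _; exact: (pcan_inj pickleK).
rewrite (_ : (\esum_(q in X) _)%E =
    (\esum_(q in [set: {ffun J -> int}] `*`` D) (c%:E * (weight (size q.2))%:E))%E); last first.
  rewrite (_ : [set: _] `*`` D = X); last by apply/seteqP; split=> [q []|q].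
  apply: eq_esum => q Xq; rewrite /delta selK// /size_of powRM ?powR_ge0 ?(ltW (halfX _))//.
rewrite -(@esum_esum _ _ _ setT D (fun _ t => c%:E * (weight (size t))%:E)%E); last first.
  by move=> l t _ _; rewrite mule_ge0// lee_fin ?powR_ge0// ltW.
apply: le_trans (esum_epsilon [set: {ffun J -> int}] (ltW e0)).
apply: le_esum => l _; rewrite esumZl//; last by move=> t; rewrite lee_fin powR_ge0.
apply: le_trans (lee_wpmul2l _ (DP l).2) _; first by rewrite lee_fin ltW.
rewrite -EFinM lee_fin le_eqVlt; apply/orP; left; apply/eqP.
rewrite !mulrA; congr (_ / _).
by rewrite [c * e]mulrC mulfK// gt_eqF.
Qed.

(** The ball is pulled back to [U], so that no measure has to be transported to the graph. *)
Definition parabolic_ball {U : Type} (tau : U -> R) (t : R) (y : 'rV[R]_d) (rho : R) : set U :=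
  [set u | `|tau u - t| <= rho /\
    forall i, `|f (tau u) ord0 i - y ord0 i| <= rho `^ H].

Lemma measurable_parabolic_ball {dU : measure_display} {U : measurableType dU}
    (tau : U -> R) t y rho : measurable_fun setT tau ->
  (forall i, measurable_fun setT (fun u => f (tau u) ord0 i)) ->
  measurable (parabolic_ball tau t y rho).
Proof.
move=> mtau mftau.
have mle (g : U -> R) (c r : R) : measurable_fun setT g ->
    measurable [set u | `|g u - c| <= r].
  move=> mg; have mb : measurable_fun setT (fun u => `|g u - c| <= r).
    apply: measurable_fun_ler => //; apply: measurableT_comp => //.
    exact: measurable_funB.
  by have := mb measurableT [set true] Logic.I; rewrite setTI.
rewrite (_ : parabolic_ball tau t y rho = [set u | `|tau u - t| <= rho] `&`
    \bigcap_(i in [set: 'I_d]) [set u | `|f (tau u) ord0 i - y ord0 i| <= rho `^ H]).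
  apply: measurableI; first exact: mle.
  by apply: fin_bigcap_measurable; [exact: finite_finset|move=> i _; exact: mle].
by apply/seteqP; split=> [u [tu fu]|u [tu fu]]; split=> // i;
  [move=> _; exact: fu|exact: (fu i Logic.I)].
Qed.

Theorem frostman_graph : parabolic_content H beta (graph_on A f) != 0%E ->
  exists (dU : measure_display) (U : measurableType dU)
    (mu : {finite_measure set U -> \bar R}) (tau : U -> R) (C : R),
  [/\ (0 < mu setT)%E, measurable_fun setT tau, forall u, A (tau u),
    forall i, measurable_fun setT (fun u => f (tau u) ord0 i) &
    forall t y rho, 0 < rho ->
      (mu (parabolic_ball tau t y rho) <= (C * rho `^ beta)%:E)%E].
Proof.
move=> content_neq0.
have [l /eqP cl] : exists l, content weight (codes H f A l) [::] <> 0%E.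
  by apply/existsNP => c0; move/eqP: content_neq0; apply; exact: parabolic_content_eq0.
have {}cl : (0 < content weight (codes H f A l) [::])%E.
  by rewrite lt0e cl content_ge0//; exact: weight_ge0.
have [M [p [M0 pcodes mp lp]]] := frostman_cantor weight_ge0 (codes_analytic H01 mA mf l) cl.
pose I : set (measurableTypeR R) := `[0, M[%classic.
have mI : measurable I by exact: measurable_itv.
have lI : lebesgue_measure I = M%:E.
  by rewrite /I lebesgue_measure_itv/= lte_fin M0 oppr0 adde0.
have Ioo : (lebesgue_measure I < +oo)%E by rewrite lI ltry.
pose mu : {finite_measure set (measurableTypeR R) -> \bar R} := mfrestr mI Ioo.
have muE X : mu X = lebesgue_measure (X `&` I) by [].
pose tau (u : measurableTypeR R) : R := decode H l None (p u).
have ftau u i : f (tau u) ord0 i = decode H l (Some i) (p u).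
  by have [_ _] := pcodes u; exact.
have mdecode j : measurable_fun [set: measurableTypeR R] (fun u => decode H l j (p u)).
  by apply: measurable_funD => //; exact: (measurable_coord (U := measurableTypeR R) H01).
have mftau i : measurable_fun [set: measurableTypeR R] (fun u => f (tau u) ord0 i).
  by apply: eq_measurable_fun (mdecode (Some i)) => u _; rewrite ftau.
(* In each coordinate a ball of radius rho meets at most four consecutive dyadic intervals of the
   matching level; [E] numbers the resulting cells. *)
pose E := {ffun J -> 'I_4}.
exists _, (measurableTypeR R), mu, tau, (M + #|E|%:R * 2 `^ beta); split => //.
- by rewrite muE setTI lI lte_fin.
- exact: mdecode.
- by move=> u; have [] := pcodes u.
move=> t y rho rho0; have mB := measurable_parabolic_ball t y rho (mdecode None) mftau.
have C2 : 0 <= #|E|%:R * 2 `^ beta by rewrite mulr_ge0 ?powR_ge0.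
have [rho1|rho1] := leP 1 rho.
  apply: (@le_trans _ _ (mu setT)); first by apply: le_measure; rewrite ?inE.
  rewrite muE setTI lI lee_fin; apply: (@le_trans _ _ (M * rho `^ beta)).
    rewrite ler_peMr ?(ltW M0)//; have <- : 1 `^ beta = 1 :> R by rewrite powR1.
    by rewrite ge0_ler_powR ?nnegrE ?(ltW beta_gt0) ?(ltW rho0).
  by rewrite ler_wpM2r ?powR_ge0// lerDl.
(* Minimality gives 2^-(m+1) < rho <= 2^-m. Words of length m are used, and their weight is at most
   (2 rho)^beta. *)
have ex := half_exp_small rho0; case: (ex_minnP ex) => -[|m] hm mmin.
  by move: hm; rewrite expr0 ltNge (ltW rho1).
have rhom : rho <= 2^-1 ^+ m.
  by rewrite leNgt; apply/negP => /mmin; rewrite ltnn.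
pose z (j : J) : R := if j is Some i then y ord0 i else t.
pose q (j : J) : R := 2^-1 ^+ level H j m.
have q0 j : 0 < q j by exact: halfX.
have rhoq j : rho `^ expo H j <= q j.
  apply: le_trans (half_level_ge j m).
  by rewrite ge0_ler_powR ?nnegrE ?(ltW (expo_gt0 H01 j)) ?(ltW rho0) ?(ltW (halfX _)).
(* With c the rescaled centre, the radius and the closed cell each contribute one unit: an index k
   satisfies c - 2 <= k <= c + 1, hence base <= k < base + 4. *)
pose base (j : J) : int := Num.floor ((z j - (l j)%:~R) / q j) - 2.
pose Pe (e : E) (u : R) := forall j, (index_of H j m (p u))%:Z = base j + (e j : nat)%:Z.
(* Codes are canonical, so the indices of all coordinates determine the word. If no code has these
   indices, any word of length [m] will do. *)
have /choice[s sP] : forall e : E, exists s : seq S, size s = m /\ forall u, Pe e u -> mkseq (p u) m = s.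
  move=> e; have [[u Pu]|nP] := pselect (exists u, Pe e u); last first.
    exists (nseq m point); split; first by rewrite size_nseq.
    by move=> u Pu; case: nP; exists u.
  exists (mkseq (p u) m); split; first by rewrite size_mkseq.
  move=> v Pv; apply: (canonical_inj (H := H)); [by have [] := pcodes v|by have [] := pcodes u|].
  by move=> j; have := Pv j; rewrite -(Pu j) => -[].
have cover u : parabolic_ball tau t y rho u -> exists e, mkseq (p u) m = s e.
  move=> [tu fu].
  have near_z j : `|decode H l j (p u) - z j| <= q j.
    case: j => [i|]; first by rewrite -ftau; exact: le_trans (fu i) (rhoq (Some i)).
    by apply: le_trans tu _; have := rhoq None; rewrite powRr1// ltW.
  have ej j : exists e : 'I_4, (index_of H j m (p u))%:Z = base j + (e : nat)%:Z.
    have := near_z j; rewrite /decode ler_distl => /andP[z1 z2].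
    have /andP[c1 c2] := coord_itv H01 j m (p u).
    move: c1 c2; rewrite /lower -/(q j); set k := index_of _ _ _ _ => c1 c2.
    pose c := (z j - (l j)%:~R) / q j; have bE : base j = Num.floor c - 2 by [].
    have zc : z j - (l j)%:~R = c * q j by rewrite mulfVK// gt_eqF.
    have k1 : c - 2 <= k%:R by rewrite -(ler_pM2r (q0 j)) mulrBl -zc; lra.
    have k2 : k%:R <= c + 1 by rewrite -(ler_pM2r (q0 j)) mulrDl -zc; lra.
    have f1 : (Num.floor c)%:~R <= c by exact: floor_le_tmp.
    have f2 : c < (Num.floor c + 1)%:~R by exact: floorD1_gt.
    have kb : base j <= k%:Z < base j + 4.
      apply/andP; split.
        by rewrite -(ler_int R) bE intrD; lra.
      by rewrite -(ltr_int R) bE !intrD; move: f2; rewrite intrD; lra.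
    have e4 : (`|k%:Z - base j| < 4)%N by move: kb; clear; lia.
    by exists (Ordinal e4); move: kb; clear => /=; lia.
  have /choice[e eP] := ej; exists [ffun j => e j]; apply: (sP _).2 => j.
  by rewrite ffunE.
pose F (k : nat) : set (measurableTypeR R) :=
  [set u | mkseq (p u) (size (s (nth [ffun=> ord0] (enum E) k))) =
           s (nth [ffun=> ord0] (enum E) k)].
have mF k : measurable (F k) by exact: mp.
have muF k : (mu (F k) <= (weight m)%:E)%E.
  by rewrite muE -(sP (nth [ffun=> ord0] (enum E) k)).1; exact: lp.
apply: (@le_trans _ _ (\sum_(k < #|E|) mu (F k))%E).
  apply: content_subadditive => // u /cover[e ue].
  rewrite -bigcup_mkord; exists (enum_rank e) => /=; first exact: ltn_ord.
  by rewrite /F /= nth_enum_rank (sP e).1.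
apply: (@le_trans _ _ (\sum_(k < #|E|) (weight m)%:E)%E); first by apply: lee_sum => k _.
rewrite sumEFin sumr_const card_ord lee_fin -[leLHS]mulr_natl.
apply: (@le_trans _ _ (#|E|%:R * 2 `^ beta * rho `^ beta)); last first.
  apply: ler_wpM2r; first exact: powR_ge0.
  by rewrite lerDr ltW.
rewrite -mulrA ler_wpM2l// -powRM ?(ltW rho0)// /weight.
rewrite ge0_ler_powR ?nnegrE ?(ltW beta_gt0)// ?mulr_ge0 ?(ltW (halfX _)) ?(ltW rho0)//.
by move: hm; rewrite exprS; lra.
Qed.

End parabolic_frostman_lemma.

(** * Gaussian estimates and Hölder continuity *)

Lemma geometric_eseries_le {R : realType} (a x : R) : 0 <= a -> 0 < x < 1 ->
  (\sum_(0 <= k <oo) (a * x ^+ k)%:E <= (a / (1 - x))%:E)%E.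
Proof.
move=> a0 /andP[x0 x1]; apply: lime_le.
  by apply: is_cvg_nneseries => n _ _; rewrite lee_fin mulr_ge0// exprn_ge0// ltW.
near=> n; rewrite sumEFin lee_fin.
by apply: geometric_le_lim => //; rewrite gtr0_norm.
Unshelve. all: by end_near. Qed.

Lemma ge0_integral_le_series {R : realType} {dT : measure_display}
    {T : measurableType dT} (mu : {measure set T -> \bar R}) (g : T -> \bar R)
    (c : nat -> R) (B : nat -> set T) :
  measurable_fun setT g -> (forall x, 0 <= g x)%E ->
  (forall k, 0 <= c k) -> (forall k, measurable (B k)) ->
  (forall x, g x <= \sum_(0 <= k <oo) (c k)%:E * (\1_(B k) x)%:E)%E ->
  (\int[mu]_x g x <= \sum_(0 <= k <oo) (c k)%:E * mu (B k))%E.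
Proof.
move=> mg g0 c0 mB gle.
have mcB k : measurable_fun setT (fun x => (c k)%:E * (\1_(B k) x)%:E)%E.
  by apply: emeasurable_funM => //; apply/measurable_EFinP; exact: measurable_indic.
have cB0 k x : (0 <= (c k)%:E * (\1_(B k) x)%:E)%E by rewrite mule_ge0// lee_fin.
apply: (@le_trans _ _ (\int[mu]_x (\sum_(0 <= k <oo) (c k)%:E * (\1_(B k) x)%:E))%E).
  apply: ge0_le_integral => //; apply: ge0_emeasurable_sum => //.
rewrite integral_nneseries//.
rewrite le_eqVlt; apply/orP; left; apply/eqP; apply: eq_eseriesr => k _.
have mi : measurable_fun setT (fun x => (\1_(B k) x)%:E : \bar R).
  by apply/measurable_EFinP; exact: measurable_indic.
have i0 x : [set: T] x -> (0 <= (\1_(B k) x)%:E :> \bar R)%E by rewrite lee_fin.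
by rewrite ge0_integralZl_EFin// integral_indic// setIT.
Qed.

(** The inequality 1 + x <= exp x at x = y / q, inverted and raised to the power q. *)
Lemma expRN_le_powR {R : realType} (q y : R) : 0 < q -> 0 < y ->
  expR (- y) <= (q / y) `^ q.
Proof.
move=> q0 y0; have -> : - y = (- (y / q)) * q by rewrite mulNr mulfVK// gt_eqF.
rewrite expRM; apply: ge0_ler_powR; rewrite ?nnegrE ?expR_ge0 ?divr_ge0 ?(ltW q0) ?(ltW y0)//.
- rewrite expRN -[leRHS]invf_div lef_pV2 ?posrE ?expR_gt0 ?divr_gt0//.
  by apply: le_trans (expR_ge1Dx (y / q)); lra.
Qed.

(** * Gaussian laws: parameters, tails and small balls *)

Section normal_bounds.
Context {R : realType}.
Implicit Types (m s x q : R).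

Lemma normal_peak_le s : 0 < s -> normal_peak s <= s^-1.
Proof.
move=> s0; rewrite /normal_peak lef_pV2 ?posrE ?sqrtr_gt0//; last first.
  by rewrite -mulr_natr !mulr_gt0// pi_gt0.
rewrite -[leLHS](gtr0_norm s0) -sqrtr_sqr ler_wsqrtr// -mulr_natr -mulrA.
by rewrite ler_peMr ?sqr_ge0//; have := pi_ge2 R; lra.
Qed.

Lemma normal_peak_sqrt2 s : normal_peak (Num.sqrt 2 * s) = (Num.sqrt 2)^-1 * normal_peak s.
Proof.
rewrite /normal_peak -invfM -sqrtrM//; congr (Num.sqrt _)^-1.
by rewrite exprMn sqr_sqrtr//; ring.
Qed.

(** Half of the exponent is kept as a decay factor; the other half is the density with doubled
    variance, whose total integral is 1. Tail bounds follow with no integral to compute. *)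
Lemma normal_pdf_split m s x : 0 < s ->
  normal_pdf m s x = Num.sqrt 2 * expR (- (x - m) ^+ 2 / (4 * s ^+ 2)) *
    normal_pdf m (Num.sqrt 2 * s) x.
Proof.
move=> s0; have s20 : 0 < Num.sqrt 2 * s :> R by rewrite mulr_gt0// sqrtr_gt0.
have sq2 : Num.sqrt 2 != 0 :> R by rewrite gt_eqF// sqrtr_gt0.
rewrite !normal_pdfE ?gt_eqF// /normal_fun normal_peak_sqrt2.
have -> : (Num.sqrt 2 * s) ^+ 2 = 2 * s ^+ 2 by rewrite exprMn sqr_sqrtr.
have split_exp (a b : R) : b != 0 -> - a / (b *+ 2) = - a / (4 * b) + - a / (2 * b *+ 2).
  by move=> b0; field.
rewrite split_exp ?gt_eqF ?exprn_gt0// expRD.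
move: (expR _) (expR _) (normal_peak s) (Num.sqrt 2 : R) sq2 => e1 e2 pk r r0.
by field.
Qed.

End normal_bounds.

Section normal_measure.
Context {R : realType}.
Implicit Types (m s x q c : R).
Local Notation leb := (@lebesgue_measure R).

Lemma normal_prob_le_pdf m s c (B : set R) : measurable B ->
  (forall x, B x -> normal_pdf m s x <= c) -> 0 <= c ->
  (normal_prob m s B <= c%:E * leb B)%E.
Proof.
move=> mB Bc c0; rewrite /normal_prob.
apply: (@le_trans _ _ (\int[leb]_(x in B) (cst c%:E) x)%E); last by rewrite integral_cst.
apply: ge0_le_integral => //.
- by move=> x _; rewrite lee_fin normal_pdf_ge0.
- by apply/measurable_EFinP/measurable_funTS; exact: measurable_normal_pdf.
Qed.

Lemma normal_prob_le_exp m s c (B : set R) : 0 < s -> measurable B ->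
  (forall x, B x -> expR (- (x - m) ^+ 2 / (4 * s ^+ 2)) <= c) -> 0 <= c ->
  (normal_prob m s B <= (2 * c)%:E)%E.
Proof.
move=> s0 mB Bc c0; rewrite /normal_prob.
have sqrt2 : Num.sqrt 2 <= 2 :> R.
  by rewrite -[leRHS]ger0_norm// -sqrtr_sqr ler_wsqrtr// expr2; lra.
have mp := @measurable_normal_pdf R m (Num.sqrt 2 * s).
apply: (@le_trans _ _ (\int[leb]_(x in B) ((2 * c)%:E * (normal_pdf m (Num.sqrt 2 * s) x)%:E))%E).
  apply: ge0_le_integral => //.
  - by move=> x _; rewrite lee_fin normal_pdf_ge0.
  - by apply/measurable_EFinP/measurable_funTS; exact: measurable_normal_pdf.
  - by apply: emeasurable_funM => //; apply/measurable_EFinP/measurable_funTS.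
  move=> x Bx; rewrite -EFinM lee_fin normal_pdf_split// ler_wpM2r ?normal_pdf_ge0//.
  by rewrite ler_pM ?expR_ge0 ?sqrtr_ge0// Bc.
rewrite ge0_integralZl_EFin//; last 3 first.
- by move=> x _; rewrite lee_fin normal_pdf_ge0.
- by apply/measurable_EFinP/measurable_funTS.
- by rewrite mulr_ge0.
rewrite -[leRHS]mule1 lee_wpmul2l ?lee_fin ?mulr_ge0//.
by rewrite -(integral_normal_pdf m (Num.sqrt 2 * s)); apply: ge0_subset_integral => //;
  [exact/measurable_EFinP|move=> x _; rewrite lee_fin normal_pdf_ge0].
Qed.

End normal_measure.

Section gaussian_rv_bounds.
Context {R : realType} {disp : measure_display} {Omega : measurableType disp}.
Variables (P : probability Omega R) (Y : Omega -> R) (tau : R).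
Hypothesis tau0 : 0 < tau.
Hypothesis gY : gaussian_rv P Y.
Hypothesis EY : 'E_P[Y]%E = 0%E.
Hypothesis EY2 : 'E_P[Y \* Y]%E = (tau ^+ 2)%:E.

Let mY : measurable_fun setT Y. Proof. by case: gY. Qed.

Lemma gaussian_second_moment (m : R) :
  (\int[P]_w ((Y w - m) ^+ 2)%:E = (tau ^+ 2 + m ^+ 2)%:E)%E.
Proof.
have mY2 : measurable_fun setT (fun w => Y w * Y w) by exact: measurable_funM.
move: EY EY2; rewrite unlock => EY' EY2'.
have I2 : P.-integrable setT (EFin \o (fun w => Y w * Y w)).
  apply/integrableP; split; first exact/measurable_EFinP.
  under eq_integral => w _ do rewrite /= ger0_norm -?expr2 ?sqr_ge0// expr2.
  by rewrite EY2' ltry.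
have Ic c : P.-integrable setT (EFin \o cst c) by exact: finite_measure_integrable_cst.
have I1 : P.-integrable setT (EFin \o Y).
  apply: (le_integrable _ _ _ (integrableD measurableT (Ic 1) I2)) => //.
    exact/measurable_EFinP.
  move=> w _; rewrite /= lee_fin; set y := Y w.
  have y2 : 0 <= y * y by rewrite -expr2 sqr_ge0.
  rewrite [leRHS]ger0_norm ?addr_ge0// ler_norml.
  have := sqr_ge0 (y + 1); have := sqr_ge0 (y - 1); rewrite !expr2 => h1 h2.
  by apply/andP; split; nra.
have IZ : P.-integrable setT (fun w => (- (2 * m))%:E * (Y w)%:E)%E.
  exact: integrableZl.
transitivity (\int[P]_w (((Y w * Y w)%:E + (- (2 * m))%:E * (Y w)%:E) + (m ^+ 2)%:E))%E.
  by apply: eq_integral => w _; rewrite -EFinM -!EFinD; congr _%:E; ring.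
rewrite integralD//; last 2 first.
- exact: integrableD.
- exact: Ic.
rewrite integralD// integralZl// EY' EY2' mule0 adde0.
rewrite (integral_cst P measurableT (m ^+ 2)%:E).
by rewrite [X in (_ * X)%E](_ : _ = 1%E) ?mule1 // ; exact: probability_setT.
Qed.

Let preim (B : set R) : measurable B -> measurable (Y @^-1` B).
Proof. by move=> mB; rewrite -[X in measurable X]setTI; exact: mY. Qed.

(** If s = 0, then Y = m almost surely and the second moment about m is 0, whereas it equals tau^2 +
    m^2 > 0. *)
Lemma gaussian_nondegenerate (m s : R) :
  (forall B : set R, measurable B ->
    P (Y @^-1` B) = if s == 0 then \d_m B else normal_prob m s B) -> s != 0.
Proof.
move=> lawY; apply/negP => s0.
have := gaussian_second_moment m.
rewrite (_ : (\int[P]_w _)%E = 0%E).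
  move=> /esym /eqP; rewrite eqe gt_eqF// ltr_wpDr ?sqr_ge0// exprn_gt0//.
rewrite (@ae_eq_integral _ _ _ P setT (cst 0%E)) ?integral0//.
- by apply/measurable_EFinP/measurable_funX; exact: measurable_funB.
- exists (Y @^-1` (~` [set m])); split.
  + by apply: preim; apply: measurableC.
  + have := lawY _ (measurableC (measurable_set1 m)).
    by rewrite s0 diracE in_setC mem_set.
  + move=> w /= /not_implyP[_ Ym] Ywm; apply: Ym.
    by rewrite Ywm subrr expr0n.
Qed.

Section law.
Variables (m s : R).
Hypothesis s0 : 0 < s.
Hypothesis lawY : forall B : set R, measurable B -> P (Y @^-1` B) = normal_prob m s B.

Let measurable_ge (l : R) : measurable [set x : R | l <= `|x - m|].
Proof.
have mb : measurable_fun setT (fun x : R => l <= `|x - m|).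
  apply: measurable_fun_ler => //; apply: measurableT_comp => //.
  exact: measurable_funB.
by have := mb measurableT [set true] Logic.I; rewrite setTI.
Qed.

Lemma gaussian_tail_exp (l : R) : 0 <= l ->
  (P [set w | (l <= `|Y w - m|)%R] <= (2 * expR (- l ^+ 2 / (4 * s ^+ 2)))%:E)%E.
Proof.
move=> l0; rewrite (_ : [set w | _] = Y @^-1` [set x | l <= `|x - m|])//.
rewrite lawY; last exact: measurable_ge.
apply: normal_prob_le_exp => //; rewrite ?expR_ge0// => x lx.
rewrite ler_expR !mulNr lerN2 ler_pM2r ?invr_gt0 ?mulr_gt0 ?exprn_gt0//.
by rewrite -[leRHS]real_normK ?num_real// lerXn2r ?nnegrE.
Qed.

(** Dyadic layers: the square is at most s^2 below distance s from m, and at most 4^(k+1) s^2 on the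
    layer between 2^k s and 2^(k+1) s, whose probability is bounded by the exponential tail. *)
Lemma gaussian_second_moment_le :
  (\int[P]_w ((Y w - m) ^+ 2)%:E <= (3000 * s ^+ 2)%:E)%E.
Proof.
pose c k : R := if k is _.+1 then 4 ^+ k * s ^+ 2 else s ^+ 2.
pose B k : set Omega := if k is k'.+1 then [set w | 2 ^+ k' * s <= `|Y w - m|] else setT.
have c0 k : 0 <= c k by rewrite /c; case: k => [|k]; rewrite ?sqr_ge0// mulr_ge0 ?sqr_ge0.
have mB k : measurable (B k).
  by case: k => [|k]; [exact: measurableT|exact: (preim (measurable_ge (2 ^+ k * s)))].
apply: le_trans (ge0_integral_le_series P (c := c) (B := B) _ _ c0 mB _) _.
- by apply/measurable_EFinP/measurable_funX; exact: measurable_funB.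
- by move=> w; rewrite lee_fin sqr_ge0.
- move=> w; have term k : B k w -> ((c k)%:E <= \sum_(0 <= i <oo) ((c i)%:E * (\1_(B i) w)%:E))%E.
    move=> Bkw; apply: le_trans (nneseries_lim_ge k.+1 _).
      rewrite big_nat_recr//= indicE mem_set// mule1 leeDr// sume_ge0// => i _.
      by rewrite mule_ge0// lee_fin.
    by move=> n _ _; rewrite mule_ge0// lee_fin.
  have [small|big] := ltP `|Y w - m| s.
    apply: le_trans (term 0%N Logic.I); rewrite lee_fin /c -[leLHS]real_normK ?num_real//.
    by rewrite lerXn2r ?nnegrE// ltW.
  have ex : exists n, `|Y w - m| < 2 ^+ n * s.
    exists (Num.truncn (`|Y w - m| / s)).+1; rewrite -ltr_pdivrMr//.
    apply: lt_le_trans (truncnS_gt _) _.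
    by rewrite -natrX ler_nat ltnW// ltn_expl.
  case: (ex_minnP ex) => -[|n] hn nmin; first by move: hn; rewrite expr0 mul1r ltNge big.
  have Bn : B n.+1 w.
    by rewrite /B /= leNgt; apply/negP => /nmin; rewrite ltnn.
  apply: le_trans (term _ Bn); rewrite lee_fin /c -[leLHS]real_normK ?num_real//.
  have -> : 4 ^+ n.+1 * s ^+ 2 = (2 ^+ n.+1 * s) ^+ 2.
    by rewrite exprMn exprAC (_ : 2 ^+ 2 = 4)//; rewrite expr2; lra.
  by rewrite lerXn2r ?nnegrE ?mulr_ge0 ?exprn_ge0// ltW.
(* With a = 4^k the tail 2 exp(-a/4) is at most 2 (8/a)^2. Multiplied by 4 a s^2 this is 512 s^2 / a
   = 2048 s^2 / 4^(k+1), and the series sums to 2048 * 4/3 < 3000. *)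
apply: (@le_trans _ _ (\sum_(0 <= k <oo) (2048 * s ^+ 2 * 4^-1 ^+ k)%:E)%E).
  apply: lee_nneseries => k _; first by rewrite mule_ge0// lee_fin.
  case: k => [|k].
    rewrite /c /B expr0 mulr1 [X in (_ * X)%E](_ : _ = 1%E); last exact: probability_setT.
    by rewrite mule1 lee_fin ler_peMl ?sqr_ge0//; lra.
  apply: le_trans (lee_wpmul2l _ (gaussian_tail_exp _)) _; rewrite ?lee_fin//.
    by rewrite mulr_ge0 ?exprn_ge0// ltW.
  rewrite /c; pose a : R := 4 ^+ k; have a0 : 0 < a by rewrite exprn_gt0.
  have eE : - (2 ^+ k * s) ^+ 2 / (4 * s ^+ 2) = - (a / 4).
    rewrite exprMn exprAC (_ : 2 ^+ 2 = 4); last by rewrite expr2; lra.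
    by rewrite -/a; field; rewrite gt_eqF.
  have a40 : 0 < a / 4 by rewrite divr_gt0.
  have e_le : expR (- (2 ^+ k * s) ^+ 2 / (4 * s ^+ 2)) <= (2 / (a / 4)) ^+ 2.
    have q0 : 0 <= 2 / (a / 4) by rewrite divr_ge0 ?(ltW a40).
    by rewrite eE -powR_mulrn//; exact: expRN_le_powR.
  apply: (@le_trans _ _ (4 ^+ k.+1 * s ^+ 2 * (2 * (2 / (a / 4)) ^+ 2))).
    apply: ler_wpM2l; first by rewrite mulr_ge0 ?sqr_ge0 ?exprn_ge0.
    exact: ler_wpM2l.
  rewrite [4 ^+ k.+1]exprS [4^-1 ^+ k.+1]exprVn [4 ^+ k.+1]exprS -/a.
  clear eE e_le; move: (s ^+ 2) => b; clearbody a.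
  rewrite le_eqVlt; apply/orP; left; apply/eqP; field.
  by rewrite gt_eqF.
apply: le_trans (geometric_eseries_le _ _) _.
- by apply: mulr_ge0; [exact: ler0n|exact: sqr_ge0].
- by apply/andP; split; lra.
- rewrite lee_fin (_ : (1 - 4^-1)^-1 = 4 / 3 :> R); last by field.
  by have := sqr_ge0 s; lra.
Qed.

(** The last two bounds come from tau^2 + m^2 <= 3000 s^2 <= (60 s)^2. *)
Lemma gaussian_params_bounds : [/\ s <= 6 * tau, `|m| <= 60 * s & tau <= 60 * s].
Proof.
have /= := gaussian_second_moment_le; rewrite gaussian_second_moment lee_fin => mom.
have t2 := sqr_ge0 tau; have m2 := sqr_ge0 m.
have sq (x : R) : x ^+ 2 <= 3000 * s ^+ 2 -> `|x| <= 60 * s.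
  move=> xs; rewrite -(ler_pXn2r (ltn0Sn 1)) ?nnegrE ?mulr_ge0 ?(ltW s0)//.
  rewrite real_normK ?num_real// (le_trans xs)// exprMn ler_wpM2r ?sqr_ge0//.
  by rewrite expr2; lra.
split; last first.
- by rewrite -[leLHS](gtr0_norm tau0); apply: sq; lra.
- by apply: sq; lra.
(* A density of at most 1/s on an interval of length s/2 has mass at most 1/2. So |Y| exceeds s/4
   with probability at least 1/2, and s^2 <= 32 tau^2 <= (6 tau)^2. *)
pose B : set R := `[- (s / 4), s / 4]%classic.
have mB : measurable B by exact: measurable_itv.
have PB : (P (Y @^-1` B) <= (2^-1)%:E)%E.
  rewrite lawY//; apply: le_trans (normal_prob_le_pdf (c := s^-1) mB _ _) _.
  - move=> x _; apply: le_trans (normal_peak_le s0).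
    by apply: normal_pdf_ub; rewrite gt_eqF.
  - by rewrite invr_ge0 ltW.
  rewrite /B lebesgue_measure_itv/= lte_fin; case: ifPn => [_|_]; last by rewrite mule0 lee_fin.
  rewrite -EFinB -EFinM lee_fin (_ : s^-1 * (s / 4 - - (s / 4)) = 2^-1)//.
  by field; rewrite gt_eqF.
have mYB := preim mB.
have PCB : ((2^-1)%:E <= P (~` (Y @^-1` B)))%E.
  have := probability_setC P mYB; have : P (Y @^-1` B) \is a fin_num by exact: fin_num_measure.
  move: PB; case: (P (Y @^-1` B)) => // x; rewrite lee_fin => x2 _ ->.
  by rewrite -EFinB lee_fin; lra.
have : (((s / 4) ^+ 2)%:E * P (~` (Y @^-1` B)) <= (tau ^+ 2)%:E)%E.
  have := gaussian_second_moment 0; rewrite expr0n addr0 => <-.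
  apply: (@le_trans _ _ (\int[P]_w (((s / 4) ^+ 2)%:E * (\1_(~` (Y @^-1` B)) w)%:E))%E).
    rewrite ge0_integralZl_EFin ?sqr_ge0//.
      by rewrite integral_indic//= ?setIT//; exact: measurableC.
    by apply/measurable_EFinP; apply: measurable_indic; exact: measurableC.
  apply: ge0_le_integral => //.
  - by move=> w _; rewrite mule_ge0// lee_fin ?sqr_ge0.
  - apply: emeasurable_funM => //; apply/measurable_EFinP.
    by apply: measurable_indic; exact: measurableC.
  - by apply/measurable_EFinP/measurable_funX; exact: measurable_funB.
  move=> w _; rewrite subr0 -EFinM lee_fin indicE.
  case: (boolP (w \in _)) => [|_]; last by rewrite mulr0 sqr_ge0.
  rewrite in_setC => /negP; rewrite inE /B /= in_itv/= => wB; rewrite mulr1.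
  rewrite -[leRHS]real_normK ?num_real// lerXn2r ?nnegrE ?divr_ge0 ?(ltW s0)//.
  by rewrite leNgt; apply/negP; rewrite ltr_norml => /andP[/ltW w1 /ltW w2]; apply: wB; rewrite w1.
move=> H; have : (((s / 4) ^+ 2)%:E * (2^-1)%:E <= (tau ^+ 2)%:E)%E.
  by apply: le_trans H; apply: lee_wpmul2l => //; rewrite lee_fin sqr_ge0.
rewrite -EFinM lee_fin => st.
rewrite -(ler_pXn2r (ltn0Sn 1)) ?nnegrE ?mulr_ge0 ?(ltW s0) ?(ltW tau0)//.
move: st; rewrite !expr2; nra.
Qed.

End law.

End gaussian_rv_bounds.

Section gaussian_estimates.
Context {R : realType} {disp : measure_display} {Omega : measurableType disp}.
Variables (P : probability Omega R).
Implicit Types (q a r tau : R) (Y : Omega -> R).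

Definition decay_const q : R := (8 * q) `^ (q / 2) * 6 `^ q + 720 `^ q.

Lemma decay_const_ge0 q : 0 <= decay_const q.
Proof. by apply: addr_ge0; [apply: mulr_ge0|]; exact: powR_ge0. Qed.

(** If |x| >= 120 s, the shift m is at most |x|/2 and the exponential is bounded by a power, with s
    <= 6 tau. Otherwise |x| < 120 s <= 720 tau and the bound 1 suffices. The two cases give the two
    terms of [decay_const]. *)
Lemma expR_decay q m s tau x : 0 < q -> 0 < s -> s <= 6 * tau -> `|m| <= 60 * s ->
  x != 0 ->
  expR (- (x - m) ^+ 2 / (4 * s ^+ 2)) <= decay_const q * (tau / `|x|) `^ q.
Proof.
move=> q0 s0 stau ms x0; have z0 : 0 < `|x| by rewrite normr_gt0.
have tau0 : 0 < tau by lra.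
have pz : 0 <= (tau / `|x|) `^ q by exact: powR_ge0.
have tx0 : 0 <= tau / `|x| by rewrite divr_ge0 ?(ltW tau0).
have [big|small] := leP (120 * s) `|x|; last first.
  rewrite /decay_const; pose N : R := 720; rewrite -/N.
  have xN : `|x| <= N * tau by rewrite /N; lra.
  have N0 : 0 <= N by exact: ler0n.
  clearbody N; apply: (@le_trans _ _ (N `^ q * (tau / `|x|) `^ q)); last first.
    by rewrite mulrDl lerDr !mulr_ge0 ?powR_ge0.
  rewrite -powRM//.
  apply: (@le_trans _ _ 1).
    rewrite -expR0 ler_expR mulNr oppr_le0 mulr_ge0 ?sqr_ge0// invr_ge0.
    by rewrite mulr_ge0// sqr_ge0.
  have {1}-> : (1 : R) = 1 `^ q by rewrite powR1.
  apply: ge0_ler_powR; rewrite ?nnegrE ?(ltW q0)//.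
    exact: mulr_ge0.
  by rewrite mulrA ler_pdivlMr// mul1r.
apply: (@le_trans _ _ ((8 * q) `^ (q / 2) * 6 `^ q * (tau / `|x|) `^ q)); last first.
  apply: ler_wpM2r => //; rewrite /decay_const lerDl; exact: powR_ge0.
pose y := `|x| ^+ 2 / (16 * s ^+ 2).
have s2 : 0 < s ^+ 2 by rewrite exprn_gt0.
have y0 : 0 < y by rewrite divr_gt0 ?exprn_gt0// mulr_gt0.
have xm : `|x| / 2 <= `|x - m|.
  by have := lerB_dist x m; lra.
apply: (@le_trans _ _ (expR (- y))).
  rewrite ler_expR mulNr lerN2 /y ler_pdivrMr ?mulr_gt0//.
  rewrite mulrAC ler_pdivlMr ?mulr_gt0// -[(x - m) ^+ 2]real_normK ?num_real//.
  have : (`|x| / 2) ^+ 2 <= `|x - m| ^+ 2 by rewrite lerXn2r ?nnegrE ?divr_ge0.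
  rewrite [(_ / 2) ^+ 2]exprMn exprVn (_ : 2 ^+ 2 = 4); last by rewrite expr2; lra.
  move: (`|x| ^+ 2) (`|x - m| ^+ 2) (s ^+ 2) s2 => u v w w0 uv; nra.
have q20 : 0 < q / 2 by rewrite divr_gt0.
apply: le_trans (expRN_le_powR q20 y0) _.
have -> : q / 2 / y = (8 * q) * (s / `|x|) ^+ 2.
  rewrite /y; have := lt0r_neq0 z0; have := lt0r_neq0 s0; move: (`|x|) => z sn zn.
  by field; rewrite sn zn.
rewrite powRM ?sqr_ge0 ?mulr_ge0 ?(ltW q0)// -mulrA ler_wpM2l ?powR_ge0//.
have sx0 : 0 <= s / `|x| by rewrite divr_ge0 ?ltW.
rewrite -[(s / _) ^+ 2]powR_mulrn// -powRrM (_ : 2%:R * (q / 2) = q); last by field.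
rewrite -powRM//; apply: ge0_ler_powR; rewrite ?nnegrE ?(ltW q0)//.
  exact: mulr_ge0.
by rewrite mulrA ler_pM2r ?invr_gt0.
Qed.

Section increments.
Variables (Y : Omega -> R) (tau : R).
Hypothesis tau0 : 0 < tau.
Hypothesis gY : gaussian_rv P Y.
Hypothesis EY : 'E_P[Y]%E = 0%E.
Hypothesis EY2 : 'E_P[Y \* Y]%E = (tau ^+ 2)%:E.

Lemma gaussian_law : exists m s, [/\ 0 < s, s <= 6 * tau, `|m| <= 60 * s, tau <= 60 * s &
  forall B : set R, measurable B -> P (Y @^-1` B) = normal_prob m s B].
Proof.
have [mY [m [s [s_ge0 lawY]]]] := gY.
have s_neq0 := gaussian_nondegenerate tau0 gY EY EY2 lawY.
have s0 : 0 < s by rewrite lt_neqAle eq_sym s_neq0.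
have {}lawY B : measurable B -> P (Y @^-1` B) = normal_prob m s B.
  by move=> /lawY ->; rewrite (negbTE s_neq0).
have [? ? ?] := gaussian_params_bounds tau0 gY EY EY2 s0 lawY.
by exists m, s; split.
Qed.

Let mball a r : measurable [set x : R | `|x - a| <= r].
Proof.
rewrite (_ : mkset _ = `[a - r, a + r]%classic); first exact: measurable_itv.
by apply/seteqP; split=> x /=; rewrite in_itv/= ler_distl.
Qed.

Let leb_ball a r : 0 <= r -> lebesgue_measure [set x : R | `|x - a| <= r] = (2 * r)%:E.
Proof.
move=> r0; rewrite (_ : mkset _ = `[a - r, a + r]%classic); last first.
  by apply/seteqP; split=> x /=; rewrite in_itv/= ler_distl.
rewrite lebesgue_measure_itv/= lte_fin; case: ifPn => [_|].
  by rewrite -EFinB; congr _%:E; ring.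
by rewrite -leNgt => h; congr _%:E; lra.
Qed.

Lemma gaussian_tail q (l : R) : 0 < q -> 0 < l ->
  (P [set w | (l <= `|Y w|)%R] <= (2 * (decay_const q * (tau / l) `^ q))%:E)%E.
Proof.
move=> q0 l0; have [m [s [s0 stau ms taus lawY]]] := gaussian_law.
rewrite (_ : [set w | _] = Y @^-1` [set x | l <= `|x|])//.
have mB : measurable [set x : R | l <= `|x|].
  have mb : measurable_fun setT (fun x : R => l <= `|x|).
    by apply: measurable_fun_ler => //; exact: measurableT_comp.
  by have := mb measurableT [set true] Logic.I; rewrite setTI.
rewrite lawY//; apply: normal_prob_le_exp => //.
  move=> x lx; have x0 : 0 < `|x| by exact: lt_le_trans lx.
  apply: le_trans (expR_decay q0 s0 stau ms _) _; first by rewrite -normr_gt0.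
  rewrite ler_wpM2l ?decay_const_ge0//.
  apply: ge0_ler_powR; rewrite ?nnegrE ?(ltW q0) ?divr_ge0 ?(ltW tau0) ?(ltW l0)//.
  by rewrite ler_pM2l// lef_pV2 ?posrE.
by rewrite mulr_ge0 ?decay_const_ge0 ?powR_ge0.
Qed.

(** The density is at most 1/s <= 60/tau on an interval of length 2 r. *)
Lemma gaussian_small_ball a r : 0 <= r ->
  (P [set w | (`|Y w - a| <= r)%R] <= (120 * (r / tau))%:E)%E.
Proof.
move=> r0; have [m [s [s0 stau ms taus lawY]]] := gaussian_law.
rewrite (_ : [set w | _] = Y @^-1` [set x | `|x - a| <= r])// lawY//.
have s1 : s^-1 <= 60 / tau by rewrite -[leLHS]mul1r ler_pdivrMr// mulrAC ler_pdivlMr// mul1r.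
apply: le_trans (normal_prob_le_pdf (c := s^-1) (mball a r) _ _) _.
- move=> x _; apply: le_trans (normal_peak_le s0).
  by apply: normal_pdf_ub; rewrite gt_eqF.
- by rewrite invr_ge0 ltW.
rewrite leb_ball// -EFinM lee_fin.
apply: le_trans (ler_wpM2r _ s1) _; first by rewrite mulr_ge0.
by rewrite le_eqVlt; apply/orP; left; apply/eqP; field; rewrite gt_eqF.
Qed.

(** Every point of the ball has modulus at least |a|/2, so the density decays there as well; halving
    |a| costs the factor 2^q. *)
Lemma gaussian_small_ball_far q a r : 0 < q -> 0 <= r -> a != 0 -> 2 * r <= `|a| ->
  (P [set w | (`|Y w - a| <= r)%R] <=
    (120 * decay_const q * 2 `^ q * (r / tau) * (tau / `|a|) `^ q)%:E)%E.
Proof.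
move=> q0 r0 a_neq0 ra; have [m [s [s0 stau ms taus lawY]]] := gaussian_law.
have a0 : 0 < `|a| by rewrite normr_gt0.
rewrite (_ : [set w | _] = Y @^-1` [set x | `|x - a| <= r])// lawY//.
have s1 : s^-1 <= 60 / tau by rewrite -[leLHS]mul1r ler_pdivrMr// mulrAC ler_pdivlMr// mul1r.
pose c := 60 / tau * (decay_const q * (2 `^ q * (tau / `|a|) `^ q)).
apply: le_trans (normal_prob_le_pdf (c := c) (mball a r) _ _) _.
- move=> x /= xa; have xa2 : `|a| / 2 <= `|x|.
    have := ler_distD x a 0; rewrite !subr0 distrC => h; lra.
  have x0 : 0 < `|x| by apply: lt_le_trans xa2; rewrite divr_gt0.
  rewrite normal_pdfE ?gt_eqF// /c.
  apply: ler_pM; [exact: normal_peak_ge0|exact: expR_ge0| |].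
    exact: le_trans (normal_peak_le s0) s1.
  apply: (@le_trans _ _ (expR (- (x - m) ^+ 2 / (4 * s ^+ 2)))).
    rewrite ler_expR !mulNr lerN2 ler_wpM2l ?sqr_ge0//.
    have s2 : 0 < s ^+ 2 by rewrite exprn_gt0.
    by rewrite lef_pV2 ?posrE; lra.
  apply: le_trans (expR_decay q0 s0 stau ms _) _; first by rewrite -normr_gt0.
  rewrite ler_wpM2l ?decay_const_ge0//.
  have ta0 : 0 <= tau / `|a| by rewrite divr_ge0 ?(ltW tau0).
  rewrite -powRM//; apply: ge0_ler_powR; rewrite ?nnegrE ?(ltW q0) ?mulr_ge0 ?invr_ge0 ?(ltW tau0)//.
  rewrite mulrCA ler_pM2l// -[X in X <= _]mul1r ler_pdivrMr// mulrAC ler_pdivlMr//; lra.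
- by rewrite /c !mulr_ge0 ?powR_ge0 ?decay_const_ge0 ?invr_ge0 ?(ltW tau0).
rewrite leb_ball// -EFinM lee_fin /c.
by rewrite le_eqVlt; apply/orP; left; apply/eqP; ring.
Qed.

End increments.

End gaussian_estimates.

(** * Increments and Hölder continuity of fractional Brownian motion *)

Section fbm_increments.
Context {R : realType} {disp : measure_display} {Omega : measurableType disp}.
Variables (P : probability Omega R) (H : R) (Y : R -> Omega -> R).
Hypothesis H_gt0 : 0 < H.
Hypothesis Y_fbm : fractional_brownian_motion_1d P H Y.

Definition increment (s t : R) (w : Omega) : R := Y t w - Y s w.

Lemma increment_gaussian s t : 0 <= s -> 0 <= t -> gaussian_rv P (increment s t).
Proof.
move=> s0 t0.
have G : gaussian_process P Y := fbm_gaussian Y_fbm.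
have := G 2%N (fun k => if k == ord0 then t else s) (fun k => if k == ord0 then 1 else -1).
have -> : (fun w => \sum_(k < 2) (if k == ord0 then 1 else -1) *
    Y (if k == ord0 then t else s) w) = increment s t.
  by apply/funext => w; rewrite big_ord_recl big_ord1 /= mul1r mulN1r.
by apply=> k; case: ifP.
Qed.

Lemma fbm_measurable t : 0 <= t -> measurable_fun setT (Y t).
Proof.
move=> t0; have G : gaussian_process P Y := fbm_gaussian Y_fbm.
have [+ _] := G 1%N (fun=> t) (fun=> 1) (fun=> t0).
by apply: eq_measurable_fun => w _; rewrite big_ord1 mul1r.
Qed.

Let integrable_prod s t : 0 <= s -> 0 <= t ->
  P.-integrable setT (EFin \o (fun w => Y s w * Y t w)).
Proof.
have sq r : 0 <= r -> P.-integrable setT (EFin \o (fun w => Y r w * Y r w)).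
  move=> r0; have mr := fbm_measurable r0.
  apply/integrableP; split; first by apply/measurable_EFinP; exact: measurable_funM.
  have := fbm_covariance Y_fbm r0 r0; rewrite unlock => E.
  under eq_integral => w _ do rewrite /= ger0_norm -?expr2 ?sqr_ge0// expr2.
  by rewrite E ltry.
move=> s0 t0; have ms := fbm_measurable s0; have mt := fbm_measurable t0.
apply: (le_integrable _ _ _ (integrableD measurableT (sq s s0) (sq t t0))) => //.
  by apply/measurable_EFinP; exact: measurable_funM.
move=> w _; rewrite /= lee_fin; set x := Y s w; set y := Y t w.
have x2 : 0 <= x * x by rewrite -expr2 sqr_ge0.
have y2 : 0 <= y * y by rewrite -expr2 sqr_ge0.
rewrite [leRHS]ger0_norm ?addr_ge0// ler_norml.
have := sqr_ge0 (x + y); have := sqr_ge0 (x - y); rewrite !expr2 => h1 h2.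
by apply/andP; split; nra.
Qed.

Let integrable_fbm t : 0 <= t -> P.-integrable setT (EFin \o Y t).
Proof.
move=> t0; have mt := fbm_measurable t0.
have Ic : P.-integrable setT (EFin \o cst 1) by exact: finite_measure_integrable_cst.
apply: (le_integrable _ _ _ (integrableD measurableT Ic (integrable_prod t0 t0))) => //.
  exact/measurable_EFinP.
move=> w _; rewrite /= lee_fin; set y := Y t w.
have y2 : 0 <= y * y by rewrite -expr2 sqr_ge0.
rewrite [leRHS]ger0_norm ?addr_ge0// ler_norml.
have := sqr_ge0 (y + 1); have := sqr_ge0 (y - 1); rewrite !expr2 => h1 h2.
by apply/andP; split; nra.
Qed.

Lemma increment_centered s t : 0 <= s -> 0 <= t -> 'E_P[increment s t]%E = 0%E.
Proof.
move=> s0 t0; have := fbm_centered Y_fbm s0; have := fbm_centered Y_fbm t0.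
rewrite unlock => Et Es.
have := integralB_EFin measurableT (integrable_fbm t0) (integrable_fbm s0).
by rewrite Et Es sube0; under eq_integral do rewrite -EFinB.
Qed.

Lemma increment_variance s t : 0 <= s -> 0 <= t ->
  'E_P[increment s t \* increment s t]%E = ((`|t - s| `^ H) ^+ 2)%:E.
Proof.
move=> s0 t0; have := fbm_covariance Y_fbm s0 t0; have := fbm_covariance Y_fbm s0 s0.
have := fbm_covariance Y_fbm t0 t0; rewrite unlock => Ett Ess Est.
have Itt := integrable_prod t0 t0; have Iss := integrable_prod s0 s0.
have Ist := integrable_prod s0 t0.
have IZ : P.-integrable setT (fun w => (- 2)%:E * (Y s w * Y t w)%:E)%E by exact: integrableZl.
transitivity (\int[P]_w ((Y t w * Y t w)%:E + (- 2)%:E * (Y s w * Y t w)%:E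
    + (Y s w * Y s w)%:E))%E.
  apply: eq_integral => w _; rewrite -EFinM -!EFinD /increment; congr _%:E; rewrite /=; ring.
rewrite integralD//; last exact: integrableD.
rewrite integralD// integralZl// Ett Ess Est -!EFinM -!EFinD; congr _%:E.
rewrite !subrr normr0 powR0 ?mulf_neq0 ?gt_eqF// !subr0.
rewrite -[(_ `^ H) ^+ 2]powR_mulrn ?powR_ge0// -powRrM [H * _]mulrC.
by field.
Qed.

End fbm_increments.

Section dyadic_chaining.
Context {R : realType}.
Variables (y : R -> R) (g : R) (N : nat).
Hypothesis g0 : 0 < g.
Hypothesis y_cont : {within `[0, +oo[, continuous y}.
Hypothesis y_dyadic : forall n k, (N <= n)%N -> (k < 2 ^ n)%N ->
  `|y (k.+1%:R * 2^-1 ^+ n) - y (k%:R * 2^-1 ^+ n)| <= (2^-1 ^+ n) `^ g.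

Let half0 n : 0 < (2^-1 : R) ^+ n. Proof. by rewrite exprn_gt0// invr_gt0. Qed.

Let theta : R := 2^-1 `^ g.

Let theta_itv : 0 < theta < 1.
Proof.
have h1 : 0 < (2^-1 : R) by rewrite invr_gt0.
rewrite powR_gt0//=; have -> : (1 : R) = 2^-1 `^ 0 by rewrite powRr0.
rewrite /theta /powR gt_eqF// ltr_expR ltr_nM2r ?ln_lt0// h1/= invf_lt1//; lra.
Qed.

Let approx n (t : R) : R := (Num.truncn (2 ^+ n * t))%:R * 2^-1 ^+ n.

Let pow0 n : 0 < (2 : R) ^+ n. Proof. by rewrite exprn_gt0. Qed.

Let powK n : (2 : R) ^+ n * 2^-1 ^+ n = 1.
Proof. by rewrite exprVn mulfV// gt_eqF. Qed.

Let approx_itv n t : 0 <= t -> approx n t <= t < approx n t + 2^-1 ^+ n.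
Proof.
move=> t0; have /andP[] := truncn_itv (mulr_ge0 (ltW (pow0 n)) t0) => h1 h2.
have e1 : t = 2 ^+ n * t * 2^-1 ^+ n by rewrite mulrAC powK mul1r.
rewrite /approx; apply/andP; split; first by rewrite [leRHS]e1 ler_pM2r.
by rewrite [ltLHS]e1 -[X in _ < _ + X](mul1r (2^-1 ^+ n)) -mulrDl ltr_pM2r// natr1.
Qed.

(** Passing to the next level appends one binary digit: the approximation stays or moves by one
    dyadic step. Summing over levels gives a geometric series of ratio [theta]. *)
Let step n t : (N <= n)%N -> 0 <= t <= 1 ->
  `|y (approx n.+1 t) - y (approx n t)| <= (2^-1 ^+ n.+1) `^ g.
Proof.
move=> Nn /andP[t0 t1]; rewrite /approx exprS -mulrA truncn_double; last by rewrite mulr_ge0 ?exprn_ge0.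
set k := Num.truncn (2 ^+ n * t).
have kE : k%:R * 2^-1 ^+ n = k.*2%:R * 2^-1 ^+ n.+1 :> R.
  by rewrite exprS -muln2 natrM -mulrA [2 * _]mulrA mulfV ?mul1r.
rewrite kE; case bE: (odd _); last by rewrite addn0 subrr normr0 powR_ge0.
rewrite addn1; apply: y_dyadic; first exact: leqW.
have : (Num.truncn (2 * (2 ^+ n * t)) <= 2 ^ n.+1)%N.
  rewrite -(ler_nat R); apply: le_trans (_ : 2 * (2 ^+ n * t) <= _).
    by rewrite truncn_le !mulr_ge0 ?exprn_ge0.
  by rewrite natrX mulrA -exprS ler_piMr ?exprn_ge0.
rewrite truncn_double; last by rewrite mulr_ge0 ?exprn_ge0.
by rewrite bE addn1.
Qed.

Let chain n p t : (N <= n)%N -> 0 <= t <= 1 ->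
  `|y (approx (n + p) t) - y (approx n t)| <= (2^-1 ^+ n) `^ g / (1 - theta).
Proof.
move=> Nn t01; have /andP[th0 th1] := theta_itv.
have : `|y (approx (n + p) t) - y (approx n t)| <=
    \sum_(0 <= i < p) (2^-1 ^+ n) `^ g * theta ^+ i.
  elim: p => [|p IH]; first by rewrite addn0 subrr normr0 big_geq.
  rewrite big_nat_recr//= addnS.
  apply: le_trans (ler_distD (y (approx (n + p) t)) _ _) _.
  rewrite [leRHS]addrC; apply: lerD; last exact: IH.
  apply: le_trans (step (leq_trans Nn (leq_addr p n)) t01) _.
  rewrite -addSn exprD powRM ?exprn_ge0 ?invr_ge0// ler_pM ?powR_ge0//.
    apply: ge0_ler_powR; rewrite ?nnegrE ?(ltW g0) ?(ltW (half0 _))//.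
    by rewrite exprS ler_piMl ?(ltW (half0 _))// invf_le1//; lra.
  rewrite /theta -!powR_mulrn ?powR_ge0 ?invr_ge0// -!powRrM mulrC//.
move=> /le_trans; apply; have := @geometric_le_lim R p ((2^-1 ^+ n) `^ g) theta.
by apply; rewrite ?powR_ge0// gtr0_norm.
Qed.

Let limit n t : (N <= n)%N -> 0 <= t <= 1 ->
  `|y t - y (approx n t)| <= (2^-1 ^+ n) `^ g / (1 - theta).
Proof.
move=> Nn t01; have /andP[t0 t1] := t01; apply/ler_addgt0Pr => e e0.
have /subspace_continuousP/(_ t) := y_cont.
rewrite /= in_itv/= andbT => /(_ t0)/cvgrPdist_le/(_ e e0).
rewrite near_withinE => /nbhs_ballP[r /= r0 rP].
have [m mr] := half_exp_small r0.
have mn : 2^-1 ^+ (n + m) <= (2^-1 ^+ m : R).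
  by rewrite exprD ler_piMl ?(ltW (half0 _))// exprn_ile1 ?invr_ge0// invf_le1//; lra.
have /andP[a1 a2] := approx_itv (n + m) t0.
have : `|y t - y (approx (n + m) t)| <= e.
  apply: rP; last by rewrite /= in_itv/= andbT mulr_ge0 ?(ltW (half0 _)).
  by rewrite /ball/= ger0_norm; lra.
have := chain m Nn t01; have := ler_distD (y (approx (n + m) t)) (y t) (y (approx n t)); lra.
Qed.

(** At the level n with 2^-(n+1) < |t - s| <= 2^-n the approximations of s and t coincide or are
    neighbours. Two chains and one step give 2 / (1 - theta) + 1, and replacing 2^-n by 2 |t - s|
    gives 2^g. *)
Lemma dyadic_holder (s t : R) : 0 <= s <= 1 -> 0 <= t <= 1 -> `|t - s| <= 2^-1 ^+ N ->
  `|y t - y s| <= (2 / (1 - 2^-1 `^ g) + 1) * 2 `^ g * `|t - s| `^ g.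
Proof.
rewrite -/theta; have /andP[th0 th1] := theta_itv.
wlog st : s t / s <= t => [H s01 t01 ts|].
  have [?|/ltW ?] := leP s t; first exact: H.
  by rewrite distrC [`|t - s|]distrC; apply: H => //; rewrite distrC.
move=> s01 t01; have [->|tneqs] := eqVneq t s.
  by rewrite !subrr normr0 => _; rewrite powR0 ?mulr0// gt_eqF.
have ts0 : 0 < t - s by rewrite subr_gt0 lt_neqAle eq_sym tneqs.
rewrite [`|t - s|]gtr0_norm// => tsN.
have ex := half_exp_small ts0; case: (ex_minnP ex) => -[|n] hn nmin.
  move: s01 t01 hn => /andP[? ?] /andP[? ?]; rewrite expr0; lra.
have tsn : t - s <= 2^-1 ^+ n by rewrite leNgt; apply/negP => /nmin; rewrite ltnn.
have Nn : (N <= n)%N.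
  rewrite leqNgt; apply/negP => nN; have : 2^-1 ^+ N <= (2^-1 ^+ n.+1 : R).
    by apply: ler_wiXn2l => //; rewrite ?invr_ge0// invf_le1//; lra.
  lra.
have mid : `|y (approx n t) - y (approx n s)| <= (2^-1 ^+ n) `^ g.
  move: s01 t01 => /andP[s0 s1] /andP[t0 t1].
  have pt : 2 ^+ n * t <= 2 ^+ n * s + 1.
    have : 2 ^+ n * (t - s) <= 2 ^+ n * 2^-1 ^+ n by rewrite ler_pM2l.
    by rewrite powK mulrBr; lra.
  have /andP[u1 u2] := truncn_itv (mulr_ge0 (ltW (pow0 n)) t0).
  have /andP[v1 v2] := truncn_itv (mulr_ge0 (ltW (pow0 n)) s0).
  have le1 : (Num.truncn (2 ^+ n * s) <= Num.truncn (2 ^+ n * t))%N.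
    by apply: le_truncn; rewrite ler_pM2l.
  have le2 : (Num.truncn (2 ^+ n * t) <= (Num.truncn (2 ^+ n * s)).+1)%N.
    rewrite -ltnS -(ltr_nat R); apply: le_lt_trans u1 _.
    by rewrite -[_.+2%:R]natr1; lra.
  have le3 : (Num.truncn (2 ^+ n * t) <= 2 ^ n)%N.
    by rewrite -(ler_nat R) natrX (le_trans u1)// ler_piMr// ltW.
  rewrite /approx; move: le1 le2 le3; set i := Num.truncn _; set j := Num.truncn _.
  rewrite leq_eqVlt => /predU1P[->|ij] ji jn; first by rewrite subrr normr0 powR_ge0.
  have -> : j = i.+1 by apply/eqP; rewrite eqn_leq ji.
  by apply: y_dyadic => //; apply: leq_trans jn.
have b1 := limit Nn t01; have b2 := limit Nn s01.
apply: (@le_trans _ _ ((2 / (1 - theta) + 1) * (2^-1 ^+ n) `^ g)).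
  have d1 := ler_distD (y (approx n t)) (y t) (y s).
  have d2 := ler_distD (y (approx n s)) (y (approx n t)) (y s).
  rewrite [`|y s - _|]distrC in b2.
  rewrite (_ : _ * _ = 2 * ((2^-1 ^+ n) `^ g / (1 - theta)) + (2^-1 ^+ n) `^ g); last by ring.
  lra.
rewrite -mulrA -powRM ?(ltW ts0)//; apply: ler_wpM2l.
  by rewrite addr_ge0// divr_ge0// subr_ge0 ltW.
apply: ge0_ler_powR; rewrite ?nnegrE ?(ltW g0) ?(ltW (half0 _)) ?mulr_ge0 ?(ltW ts0)//.
by move: hn; rewrite exprS; lra.
Qed.

End dyadic_chaining.

(** Borel-Cantelli for the dyadic increments: almost surely only finitely many levels contain a
    large one. *)
Lemma fbm_holder {R : realType} {disp : measure_display} {Omega : measurableType disp}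
    (P : probability Omega R) (H g : R) (Y : R -> Omega -> R) :
  0 < g < H -> fractional_brownian_motion_1d P H Y ->
  exists2 C, 0 <= C & {ae P, forall w, exists N, forall s t, 0 <= s <= 1 -> 0 <= t <= 1 ->
    `|t - s| <= 2^-1 ^+ N -> `|Y t w - Y s w| <= C * `|t - s| `^ g}.
Proof.
move=> /andP[g0 gH] Y_fbm; have H0 : 0 < H by exact: lt_trans gH.
exists ((2 / (1 - 2^-1 `^ g) + 1) * 2 `^ g).
  have : 2^-1 `^ g <= 1 :> R.
    have {2}-> : (1 : R) = 1 `^ g by rewrite powR1.
    by apply: ge0_ler_powR; rewrite ?nnegrE ?invr_ge0 ?(ltW g0)// invf_le1//; lra.
  by move=> h; rewrite mulr_ge0 ?powR_ge0// addr_ge0// divr_ge0// subr_ge0.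
pose x n : R := 2^-1 ^+ n.
have x0 n : 0 < x n by rewrite exprn_gt0// invr_gt0.
(* Turns the tail (x^H / x^g)^q into x^2 with x = 2^-n, so that 2^n increments contribute a summable
   2^-n. *)
pose q := 2 / (H - g); have q0 : 0 < q by rewrite divr_gt0// subr_gt0.
pose B n k : set Omega := [set w | (x n `^ g <= `|increment Y (k%:R * x n) (k.+1%:R * x n) w|)%R].
have kx0 n k : 0 <= k%:R * x n by rewrite mulr_ge0// ltW.
have mB n k : measurable (B n k).
  have [mi _] := increment_gaussian Y_fbm (kx0 n k) (kx0 n k.+1).
  have mb : measurable_fun setT (fun w => x n `^ g <= `|increment Y (k%:R * x n) (k.+1%:R * x n) w|).
    by apply: measurable_fun_ler => //; exact: measurableT_comp.
  by have := mb measurableT [set true] Logic.I; rewrite setTI.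
have PB n k : (P (B n k) <= (2 * decay_const q * x n ^+ 2)%:E)%E.
  have kk : `|k.+1%:R * x n - k%:R * x n| = x n.
    by rewrite -mulrBl -natr1 addrAC subrr add0r mul1r gtr0_norm.
  apply: le_trans (gaussian_tail (powR_gt0 H (x0 n)) (increment_gaussian Y_fbm (kx0 n k) (kx0 n k.+1))
    (increment_centered Y_fbm (kx0 n k) (kx0 n k.+1)) _ q0 (powR_gt0 g (x0 n))) _.
    by rewrite (increment_variance H0 Y_fbm (kx0 n k) (kx0 n k.+1)) kk.
  rewrite lee_fin mulrA le_eqVlt; apply/orP; left; apply/eqP; congr (_ * _).
  rewrite -powRB ?(gt_eqF (x0 n)) ?implybT// -powRrM /q mulrCA mulfV ?mulr1 ?subr_eq0 ?gt_eqF//.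
  by rewrite powR_mulrn// ltW.
pose F n := \big[setU/set0]_(k < 2 ^ n) B n k.
have mF n : measurable (F n) by exact: bigsetU_measurable.
have PF n : (P (F n) <= (2 * decay_const q * x n)%:E)%E.
  apply: le_trans (le_mu_bigsetU P _) _ => //.
  apply: (@le_trans _ _ (\sum_(k < 2 ^ n) (2 * decay_const q * x n ^+ 2)%:E)%E).
    by apply: lee_sum => k _; exact: PB.
  rewrite sumEFin sumr_const card_ord lee_fin -[leLHS]mulr_natr natrX expr2 -!mulrA.
  by rewrite [x n * 2 ^+ n](_ : _ = 1) ?mulr1// /x exprVn mulVf// gt_eqF// exprn_gt0.
have nullF : P (lim_sup_set F) = 0%E.
  apply: lim_sup_set_cvg0 => //.
  apply: le_lt_trans (_ : (\sum_(0 <= n <oo) (2 * decay_const q * 2^-1 ^+ n)%:E < +oo)%E).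
    apply: lee_nneseries => n _; [by []|exact: PF].
  apply: le_lt_trans (geometric_eseries_le _ _) (ltry _).
    by rewrite mulr_ge0// decay_const_ge0.
  by apply/andP; split; lra.
exists (lim_sup_set F); split => //.
  by apply: bigcap_measurable => // k _; exact: bigcup_measurable.
move=> w /= nH; apply: contrapT => nF; apply: nH.
have [N NF] : exists N, forall n, (N <= n)%N -> ~ F n w.
  move: nF; rewrite /lim_sup_set => /existsNP[N /not_implyP[_ NF]].
  by exists N => n Nn Fn; apply: NF; exists n.
have wc : {within `[0, +oo[, continuous (Y ^~ w)} by exact: (fbm_continuous Y_fbm).
exists N; apply: (dyadic_holder g0 wc) => n k Nn kn.
rewrite leNgt; apply/negP => /ltW big; apply: (NF n Nn).
by rewrite /F -bigcup_mkord; exists k.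
Qed.

(** * Upper bounds *)

Section hausdorff_premeasure_theory.
Context {R : realType} {T : Type} (dist : T -> T -> R).
Local Open Scope ereal_scope.
Local Notation diameter := (diameter dist).
Local Notation premeasure := (hausdorff_premeasure dist).
Implicit Types (U E : set T) (s r eta : R).

Lemma diameter_ge0 U : 0 <= diameter U.
Proof. by rewrite /diameter le_max lexx. Qed.

Lemma diameter_set0 : diameter set0 = 0.
Proof.
rewrite /diameter (_ : [set _ | _ in _] = set0) ?ereal_sup0 ?maxeNy//.
by apply/seteqP; split=> // x [p [[]]].
Qed.

Lemma diameter_le U r : (0 <= r)%R ->
  (forall p q, U p -> U q -> (dist p q <= r)%R) -> diameter U <= r%:E.
Proof.
move=> r0 Ur; rewrite /diameter ge_max lee_fin r0/=.
by apply: ge_ereal_sup => _ [[p q] [Up Uq] <-]; rewrite lee_fin; exact: Ur.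
Qed.

Lemma dist_le_diameter U p q : U p -> U q -> (dist p q)%:E <= diameter U.
Proof.
move=> Up Uq; rewrite /diameter le_max; apply/orP; right.
by apply: ereal_sup_ubound; exists (p, q).
Qed.

Lemma premeasure_ge0 s eta E : 0 <= premeasure s eta E.
Proof.
apply: le_ereal_inf_tmp => _ [U _ <-]; apply: nneseries_ge0 => n _ _.
exact: poweR_ge0.
Qed.

Lemma premeasure_le_esum {I : countType} (J : set I) s eta E (U : I -> set T) :
  (0 < s)%R -> (0 <= eta)%R -> E `<=` \bigcup_(i in J) U i ->
  (forall i, J i -> diameter (U i) <= eta%:E) ->
  premeasure s eta E <= \esum_(i in J) diameter (U i) `^ s.
Proof.
move=> s0 eta0 EU Ueta.
pose V k := if @pickle_inv I k is Some i then (if i \in J then U i else set0) else set0.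
have VJ i : J i -> V (pickle i) = U i by move=> Ji; rewrite /V pickleK_inv mem_set.
apply: ge_ereal_inf; exists (\sum_(0 <= k <oo) diameter (V k) `^ s).
  exists V => //; split.
    by move=> p /EU[i Ji Uip]; exists (pickle i) => //; rewrite VJ.
  move=> k; rewrite /V; case: pickle_inv => [i|]; last by rewrite diameter_set0 lee_fin.
  by case: ifPn => [/set_mem/Ueta//|_]; rewrite diameter_set0 lee_fin.
rewrite nneseries_esumT; last by move=> k; exact: poweR_ge0.
rewrite (_ : \esum_(k in _) _ = \esum_(k in pickle @` J) diameter (V k) `^ s); last first.
  rewrite [RHS]esum_mkcond; apply: eq_esum => k _; case: ifPn => // /negP kJ.
  rewrite /V; case Ek : pickle_inv => [i|]; last by rewrite diameter_set0 poweR0r ?gt_eqF.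
  case: ifPn => [/set_mem Ji|_]; last by rewrite diameter_set0 poweR0r ?gt_eqF.
  exfalso; apply: kJ; rewrite inE; exists i => //.
  by have := @pickle_invK I k; rewrite /= Ek.
rewrite esum_image; last by move=> x y _ _; exact: (pcan_inj pickleK).
by apply: le_esum => i Ji; rewrite VJ.
Qed.

Lemma premeasure_subadd {I : countType} (J : set I) s eta E (F : I -> set T) :
  (0 < s)%R -> (0 <= eta)%R -> E `<=` \bigcup_(i in J) F i ->
  premeasure s eta E <= \esum_(i in J) premeasure s eta (F i).
Proof.
move=> s0 eta0 EF.
(* One infinite term makes the bound trivial; finiteness is required to pick nearly optimal
   covers. *)
have [[i Ji Fi]|allfin] := pselect (exists2 i, J i & premeasure s eta (F i) = +oo).
  apply: (@le_trans _ _ +oo); first exact: leey.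
  rewrite -Fi -[leLHS](@esum_set1 R _ i (fun i => premeasure s eta (F i))) ?premeasure_ge0//.
  by apply: subset_esum => _ ->.
have Ffin i : J i -> premeasure s eta (F i) \is a fin_num.
  move=> Ji; rewrite ge0_fin_numE ?premeasure_ge0// ltey.
  by apply/eqP => Fi; apply: allfin; exists i.
apply/lee_addgt0Pr => e e0.
have /choice[U UP] : forall i, exists U : nat -> set T, J i ->
    [/\ F i `<=` \bigcup_k U k, forall k, diameter (U k) <= eta%:E &
      \sum_(0 <= k <oo) diameter (U k) `^ s <=
        premeasure s eta (F i) + (e / (2 ^ (pickle i).+1)%:R)%:E].
  move=> i; have [Ji|nJi] := pselect (J i); last by exists (fun=> set0).
  have e'0 : (0 < e / (2 ^ (pickle i).+1)%:R)%R by rewrite divr_gt0// ltr0n expn_gt0.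
  have [_ [U [FU Ueta] <-] /ltW ?] := lb_ereal_inf_adherent e'0 (Ffin i Ji).
  by exists U.
apply: le_trans (premeasure_le_esum (J := J `*`` (fun=> [set: nat]))
  (U := fun k => U k.1 k.2) s0 eta0 _ _) _.
- by move=> p /EF[i Ji /(let: And3 h _ _ := UP i Ji in h p)[k _ Ukp]]; exists (i, k).
- by move=> [i k] [Ji _]; have [_ + _] := UP i Ji; exact.
rewrite -(@esum_esum _ _ _ J (fun=> [set: nat]) (fun i k => diameter (U i k) `^ s)); last first.
  by move=> i k _ _; exact: poweR_ge0.
apply: (@le_trans _ _ (\esum_(i in J)
    (premeasure s eta (F i) + (e / (2 ^ (pickle i).+1)%:R)%:E)%E)).
  apply: le_esum => i Ji; have [_ _] := UP i Ji.
  by rewrite nneseries_esumT// => k; exact: poweR_ge0.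
rewrite esumD; [|by move=> i _; exact: premeasure_ge0|by move=> i _; rewrite lee_fin divr_ge0// ltW].
by rewrite leeD2l// esum_epsilon// ltW.
Qed.

Lemma premeasure_le_diameter s eta r E : (0 < s)%R -> (0 <= r <= eta)%R ->
  (forall p q, E p -> E q -> (dist p q <= r)%R) ->
  premeasure s eta E <= (r `^ s)%:E.
Proof.
move=> s0 /andP[r0 reta] Er.
have dE := diameter_le r0 Er.
apply: le_trans (premeasure_le_esum (J := [set: unit]) (U := fun=> E) s0 _ _ _) _.
- exact: le_trans reta.
- by move=> p Ep; exists tt.
- by move=> _ _; apply: le_trans dE _; rewrite lee_fin.
rewrite esum_fin; last by move=> _; exact: poweR_ge0.
rewrite big_const card_unit /= adde0 -poweR_EFin.
by apply: (gt0_ler_poweR (ltW s0)); rewrite ?in_itv/= ?diameter_ge0 ?lee_fin ?leey ?andbT //.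
Qed.

(** Cuts a cube into [n ^ d] cells. Only the coordinates [crd] are cut: for the graph, time is left
    alone and is controlled through the assumption on [dist]. *)
Lemma premeasure_cells {d : nat} (crd : 'I_d -> T -> R) (b : 'I_d -> R) (n : nat)
    s eta (delta r : R) E :
  (0 < s)%R -> (0 <= r <= eta)%R -> (0 < delta)%R ->
  (forall p i, E p -> (b i <= crd i p < b i + n%:R * delta)%R) ->
  (forall p q, E p -> E q -> (forall i, (`|crd i p - crd i q| <= delta)%R) ->
    (dist p q <= r)%R) ->
  premeasure s eta E <= (n%:R ^+ d * r `^ s)%:E.
Proof.
move=> s0 reta delta0 Eb Er.
pose F (c : {ffun 'I_d -> 'I_n}) : set T := [set p | E p /\
  forall i, (b i + (c i)%:R * delta <= crd i p <= b i + ((c i)%:R + 1) * delta)%R].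
have eta0 : (0 <= eta)%R by case/andP: reta; exact: le_trans.
apply: le_trans (premeasure_subadd (J := [set: {ffun 'I_d -> 'I_n}]) (F := F) s0 eta0 _) _.
  move=> p Ep; have ci i : exists c : 'I_n,
      (b i + c%:R * delta <= crd i p <= b i + (c%:R + 1) * delta)%R.
    have /andP[b1 b2] := Eb p i Ep.
    have x0 : (0 <= (crd i p - b i) / delta)%R by rewrite divr_ge0 ?subr_ge0// ltW.
    have kn : (Num.truncn ((crd i p - b i) / delta) < n)%N.
      by rewrite truncn_lt_nat// ltr_pdivrMr// ltrBlDl.
    exists (Ordinal kn) => /=; have /andP[k1 k2] := truncn_itv x0.
    rewrite -lerBrDl -ler_pdivlMr// k1/= -lerBlDl -ler_pdivrMr// natr1 ltW//.
  have /choice[c cP] := ci; exists [ffun i => c i] => //.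
  by split=> // i; rewrite ffunE.
rewrite esum_fin; last by move=> c; exact: premeasure_ge0.
apply: (@le_trans _ _ (\sum_(c : {ffun 'I_d -> 'I_n}) (r `^ s)%:E)).
  apply: lee_sum => c _; apply: premeasure_le_diameter => // p q [Ep cp] [Eq cq].
  apply: Er => // i; have /andP[p1 p2] := cp i; have /andP[q1 q2] := cq i.
  by rewrite ler_norml; apply/andP; split; lra.
by rewrite sumEFin sumr_const card_ffun !card_ord lee_fin -[leLHS]mulr_natl natrX.
Qed.

Lemma hausdorff_measure_eq0 s E :
  (forall eta e, (0 < eta)%R -> (0 < e)%R -> premeasure s eta E <= e%:E) ->
  hausdorff_measure dist s E = 0.
Proof.
move=> H; apply/eqP; rewrite eq_le; apply/andP; split; last first.
  apply: le_ereal_sup_tmp; exists (premeasure s 1 E); last exact: premeasure_ge0.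
  by exists 1%R => //=.
apply: ge_ereal_sup => _ [eta /= eta0 <-].
by apply/lee_addgt0Pr => e e0; rewrite add0e; exact: H.
Qed.

Lemma premeasure_eq0 s eta E : hausdorff_measure dist s E = 0 -> (0 < eta)%R ->
  premeasure s eta E = 0.
Proof.
move=> E0 eta0; apply/eqP; rewrite eq_le premeasure_ge0 andbT -E0.
by apply: ereal_sup_ubound; exists eta.
Qed.

Lemma hausdorff_dim_le s E : (0 < s)%R -> hausdorff_measure dist s E = 0 ->
  hausdorff_dim dist E <= s%:E.
Proof. by move=> s0 E0; apply: ereal_inf_lbound; exists s. Qed.

End hausdorff_premeasure_theory.

Lemma sum_sqr_le {R : realType} (n : nat) (x : 'I_n -> R) (r : R) : 0 <= r ->
  (forall i, `|x i| <= r) -> Num.sqrt (\sum_i x i ^+ 2) <= Num.sqrt n%:R * r.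
Proof.
move=> r0 xr; rewrite -[in leRHS](ger0_norm r0) -sqrtr_sqr -sqrtrM//.
apply: ler_wsqrtr; apply: (@le_trans _ _ (\sum_(i < n) r ^+ 2)).
  apply: ler_sum => i _; rewrite -[leLHS]real_normK ?num_real//.
  by rewrite lerXn2r ?nnegrE.
by rewrite sumr_const card_ord -[leLHS]mulr_natl.
Qed.

Lemma euclidean_dist_le {R : realType} {d : nat} (p q : 'rV[R]_d) (r : R) : 0 <= r ->
  (forall i, `|p ord0 i - q ord0 i| <= r) ->
  euclidean_dist p q <= Num.sqrt d%:R * r.
Proof. exact: sum_sqr_le. Qed.

Lemma spacetime_dist_le {R : realType} {d : nat} (p q : R * 'rV[R]_d) (r : R) : 0 <= r ->
  `|p.1 - q.1| <= r -> (forall i, `|p.2 ord0 i - q.2 ord0 i| <= r) ->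
  spacetime_dist p q <= Num.sqrt d.+1%:R * r.
Proof.
move=> r0 tr xr; have := @sum_sqr_le R d.+1
  (fun i => if unlift ord0 i is Some j then p.2 ord0 j - q.2 ord0 j else p.1 - q.1) r r0.
rewrite big_ord_recl unlift_none.
under eq_bigr do rewrite liftK.
by apply=> i; case: unliftP.
Qed.

(** * Covers of the image and the graph along a Hölder path *)

Section upper_bound.
Context {R : realType} {d : nat}.
Variables (H g beta : R) (f X : R -> 'rV[R]_d) (A : set R).
Hypothesis H1 : 0 < H < 1.
Hypothesis gH : 0 < g < H.
Hypothesis beta0 : 0 < beta.
Hypothesis A01 : A `<=` `[0, 1].
Variables (N : nat) (C : R).
Hypothesis C0 : 0 <= C.
Hypothesis X_holder : forall s t i, 0 <= s <= 1 -> 0 <= t <= 1 -> `|t - s| <= 2^-1 ^+ N ->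
  `|X t ord0 i - X s ord0 i| <= C * `|t - s| `^ g.
Hypothesis f0 : parabolic_content H beta (graph_on A f) = 0%E.

Let g0 : 0 < g. Proof. by case/andP: gH. Qed.
Let g_lt1 : g < 1. Proof. by move: gH H1 => /andP[_ ?] /andP[_]; exact: lt_trans. Qed.

Let piece a b delta : set R := [set t | A t /\ parabolic_box H a b delta (t, f t)].

(* The drift moves a point by at most delta ^ H <= delta ^ g within a parabolic
   box of size delta. *)
Let piece_small a b delta t s : 0 <= delta <= 1 -> delta <= 2^-1 ^+ N ->
  piece a b delta t -> piece a b delta s ->
  `|t - s| <= delta /\
  forall i, `|(X t + f t) ord0 i - (X s + f s) ord0 i| <= (C + 1) * delta `^ g.
Proof.
move=> /andP[d0 d1] dN [At [/= /andP[t1 t2] ft]] [As [/= /andP[s1 s2] fs]].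
have ts : `|t - s| <= delta by rewrite ler_norml; apply/andP; split; lra.
split => // i; rewrite !mxE.
have fts : `|f t ord0 i - f s ord0 i| <= delta `^ H.
  have /andP[? ?] := ft i; have /andP[? ?] := fs i.
  by rewrite ler_norml; apply/andP; split; lra.
have dHg : delta `^ H <= delta `^ g.
  have [->|dn0] := eqVneq delta 0; first by rewrite !powR0 ?gt_eqF//; case/andP: H1.
  apply: ger_powR; last by case/andP: gH => _ /ltW.
  by rewrite lt_neqAle eq_sym dn0 d0.
have Xts : `|X t ord0 i - X s ord0 i| <= C * delta `^ g.
  apply: le_trans (X_holder _ _ _ _) _.
  - by have := A01 As; rewrite /= in_itv.
  - by have := A01 At; rewrite /= in_itv.
  - exact: le_trans dN.
  - by apply: ler_wpM2l => //; apply: ge0_ler_powR; rewrite ?nnegrE ?(ltW g0).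
rewrite (_ : _ - _ = (X t ord0 i - X s ord0 i) + (f t ord0 i - f s ord0 i)); last by ring.
by apply: le_trans (ler_normD _ _) _; rewrite mulrDl mul1r lerD// (le_trans fts).
Qed.

(** The content does not restrict box sizes, but a total below D^beta forces every size to be at
    most D. *)
Let small_cover (D e : R) : 0 < D -> 0 < e -> exists a b delta,
  [/\ forall j, 0 <= delta j <= D, A `<=` \bigcup_j piece (a j) (b j) (delta j) &
    (\sum_(0 <= j <oo) (delta j `^ beta)%:E <= e%:E)%E].
Proof.
move=> D0 e0; pose e' := Num.min (D `^ beta) e.
have e'0 : 0 < e' by rewrite lt_min powR_gt0.
have : (parabolic_content H beta (graph_on A f) < e'%:E)%E by rewrite f0 lte_fin.
move=> /ereal_inf_lt[_ [a [b [delta [d0 cov ->]]]] /ltW Se].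
have {}Se : (\sum_(0 <= j <oo) (delta j `^ beta)%:E <= e'%:E)%E by exact: Se.
exists a, b, delta; split.
- move=> j; rewrite d0/= leNgt; apply/negP => Dd.
  have : (e'%:E < (delta j `^ beta)%:E)%E.
    rewrite lte_fin gt_min gt0_ltr_powR ?nnegrE//; exact: ltW.
  apply/negP; rewrite -leNgt; apply: le_trans Se.
  apply: le_trans (nneseries_lim_ge j.+1 _); last by move=> n _ _; rewrite lee_fin powR_ge0.
  by rewrite big_nat_recr//= leeDr// sume_ge0// => i _; rewrite lee_fin powR_ge0.
- move=> t At; have [|j _ bj] := cov (t, f t); first by exists t.
  by exists j.
- by apply: le_trans Se _; rewrite lee_fin ge_min lexx orbT.
Qed.

(* [phi] stands for both t |-> X t + f t and its graph map. *)
Lemma hausdorff_measure_image_eq0 {T : Type} (dist : T -> T -> R) (phi : R -> T) (k : R) :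
  0 < k ->
  (forall t s r, 0 <= r -> `|t - s| <= r ->
    (forall i, `|(X t + f t) ord0 i - (X s + f s) ord0 i| <= r) ->
    dist (phi t) (phi s) <= k * r) ->
  hausdorff_measure dist (beta / g) (phi @` A) = 0%E.
Proof.
move=> k0 dist_phi; apply: hausdorff_measure_eq0 => eta e eta0 e0.
have s0 : 0 < beta / g by rewrite divr_gt0.
pose K := k * (C + 1); have K0 : 0 < K by rewrite mulr_gt0// ltr_wpDl.
pose D := Num.min (2^-1 ^+ N) ((eta / K) `^ g^-1).
have D0 : 0 < D by rewrite lt_min exprn_gt0 ?invr_gt0//= powR_gt0// divr_gt0.
have D1 : D <= 1.
  by rewrite ge_min exprn_ile1 ?invr_ge0// invf_le1//; lra.
have DN : D <= 2^-1 ^+ N by rewrite ge_min lexx.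
have Ke : 0 < e / K `^ (beta / g) by rewrite divr_gt0// powR_gt0.
have [a [b [delta [dD cov Se]]]] := small_cover D0 Ke.
pose U j := phi @` piece (a j) (b j) (delta j).
have diamU j p q : U j p -> U j q -> dist p q <= K * delta j `^ g.
  have /andP[d0 dj] := dD j.
  have d01 : 0 <= delta j <= 1 by rewrite d0 (le_trans dj).
  have dN := le_trans dj DN.
  move=> [t Ut <-] [s Us <-]; rewrite /K -mulrA; apply: dist_phi.
  - by rewrite mulr_ge0 ?powR_ge0 ?addr_ge0.
  - have [ts _] := piece_small d01 dN Ut Us; apply: le_trans ts _.
    apply: (@le_trans _ _ (delta j `^ g)); last by rewrite ler_peMl ?powR_ge0// lerDr.
    have [->|dn0] := eqVneq (delta j) 0; first by rewrite powR0 ?gt_eqF.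
    rewrite -[leLHS]powRr1//; apply: ger_powR (ltW g_lt1).
    by rewrite lt_neqAle eq_sym dn0.
  - by have [] := piece_small d01 dN Ut Us.
have Kd0 j : 0 <= K * delta j `^ g by rewrite mulr_ge0 ?powR_ge0// ltW.
apply: le_trans (premeasure_le_esum (J := [set: nat]) (U := U) s0 (ltW eta0) _ _) _.
- by move=> _ [t /cov[j _ Uj] <-]; exists j => //; exists t.
- move=> j _; apply: le_trans (diameter_le (Kd0 j) (diamU j)) _.
  rewrite lee_fin mulrC -ler_pdivlMr//.
  rewrite -[leRHS](_ : ((eta / K) `^ g^-1) `^ g = _); last first.
    by rewrite -powRrM mulVf ?gt_eqF// powRr1// divr_ge0 ?ltW.
  have /andP[d0 dj] := dD j.
  apply: ge0_ler_powR; rewrite ?nnegrE ?(ltW g0) ?powR_ge0//.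
  by rewrite (le_trans dj)// ge_min lexx orbT.
apply: (@le_trans _ _ (\esum_(j in [set: nat]) ((K `^ (beta / g))%:E * (delta j `^ beta)%:E))%E).
  apply: le_esum => j _; have /andP[d0 _] := dD j.
  apply: le_trans (gt0_ler_poweR (ltW s0) _ _ (diameter_le (Kd0 j) (diamU j))) _.
  - by rewrite in_itv/= diameter_ge0 leey.
  - by rewrite in_itv/= lee_fin Kd0 leey.
  rewrite poweR_EFin -EFinM lee_fin powRM ?powR_ge0 ?(ltW K0)// -powRrM.
  by rewrite mulrCA mulfV ?mulr1// gt_eqF.
rewrite esumZl ?powR_gt0//; last by move=> j; rewrite lee_fin powR_ge0.
rewrite -nneseries_esumT; last by move=> j; rewrite lee_fin powR_ge0.
apply: le_trans (lee_wpmul2l _ Se) _; first by rewrite lee_fin powR_ge0.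
by rewrite -EFinM lee_fin mulrC mulfVK// gt_eqF// powR_gt0.
Qed.

(** A piece of duration delta has space extent of order delta^g. Cutting it at side delta gives
    about delta^(d (g - 1)) cells of diameter of order delta, and the exponent is chosen so that
    their total is a multiple of delta^beta. *)
Lemma hausdorff_measure_graph_eq0 :
  hausdorff_measure spacetime_dist (beta + d%:R * (1 - g))
    (graph_on A (fun t => X t + f t)) = 0%E.
Proof.
apply: hausdorff_measure_eq0 => eta e eta0 e0.
pose s := beta + d%:R * (1 - g).
have dg : 0 <= d%:R * (1 - g) by rewrite mulr_ge0// subr_ge0 ltW.
have s0 : 0 < s by rewrite ltr_wpDr.
pose k : R := Num.sqrt d.+1%:R; have k0 : 0 < k by rewrite sqrtr_gt0 ltr0n.
(* The final 1 absorbs the rounding up of the number of cells, as delta^(g - 1) >= 1. *)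
pose L := 2 * (C + 1) + 1; have L0 : 0 < L by have := C0; rewrite /L; lra.
pose D := Num.min (2^-1 ^+ N) (eta / k).
have D0 : 0 < D by rewrite lt_min exprn_gt0 ?invr_gt0//= divr_gt0.
have D1 : D <= 1 by rewrite ge_min exprn_ile1 ?invr_ge0// invf_le1//; lra.
have DN : D <= 2^-1 ^+ N by rewrite ge_min lexx.
pose c := L ^+ d * k `^ s; have c0 : 0 < c by rewrite mulr_gt0 ?exprn_gt0 ?powR_gt0.
have ce : 0 < e / c by rewrite divr_gt0.
have [a [b [delta [dD cov Se]]]] := small_cover D0 ce.
pose phi t := (t, X t + f t).
pose U j := phi @` piece (a j) (b j) (delta j).
have U_le j : (hausdorff_premeasure spacetime_dist s eta (U j) <=
    c%:E * (delta j `^ beta)%:E)%E.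
  have /andP[d0 dj] := dD j; have d1 := le_trans dj D1; have dN := le_trans dj DN.
  have d01 : 0 <= delta j <= 1 by rewrite d0.
  have [U0|/set0P[_ [t0 Ut0 _]]] := eqVneq (U j) set0.
    rewrite U0; apply: le_trans (premeasure_le_diameter (r := 0) s0 _ _) _ => //.
      by rewrite lexx ltW.
    by rewrite powR0 ?gt_eqF// -EFinM lee_fin mulr_ge0 ?powR_ge0// ltW.
  (* A box of size 0 leaves a single point; it is treated apart because the cell count divides by
     [delta j]. *)
  have [dj0|dn0] := eqVneq (delta j) 0.
    apply: le_trans (premeasure_le_diameter (r := 0) s0 _ _) _.
    - by rewrite lexx ltW.
    - move=> _ _ [t Ut <-] [u Uu <-]; have [tu Xtu] := piece_small d01 dN Ut Uu.
      apply: le_trans (spacetime_dist_le (r := 0) _ _ _) _; rewrite ?mulr0//=.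
        by rewrite -dj0.
      by move=> i; apply: le_trans (Xtu i) _; rewrite dj0 powR0 ?mulr0// gt_eqF.
    - by rewrite powR0 ?gt_eqF// -EFinM lee_fin mulr_ge0 ?powR_ge0// ltW.
  have dgt0 : 0 < delta j by rewrite lt_neqAle eq_sym dn0.
  have dg0 : 0 < delta j `^ (g - 1) by rewrite powR_gt0.
  pose l := (C + 1) * delta j `^ g; have l0 : 0 <= l by rewrite mulr_ge0 ?powR_ge0 ?addr_ge0.
  pose n := (Num.truncn (2 * l / delta j)).+1.
  have ldn : 2 * l < n%:R * delta j by rewrite -ltr_pdivrMr// truncnS_gt.
  have nL : n%:R <= L * delta j `^ (g - 1).
    have -> : n%:R = (Num.truncn (2 * l / delta j))%:R + 1 :> R by rewrite natr1.
    rewrite /L [leRHS]mulrDl [X in _ <= _ + X]mul1r; apply: lerD.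
      have nn : 0 <= 2 * l / delta j by rewrite divr_ge0// mulr_ge0.
      apply: le_trans (_ : 2 * l / delta j <= _); first by rewrite truncn_le.
      rewrite /l powRB ?(gt_eqF dgt0) ?implybT// powRr1// le_eqVlt; apply/orP; left; apply/eqP.
      by ring.
    have {1}-> : (1 : R) = delta j `^ 0 by rewrite powRr0.
    by apply: ger_powR; rewrite ?dgt0// subr_le0 ltW.
  pose z0 := X t0 + f t0.
  apply: le_trans (premeasure_cells (crd := fun i (p : R * 'rV[R]_d) => p.2 ord0 i) (b := fun i => z0 ord0 i - l)
    (n := n) (delta := delta j) (r := k * delta j) s0 _ dgt0 _ _) _.
  - rewrite mulr_ge0 ?(ltW k0)//= mulrC -ler_pdivlMr// (le_trans dj)// ge_min lexx orbT//.
  - move=> _ i [t Ut <-] /=; have [_ /(_ i)] := piece_small d01 dN Ut Ut0.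
    rewrite -/l -/z0 ler_norml => /andP[h1 h2]; apply/andP; split; lra.
  - move=> _ _ [t Ut <-] [u Uu <-] tu; apply: spacetime_dist_le => //=.
    by have [] := piece_small d01 dN Ut Uu.
  rewrite -EFinM lee_fin.
  apply: (@le_trans _ _ ((L * delta j `^ (g - 1)) ^+ d * (k * delta j) `^ s)).
    apply: ler_wpM2r; first exact: powR_ge0.
    by apply: lerXn2r; rewrite ?nnegrE// mulr_ge0 ?(ltW L0) ?(ltW dg0).
  rewrite exprMn powRM ?(ltW k0)// mulrACA -/c; apply: ler_wpM2l; first exact: ltW.
  rewrite -powR_mulrn ?(ltW dg0)// -powRrM -powRD ?(gt_eqF dgt0) ?implybT//.
  by rewrite (_ : (g - 1) * d%:R + s = beta)//; rewrite /s; ring.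
apply: le_trans (premeasure_subadd spacetime_dist (J := [set: nat]) (F := U) s0 (ltW eta0) _) _.
  by move=> _ [t /cov[j _ Uj] <-]; exists j => //; exists t.
apply: (@le_trans _ _ (\esum_(j in [set: nat]) (c%:E * (delta j `^ beta)%:E))%E).
  by apply: le_esum => j _; exact: U_le.
rewrite esumZl//; last by move=> j; rewrite lee_fin powR_ge0.
rewrite -nneseries_esumT; last by move=> j; rewrite lee_fin powR_ge0.
apply: le_trans (lee_wpmul2l _ Se) _; first by rewrite lee_fin ltW.
by rewrite -EFinM lee_fin mulrC mulfVK// gt_eqF.
Qed.

End upper_bound.

Lemma hausdorff_measure_euclidean_eq0 {R : realType} {d : nat} (s : R) (E : set 'rV[R]_d) :
  d%:R < s -> hausdorff_measure euclidean_dist s E = 0%E.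
Proof.
move=> ds; have s0 : 0 < s by apply: le_lt_trans ds.
pose F (l : {ffun 'I_d -> int}) : set 'rV[R]_d :=
  [set p | forall i, (l i)%:~R <= p ord0 i < (l i)%:~R + 1].
apply: hausdorff_measure_eq0 => eta e eta0 e0.
suff F0 l : hausdorff_premeasure euclidean_dist s eta (F l) = 0%E.
  apply: le_trans (premeasure_subadd euclidean_dist (J := [set: {ffun 'I_d -> int}]) (F := F) s0 (ltW eta0) _) _.
    move=> p _; exists [ffun i => Num.floor (p ord0 i)] => // i.
    by rewrite ffunE floor_le_tmp/= -intrD1 floorD1_gt.
  by rewrite esum1 ?lee_fin ?(ltW e0)// => l _; exact: F0.
apply/eqP; rewrite eq_le premeasure_ge0 andbT.
apply/lee_addgt0Pr => e' e'0; rewrite add0e.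
(* The added 1 keeps [k] positive when d = 0. *)
pose k : R := Num.sqrt d%:R + 1.
have k0 : 0 < k by rewrite ltr_wpDl ?sqrtr_ge0.
pose c := k `^ s; have c0 : 0 < c by rewrite powR_gt0.
pose D := Num.min (eta / k) ((e' / c) `^ (s - d%:R)^-1).
have D0 : 0 < D by rewrite lt_min !(divr_gt0, powR_gt0).
pose n := (Num.truncn D^-1).+1.
have n0 : 0 < n%:R :> R by rewrite ltr0n.
have nD : n%:R^-1 <= D.
  by rewrite -[leRHS]invrK lef_pV2 ?posrE ?invr_gt0// ltW// truncnS_gt.
apply: le_trans (premeasure_cells (crd := fun i (p : 'rV[R]_d) => p ord0 i) (b := fun i => (l i)%:~R)
    (n := n) (delta := n%:R^-1) (r := k * n%:R^-1) s0 _ _ _ _) _.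
- rewrite mulr_ge0 ?invr_ge0 ?(ltW k0)//= mulrC -ler_pdivlMr// (le_trans nD)// ge_min lexx//.
- by rewrite invr_gt0.
- by move=> p i /(_ i); rewrite mulfV// gt_eqF.
- move=> p q _ _ pq; apply: le_trans (euclidean_dist_le (r := n%:R^-1) _ pq) _.
    by rewrite invr_ge0.
  by rewrite ler_pM2r ?invr_gt0// lerDl.
rewrite lee_fin powRM ?invr_ge0 ?(ltW k0)// -/c mulrCA mulrC -ler_pdivlMr//.
have -> : n%:R ^+ d = n%:R^-1 `^ (- d%:R) :> R.
  by rewrite powRN powR_mulrn ?invr_ge0// exprVn invrK.
rewrite -powRD; last by rewrite (gt_eqF (_ : 0 < n%:R^-1)) ?implybT// invr_gt0.
have sd : 0 < s - d%:R by rewrite subr_gt0.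
rewrite addrC -[leRHS](_ : ((e' / c) `^ (s - d%:R)^-1) `^ (s - d%:R) = _); last first.
  by rewrite -powRrM mulVf ?gt_eqF// powRr1// divr_ge0 ?ltW.
apply: ge0_ler_powR; rewrite ?nnegrE ?powR_ge0 ?invr_ge0 ?(ltW sd)//.
by rewrite (le_trans nD)// ge_min lexx orbT.
Qed.

(** * Lower bounds *)

Section mass_distribution.
Context {R : realType} {dU : measure_display} {U : measurableType dU}.
Variables (mu : {finite_measure set U -> \bar R}).
Context {T : Type} (dist : T -> T -> R) (phi : U -> T).
Variables (B : nat -> U -> set U) (s : R).
Hypothesis s_gt0 : 0 < s.
Hypothesis mB : forall k u, measurable (B k u).
Hypothesis phi_B : forall k u v, dist (phi u) (phi v) <= 2^-1 ^+ k -> B k u v.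

Let half0 n : 0 < (2^-1 : R) ^+ n. Proof. by rewrite exprn_gt0// invr_gt0. Qed.

(** Each covering set that meets the image of [G] lies in a ball around one of its points, at a
    dyadic scale comparable to its diameter. Diameters at most 1 permit the passage from [s] down to
    [s0]. *)
Lemma hausdorff_measure_neq0 (s0 M : R) (G : set U) (E : set T) :
  0 < s0 <= s -> measurable G -> (0 < mu G)%E -> 0 <= M ->
  (forall k u, G u -> (mu (B k u) <= (M * (2^-1 ^+ k) `^ s)%:E)%E) ->
  (forall u, E (phi u)) -> hausdorff_measure dist s0 E <> 0%E.
Proof.
move=> /andP[s00 s0s] mG G0 M0 BM Ephi E0.
have := premeasure_eq0 E0 ltr01 => pre0.
suff : (mu G <= 0)%E by rewrite leNgt G0.
apply/lee_addgt0Pr => e e0; rewrite add0e.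
pose K := M * 2 `^ s; have K0 : 0 <= K by rewrite mulr_ge0 ?powR_ge0.
pose e1 := e / 2 / (K + 1); have e10 : 0 < e1 by rewrite !divr_gt0// ltr_wpDl.
have : (hausdorff_premeasure dist s0 1 E < e1%:E)%E by rewrite pre0 lte_fin.
move=> /ereal_inf_lt[_ [V [EV V1] <-] /ltW Ve].
(* The preimage of [V j] may fail to be measurable; a set [B k u] that contains its part in [G]
   replaces it. *)
have /choice[W WP] : forall j, exists W : set U, [/\ measurable W,
    forall u, G u -> V j (phi u) -> W u &
    (mu W <= K%:E * diameter dist (V j) `^ s0 + (e / 2 / (2 ^ j.+1)%:R)%:E)%E].
  move=> j; have ej : 0 < e / 2 / (2 ^ j.+1)%:R :> R by rewrite !divr_gt0// ltr0n expn_gt0.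
  have [[u Gu Vu]|noG] := pselect (exists2 u, G u & V j (phi u)); last first.
    exists set0; split => //; first by move=> u Gu Vu; apply: noG; exists u.
    by rewrite measure0 adde_ge0 ?mule_ge0 ?poweR_ge0// lee_fin// ltW.
  have dfin : diameter dist (V j) \is a fin_num.
    by rewrite ge0_fin_numE ?diameter_ge0//; apply: le_lt_trans (V1 j) (ltry _).
  pose delta := fine (diameter dist (V j)).
  have dE : diameter dist (V j) = delta%:E by rewrite fineK.
  have d0 : 0 <= delta by rewrite -lee_fin -dE diameter_ge0.
  have d1 : delta <= 1 by rewrite -lee_fin -dE.
  have BV k : delta <= 2^-1 ^+ k -> forall v, G v -> V j (phi v) -> B k u v.
    move=> dk v Gv Vv; apply: phi_B; apply: le_trans dk.
    by rewrite -lee_fin -dE; exact: dist_le_diameter.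
  (* No dyadic scale is comparable to diameter 0. A ball small enough to be paid for by the error
     term of index [j] is used. *)
  have [delta0|deltan0] := eqVneq delta 0.
    have Me : 0 < e / 2 / (2 ^ j.+1)%:R / (M + 1) by rewrite divr_gt0// ltr_wpDl.
    have [k kP] := half_exp_small (powR_gt0 s^-1 Me).
    exists (B k u); split => //; first by apply: BV; rewrite delta0 ltW.
    rewrite dE delta0 poweR0r ?gt_eqF// mule0 add0e.
    apply: le_trans (BM k u Gu) _; rewrite lee_fin.
    have -> : e / 2 / (2 ^ j.+1)%:R = (M + 1) * (e / 2 / (2 ^ j.+1)%:R / (M + 1)).
      by rewrite mulrCA mulfV ?mulr1// gt_eqF// ltr_wpDl.
    apply: ler_pM; rewrite ?powR_ge0 ?lerDl//.
    rewrite -[leRHS](_ : ((e / 2 / (2 ^ j.+1)%:R / (M + 1)) `^ s^-1) `^ s = _); last first.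
      by rewrite -powRrM mulVf ?gt_eqF// powRr1// ltW.
    by apply: ge0_ler_powR; rewrite ?nnegrE ?powR_ge0 ?(ltW s_gt0) ?(ltW (half0 _)) ?(ltW kP).
  have dgt0 : 0 < delta by rewrite lt_neqAle eq_sym deltan0.
  have ex := half_exp_small dgt0; case: (ex_minnP ex) => -[|k] hk kmin.
    by move: hk; rewrite expr0 ltNge d1.
  have dk : delta <= 2^-1 ^+ k by rewrite leNgt; apply/negP => /kmin; rewrite ltnn.
  exists (B k u); split => //; first exact: BV.
  apply: le_trans (BM k u Gu) _; rewrite dE poweR_EFin -EFinM -EFinD lee_fin.
  apply: (@le_trans _ _ (K * delta `^ s0)); last by rewrite lerDl ltW.
  rewrite /K -mulrA; apply: ler_wpM2l => //.
  apply: (@le_trans _ _ (2 `^ s * delta `^ s)).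
    rewrite -powRM//; apply: ge0_ler_powR; rewrite ?nnegrE ?(ltW s_gt0) ?(ltW (half0 _)) ?mulr_ge0//.
    by move: hk; rewrite exprS; lra.
  by apply: ler_wpM2l; [exact: powR_ge0|apply: ger_powR; rewrite ?dgt0].
have mW j : measurable (W j) by have [] := WP j.
apply: (@le_trans _ _ (mu (\bigcup_j W j))).
  apply: le_measure; rewrite ?inE//; first exact: bigcup_measurable.
  move=> u Gu; have [j _ Vj] := EV _ (Ephi u); exists j => //.
  by have [_ + _] := WP j; exact.
apply: le_trans (generalized_Boole_inequality mu mW (bigcup_measurable (fun k _ => mW k))) _.
apply: (@le_trans _ _ (\sum_(0 <= j <oo)
    (K%:E * diameter dist (V j) `^ s0 + (e / 2 / (2 ^ j.+1)%:R)%:E))%E).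
  apply: lee_nneseries => j _; [by []|by have [] := WP j].
apply: le_trans (epsilon_trick _ _ _) _.
- by move=> j; rewrite mule_ge0 ?poweR_ge0 ?lee_fin.
- by rewrite divr_ge0// ltW.
rewrite nneseriesZl; last by move=> j _; exact: poweR_ge0.
apply: (@le_trans _ _ (K%:E * e1%:E + (e / 2)%:E)%E).
  by rewrite leeD2r//; apply: lee_wpmul2l; rewrite ?lee_fin.
rewrite -EFinM -EFinD lee_fin /e1.
have Ke : K * (e / 2 / (K + 1)) <= e / 2.
  by rewrite mulrCA ler_piMr ?divr_ge0 ?(ltW e0)// ler_pdivrMr ?ltr_wpDl// mul1r lerDl.
lra.
Qed.

End mass_distribution.

Lemma powR_ge1 {R : realType} (z e : R) : 1 <= z -> 0 <= e -> 1 <= z `^ e.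
Proof. by move=> z1 e0; have := ler_powR z1 e0; rewrite powRr0. Qed.

(* [p] is the probability that a Gaussian vector of scale [sigma], shifted by a
   vector of size [a], falls in a box of size [r]. *)
Section small_ball_exponents.
Context {R : realType}.
Variables (d : nat) (q c K p sigma a r : R).
Hypothesis q0 : 0 < q.
Hypothesis c1 : 1 <= c.
Hypothesis K0 : 0 <= K.
Hypothesis sigma0 : 0 < sigma.
Hypothesis a0 : 0 <= a.
Hypothesis r0 : 0 < r.
Hypothesis p1 : p <= 1.
Hypothesis p_near : p <= (c * (r / sigma)) ^+ d.
Hypothesis p_far1 : 0 < a -> 2 * r <= a ->
  p <= K * (r / sigma) * (sigma / a) `^ (q + 1).
Hypothesis p_fard : 0 < a -> 2 * r <= a ->
  p <= K * (r / sigma) ^+ d * (sigma / a) `^ (q + 1).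

Let x := r / sigma.
Let x0 : 0 < x. Proof. exact: divr_gt0. Qed.
Let c0 : 0 < c. Proof. by apply: lt_le_trans c1. Qed.

Let scale : R := Num.max sigma a.
Let scale0 : 0 < scale. Proof. by rewrite lt_max sigma0. Qed.

(** For small ratios r / sigma, the power d may be lowered to q. When the shift a is below 2 r or
    the ratio is large, the bounds by 1 and by one coordinate take over. *)
Lemma small_ball_image_exponent : q <= d%:R ->
  p <= (c `^ q + 2 `^ q + K) * (r `^ q * scale `^ (- q)).
Proof.
move=> qd.
have -> : r `^ q * scale `^ (- q) = (r / scale) `^ q.
  by rewrite powRM ?invr_ge0 ?(ltW r0) ?(ltW scale0)// powRN -[scale^-1]powR_inv1 ?(ltW scale0)//
    -powRrM mulN1r powRN.
have cq := powR_ge0 c q; have q2 := powR_ge0 2 q; have K0' := K0.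
have [asigma|siga] := leP a sigma.
  have scaleE : scale = sigma by rewrite /scale max_l.
  apply: (@le_trans _ _ (c `^ q * x `^ q)); last first.
    by rewrite scaleE -/x ler_wpM2r ?powR_ge0//; lra.
  rewrite -powRM ?(ltW c0) ?(ltW x0)//.
  have z0 : 0 < c * x by rewrite mulr_gt0.
  have [z1|z1] := leP 1 (c * x); first by rewrite (le_trans p1)// powR_ge1// ltW.
  apply: le_trans p_near _; rewrite -powR_mulrn ?(ltW z0)//.
  by apply: ger_powR => //; rewrite z0 ltW.
have scaleE : scale = a by rewrite /scale max_r// ltW.
have agt0 : 0 < a by apply: lt_trans siga.
rewrite scaleE.
have [ra|ra] := ltP a (2 * r).
  apply: (@le_trans _ _ (2 `^ q * (r / a) `^ q)); last first.
    by rewrite ler_wpM2r ?powR_ge0//; lra.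
  rewrite -powRM ?divr_ge0 ?(ltW r0)//; apply: le_trans p1 _.
  by apply: powR_ge1; rewrite ?(ltW q0)// mulrA ler_pdivlMr// mul1r ltW.
pose y := sigma / a; have y0 : 0 < y by exact: divr_gt0.
have y1 : y <= 1 by rewrite ler_pdivrMr// mul1r ltW.
have xy : r / a = x * y by rewrite /x /y mulrA divfK// gt_eqF.
apply: (@le_trans _ _ (K * (r / a) `^ q)); last first.
  by rewrite ler_wpM2r ?powR_ge0//; lra.
rewrite xy powRM ?(ltW x0) ?(ltW y0)//.
have yq : y `^ (q + 1) = y * y `^ q.
  by rewrite powRD ?(gt_eqF y0) ?implybT// powRr1 ?(ltW y0)// mulrC.
(* The spare power of y = sigma / a in the exponent q + 1 is spent here: for x >= 1 it compensates
   the factor x, because x y = r / a <= 1 <= x^q. *)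
have [x1|x1] := leP 1 x.
  apply: le_trans (p_far1 agt0 ra) _; rewrite -/x -/y yq -mulrA; apply: ler_wpM2l => //.
  rewrite mulrA; apply: ler_wpM2r; first exact: powR_ge0.
  apply: (@le_trans _ _ 1); last by rewrite powR_ge1// ltW.
  by rewrite -xy ler_pdivrMr// mul1r; have := r0; lra.
apply: le_trans (p_fard agt0 ra) _; rewrite -/x -/y yq -mulrA; apply: ler_wpM2l => //.
apply: ler_pM; [exact: exprn_ge0 (ltW x0)|exact: mulr_ge0 (ltW y0) (powR_ge0 _ _)| |].
  by rewrite -powR_mulrn ?(ltW x0)//; apply: ger_powR => //; rewrite x0 ltW.
by rewrite ler_piMl ?powR_ge0.
Qed.

(** All d factors r / sigma are used. The remaining sigma^(q - d) is at most r^(H (q - d)), and d +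
    H (q - d) is the exponent claimed. If a < 2 r, then (2 r / a)^q >= 1 suffices, since the
    exponent is at most q. *)
Lemma small_ball_graph_exponent (H : R) : 0 < H < 1 -> d%:R <= q -> r <= 1 ->
  sigma <= r `^ H ->
  p <= (c ^+ d + 2 `^ q + K) * (r `^ (H * q + d%:R * (1 - H)) * scale `^ (- q)).
Proof.
move=> /andP[H0 H1] dq r1 sigr; set s := H * q + d%:R * (1 - H).
have cd : 0 <= c ^+ d by rewrite exprn_ge0 ?(ltW c0).
have q2 := powR_ge0 2 q; have K0' := K0.
have rs0 : 0 < r `^ s by exact: powR_gt0.
have spread (z : R) : 0 < z -> r ^+ d * (sigma `^ (q - d%:R) * z `^ (- q)) <= r `^ s * z `^ (- q).
  move=> z0; rewrite mulrA; apply: ler_wpM2r; first exact: powR_ge0.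
  have -> : r `^ s = r ^+ d * (r `^ H) `^ (q - d%:R).
    rewrite -powRrM -powR_mulrn ?(ltW r0)// -powRD ?(gt_eqF r0) ?implybT//.
    by congr (_ `^ _); rewrite /s; ring.
  apply: ler_wpM2l; first by rewrite exprn_ge0 ?(ltW r0).
  by apply: ge0_ler_powR; rewrite ?nnegrE ?powR_ge0 ?(ltW sigma0) ?subr_ge0.
have sigd : sigma `^ (q - d%:R) = sigma `^ q / sigma ^+ d.
  by rewrite powRB ?(gt_eqF sigma0) ?implybT// powR_mulrn ?(ltW sigma0).
have [asigma|siga] := leP a sigma.
  have scaleE : scale = sigma by rewrite /scale max_l.
  rewrite scaleE; apply: (@le_trans _ _ (c ^+ d * (r `^ s * sigma `^ (- q)))); last first.
    by rewrite ler_wpM2r ?mulr_ge0 ?powR_ge0//; lra.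
  apply: le_trans p_near _; rewrite exprMn; apply: ler_wpM2l => //.
  apply: le_trans (spread _ sigma0); rewrite sigd expr_div_n powRN.
  rewrite le_eqVlt; apply/orP; left; apply/eqP.
  by rewrite [_ / _ * _]mulrAC mulfV ?gt_eqF ?powR_gt0// mul1r.
have scaleE : scale = a by rewrite /scale max_r// ltW.
have agt0 : 0 < a by apply: lt_trans siga.
rewrite scaleE.
have aq0 : 0 < a `^ (- q) by exact: powR_gt0.
have [ra|ra] := ltP a (2 * r).
  apply: (@le_trans _ _ (2 `^ q * (r `^ s * a `^ (- q)))); last first.
    by rewrite ler_wpM2r ?mulr_ge0 ?powR_ge0//; lra.
  apply: le_trans p1 _; apply: (@le_trans _ _ (2 `^ q * (r `^ q * a `^ (- q)))).
    rewrite mulrA -powRM ?(ltW r0)// powRN ler_pdivlMr ?powR_gt0// mul1r.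
    by apply: ge0_ler_powR; rewrite ?nnegrE ?(ltW q0) ?mulr_ge0 ?(ltW ra) ?(ltW r0).
  rewrite ler_pM2l ?powR_gt0// ler_pM2r//; apply: ger_powR; first by rewrite r0.
  rewrite -subr_ge0 /s (_ : _ - _ = (q - d%:R) * (1 - H)); last by ring.
  by rewrite mulr_ge0 ?subr_ge0// ltW.
pose y := sigma / a; have y0 : 0 < y by exact: divr_gt0.
have y1 : y <= 1 by rewrite ler_pdivrMr// mul1r ltW.
apply: (@le_trans _ _ (K * (r `^ s * a `^ (- q)))); last first.
  by rewrite ler_wpM2r ?mulr_ge0 ?powR_ge0//; lra.
apply: le_trans (p_fard agt0 ra) _; rewrite -mulrA; apply: ler_wpM2l => //.
apply: le_trans (spread _ agt0); rewrite sigd expr_div_n.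
apply: (@le_trans _ _ (r ^+ d / sigma ^+ d * y `^ q)).
  apply: ler_wpM2l; first by rewrite divr_ge0 ?exprn_ge0 ?(ltW r0) ?(ltW sigma0).
  by apply: ger_powR; rewrite ?y0// lerDl.
rewrite /y powRM ?invr_ge0 ?(ltW sigma0)// -[a^-1]powR_inv1// -powRrM mulN1r.
by rewrite le_eqVlt; apply/orP; left; apply/eqP; ring.
Qed.

End small_ball_exponents.

(** * Small ball probabilities for the increments of the process *)

Section fbm_small_ball.
Context {R : realType} {disp : measure_display} {Omega : measurableType disp}.
Variables (P : probability Omega R) (d : nat) (H : R) (X : R -> Omega -> 'rV[R]_d).
Hypothesis H01 : 0 < H < 1.
Hypothesis X_fbm : fractional_brownian_motion P H X.

Let comp (i : 'I_d) (t : R) (w : Omega) : R := X t w ord0 i.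

Let H0 : 0 < H. Proof. by case/andP: H01. Qed.

Let comp_fbm i : fractional_brownian_motion_1d P H (comp i).
Proof. by have [_] := X_fbm; exact. Qed.

Definition ball_event (s t r : R) (b : 'I_d -> R) (i : 'I_d) : set Omega :=
  [set w | `|increment (comp i) s t w - b i| <= r].

Lemma process_ball_event s t r b i : 0 <= s -> 0 <= t ->
  process_sigma_algebra (comp i) (ball_event s t r b i).
Proof.
move=> s0 t0; rewrite /process_sigma_algebra.
set G := (X in <<s X >>).
pose T := g_sigma_algebraType G.
have mcomp u : 0 <= u -> measurable_fun [set: T] (comp i u : T -> R).
  move=> u0 _ B mB; rewrite setTI; apply: sub_sigma_algebra.
  by exists u, B.
have mb : measurable_fun [set: T] (fun w : T => `|increment (comp i) s t w - b i| <= r).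
  apply: measurable_fun_ler => //; apply: measurableT_comp => //.
  apply: measurable_funB => //; apply: measurable_funB; exact: mcomp.
by have := mb measurableT [set true] Logic.I; rewrite setTI.
Qed.

Lemma ball_event_prod s t r b : 0 <= s -> 0 <= t ->
  (P (\bigcap_i ball_event s t r b i) = \prod_(i < d) P (ball_event s t r b i))%E.
Proof.
by move=> s0 t0; have [ind _] := X_fbm; apply: ind => i; exact: process_ball_event.
Qed.

Lemma measurable_ball_event s t r b i : 0 <= s -> 0 <= t ->
  measurable (ball_event s t r b i).
Proof.
move=> s0 t0; have [mi _] := increment_gaussian (comp_fbm i) s0 t0.
have mb : measurable_fun setT (fun w => `|increment (comp i) s t w - b i| <= r).
  by apply: measurable_fun_ler => //; apply: measurableT_comp => //; exact: measurable_funB.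
by have := mb measurableT [set true] Logic.I; rewrite setTI.
Qed.

Definition ball_const (q : R) : R :=
  120 ^+ d * (120 * decay_const (q + 1) * 2 `^ (q + 1)).

Lemma ball_const_ge0 q : 0 <= ball_const q.
Proof.
apply: mulr_ge0; first exact: exprn_ge0.
by apply: mulr_ge0; [apply: mulr_ge0; [exact: ler0n|exact: decay_const_ge0]|exact: powR_ge0].
Qed.

(** By independence the probability is a product. The factor [j] takes the far estimate, and the
    others are bounded by 1 or by the near estimate, which explains the factor 120^d in
    [ball_const]. *)
Lemma ball_event_estimates s t r b q (j : 'I_d) : 0 <= s -> 0 <= t -> s != t ->
  0 < r -> 0 < q ->
  let p := fine (P (\bigcap_i ball_event s t r b i)) in
  let sigma := `|t - s| `^ H in
  [/\ p <= 1, p <= (120 * (r / sigma)) ^+ d,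
      (0 < `|b j| -> 2 * r <= `|b j| ->
        p <= ball_const q * (r / sigma) * (sigma / `|b j|) `^ (q + 1)) &
      (0 < `|b j| -> 2 * r <= `|b j| ->
        p <= ball_const q * (r / sigma) ^+ d * (sigma / `|b j|) `^ (q + 1))].
Proof.
move=> s0 t0 st r0 q0 p sigma.
have ts0 : 0 < `|t - s| by rewrite normr_gt0 subr_eq0 eq_sym.
have sigma0 : 0 < sigma by exact: powR_gt0.
have mE i := measurable_ball_event r b i s0 t0.
pose pi i := fine (P (ball_event s t r b i)).
have piE i : P (ball_event s t r b i) = (pi i)%:E by rewrite fineK// fin_num_measure.
have pE : p = \prod_(i < d) pi i.
  rewrite /p ball_event_prod//; under eq_bigr do rewrite piE.
  by rewrite prodEFin.
have pi0 i : 0 <= pi i by rewrite -lee_fin -piE.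
have pi1 i : pi i <= 1 by rewrite -lee_fin -piE probability_le1.
have x0 : 0 < r / sigma by exact: divr_gt0.
have pi_near i : pi i <= 120 * (r / sigma).
  rewrite -lee_fin -piE; apply: (gaussian_small_ball sigma0 (increment_gaussian (comp_fbm i) s0 t0)
    (increment_centered (comp_fbm i) s0 t0) _ _ (ltW r0)).
  by rewrite (increment_variance H0 (comp_fbm i) s0 t0).
have prod_le1 (S : pred 'I_d) : \prod_(i < d | S i) pi i <= 1.
  apply: (@le_trans _ _ (\prod_(i < d | S i) 1)); last by rewrite big1.
  by apply: ler_prod => i _; rewrite pi0 pi1.
have pj_le : p <= pi j.
  by rewrite pE (bigD1 j)//= ler_piMr.
have q1 : 0 < q + 1 by rewrite addr_gt0.
have pi_far : 0 < `|b j| -> 2 * r <= `|b j| ->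
    pi j <= 120 * decay_const (q + 1) * 2 `^ (q + 1) * (r / sigma) * (sigma / `|b j|) `^ (q + 1).
  move=> b0 rb; rewrite -lee_fin -piE.
  apply: (gaussian_small_ball_far sigma0 (increment_gaussian (comp_fbm j) s0 t0)
    (increment_centered (comp_fbm j) s0 t0) _ q1 (ltW r0)) => //.
    by rewrite (increment_variance H0 (comp_fbm j) s0 t0).
  by rewrite -normr_gt0.
have K0 : 0 <= 120 * decay_const (q + 1) * 2 `^ (q + 1) :> R.
  by apply: mulr_ge0; [apply: mulr_ge0; [exact: ler0n|exact: decay_const_ge0]|exact: powR_ge0].
have c1 : 1 <= 120 :> R by rewrite (ler_nat R 1).
rewrite /ball_const; move: (120 * _ * _) K0 pi_far => K K0 pi_far.
move: (120 : R) c1 pi_near => c c1 pi_near.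
have c0 : 0 <= c by exact: le_trans c1.
split.
- by rewrite pE; exact: prod_le1.
- rewrite pE; apply: (@le_trans _ _ (\prod_(i < d) (c * (r / sigma)))).
    by apply: ler_prod => i _; rewrite pi0 pi_near.
  by rewrite prodr_const card_ord.
- move=> b0 rb; apply: le_trans pj_le _; apply: le_trans (pi_far b0 rb) _.
  apply: ler_wpM2r; first exact: powR_ge0.
  apply: ler_wpM2r; first exact: ltW.
  by rewrite ler_peMl// exprn_ege1.
- move=> b0 rb; rewrite pE (bigD1 j)//=.
  apply: (@le_trans _ _ (K * (r / sigma) * (sigma / `|b j|) `^ (q + 1) *
      (c * (r / sigma)) ^+ d.-1)).
    apply: ler_pM => //; [exact: prodr_ge0|exact: pi_far|].
    apply: (@le_trans _ _ (\prod_(i < d | i != j) (c * (r / sigma)))).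
      by apply: ler_prod => i _; rewrite pi0 pi_near.
    by rewrite (eq_bigl (mem (predC1 j)))// prodr_const cardC1 card_ord lexx.
  have dE z : z ^+ d = z * z ^+ d.-1 :> R.
    by rewrite -exprS prednK// (leq_trans _ (ltn_ord j)).
  rewrite exprMn !dE.
  have h : 0 <= K * (r / sigma) * (sigma / `|b j|) `^ (q + 1) * (c ^+ d.-1 * (r / sigma) ^+ d.-1).
    apply: mulr_ge0; [apply: mulr_ge0; [apply: mulr_ge0|] |apply: mulr_ge0].
    - exact: K0.
    - exact: ltW.
    - exact: powR_ge0.
    - exact: exprn_ge0.
    - by apply: exprn_ge0; exact: ltW.
  apply: (@le_trans _ _ (c * (K * (r / sigma) * (sigma / `|b j|) `^ (q + 1) * (c ^+ d.-1 * (r / sigma) ^+ d.-1)))).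
    by rewrite ler_peMl.
  by rewrite le_eqVlt; apply/orP; left; apply/eqP; ring.
Qed.

End fbm_small_ball.

Section fbm_ball_bound.
Context {R : realType} {disp : measure_display} {Omega : measurableType disp}.
Variables (P : probability Omega R) (d : nat) (H : R) (X : R -> Omega -> 'rV[R]_d).
Hypothesis d_gt0 : (0 < d)%N.
Hypothesis H01 : 0 < H < 1.
Hypothesis X_fbm : fractional_brownian_motion P H X.

(* [timed] selects the exponent of the graph, for which the two times have to be
   r-close as well. *)
Definition ball_exponent (timed : bool) (q : R) : R :=
  if timed then H * q + d%:R * (1 - H) else q.

Lemma fbm_ball_bound (timed : bool) (q : R) : 0 < q ->
  (if timed then d%:R <= q else q <= d%:R) ->
  exists2 C, 0 <= C & forall s t r (b : 'I_d -> R), 0 <= s -> 0 <= t -> s != t ->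
    0 < r <= 1 -> (timed -> `|t - s| <= r) ->
    exists M, [/\ 0 < M, `|t - s| `^ H <= M, forall i, `|b i| <= M &
      (P (\bigcap_i ball_event X s t r b i) <=
        (C * (r `^ ball_exponent timed q * M `^ (- q)))%:E)%E].
Proof.
move=> q0 qd; have [H0 H1] := andP H01.
pose K := ball_const d q; have K0 : 0 <= K by exact: ball_const_ge0.
pose C := (if timed then 120 ^+ d else 120 `^ q) + 2 `^ q + K.
have C0 : 0 <= C.
  apply: addr_ge0 => //; apply: addr_ge0; last exact: powR_ge0.
  by case: (timed); [apply: exprn_ge0; exact: ler0n|exact: powR_ge0].
exists C => // s t r b s0 t0 st /andP[r0 r1] tst.
(* A coordinate of largest shift, so that max (sigma, |b j|) controls the whole vector [b]. *)
have [j jmax] : exists j, forall i, `|b i| <= `|b j|.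
  exists [arg max_(j > Ordinal d_gt0) `|b j|]%O; case: Order.TotalTheory.arg_maxP => // j _ jmax i.
  exact: jmax.
have ts0 : 0 < `|t - s| by rewrite normr_gt0 subr_eq0 eq_sym.
pose sigma := `|t - s| `^ H; have sigma0 : 0 < sigma by exact: powR_gt0.
exists (Num.max sigma `|b j|); split.
- by rewrite lt_max sigma0.
- by rewrite le_max lexx.
- by move=> i; rewrite le_max jmax orbT.
have mB : measurable (\bigcap_i ball_event X s t r b i).
  apply: fin_bigcap_measurable; first exact: finite_finset.
  by move=> i _; exact: (measurable_ball_event X_fbm).
have [p1 pnear pfar1 pfard] := ball_event_estimates H01 X_fbm b j s0 t0 st r0 q0.
rewrite -(fineK (fin_num_measure P _ mB)) lee_fin.
have c1 : 1 <= 120 :> R by rewrite (ler_nat R 1).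
move: p1 pnear pfar1 pfard; rewrite -/sigma -/K; set p := fine _ => p1 pnear pfar1 pfard.
rewrite /C /ball_exponent; move: tst qd; case: timed {C C0} => /= tst qd.
- apply: (small_ball_graph_exponent q0 c1 K0 sigma0 (normr_ge0 _) r0 p1 pnear pfard H01 qd r1).
  by apply: ge0_ler_powR; rewrite ?nnegrE ?(ltW H0) ?(ltW r0) ?(tst isT).
- exact: (small_ball_image_exponent q0 c1 K0 sigma0 (normr_ge0 _) r0 p1 pnear pfar1 pfard qd).
Qed.

End fbm_ball_bound.

(** * Joint measurability, Fubini and product measures *)

Section measurable_time_change.
Context {R : realType} {dT : measure_display} {T : measurableType dT}.
Context {dU : measure_display} {U : measurableType dU}.
Variables (Y : R -> T -> R) (tau : U -> R).
Hypothesis mY : forall t, 0 <= t -> measurable_fun setT (Y t).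
Hypothesis Yc : forall w, {within `[0, +oo[, continuous (Y ^~ w)}.
Hypothesis mtau : measurable_fun setT tau.
Hypothesis tau_ge0 : forall u, 0 <= tau u.

(* Path continuity turns the process evaluated at the discretised time into an
   approximation of the process at the time tau. *)
Lemma measurable_fun_time_change :
  measurable_fun setT (fun z : T * U => Y (tau z.2) z.1).
Proof.
pose g (n : nat) (u : U) : R := (Num.trunc (n.+1%:R * tau u))%:R / n.+1%:R.
have g0 n u : 0 <= g n u by rewrite divr_ge0.
have n0 n : 0 < n.+1%:R :> R by rewrite ltr0n.
have nt0 n u : 0 <= n.+1%:R * tau u by rewrite mulr_ge0.
apply: (@measurable_fun_cvg _ _ _ _ (fun n z => Y (g n z.2) z.1)).
- move=> n _ B mB; rewrite setTI.
  rewrite (_ : _ @^-1` B = \bigcup_m ((Y (m%:R / n.+1%:R) @^-1` B) `*`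
      [set u | m%:R <= n.+1%:R * tau u < m.+1%:R])); last first.
    apply/seteqP; split => [[w u] /= Bw|[w u] [m _ [/= Bw mu]]].
      by exists (Num.trunc (n.+1%:R * tau u)) => //; split => //=; exact: truncn_itv.
    by rewrite /g (truncn_def mu).
  apply: bigcup_measurable => m _; apply: measurableX.
    by rewrite -[X in measurable X]setTI; apply: (mY _) => //; rewrite divr_ge0.
  have mnt : measurable_fun setT (fun u => n.+1%:R * tau u) by exact: measurable_funM.
  rewrite (_ : [set u | _] = (fun u => n.+1%:R * tau u) @^-1` `[m%:R, m.+1%:R[).
    by rewrite -[X in measurable X]setTI; exact: mnt.
  by apply/seteqP; split => u /=; rewrite in_itv.
- move=> [w u] _ /=.
  have /subspace_continuousP/(_ (tau u)) := @Yc w.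
  rewrite /= in_itv/= andbT => /(_ (tau_ge0 u)).
  apply: cvg_trans; apply: (@cvg_comp _ _ _ (g ^~ u) (Y ^~ w)) => //.
  have gt : g ^~ u @ \oo --> tau u.
    apply/cvgrPdist_le => /= e e0; near=> n.
    rewrite ger0_norm; last first.
      rewrite subr_ge0 ler_pdivrMr// [leRHS]mulrC; by have /andP[] := truncn_itv (nt0 n u).
    have h : n.+1%:R * tau u < (Num.trunc (n.+1%:R * tau u))%:R + 1.
      by rewrite natr1; have /andP[] := truncn_itv (nt0 n u).
    apply: (@le_trans _ _ (n.+1%:R^-1)).
      rewrite lerBlDr -[leLHS](mulKf (lt0r_neq0 (n0 n))) [leLHS]mulrC.
      by rewrite -[X in _ <= X + _]mul1r -mulrDl ler_wpM2r ?invr_ge0// addrC ltW.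
    by apply: ltW; near: n; exact: (near_infty_natSinv_lt (PosNum e0)).
  move=> B /= [e e0 Be]; have /cvgrPdist_lt/(_ e e0) := gt; apply: filterS => n gn.
  by apply: Be => //=; rewrite in_itv/= andbT.
Unshelve. all: by end_near. Qed.

End measurable_time_change.

Lemma fubini_sections {R : realType} {dT dV : measure_display}
    {T : measurableType dT} {V : measurableType dV}
    (P : {sigma_finite_measure set T -> \bar R})
    (nu : {sigma_finite_measure set V -> \bar R}) (A : set (T * V)) :
  measurable A ->
  (\int[P]_w nu (xsection A w) = \int[nu]_z P (ysection A z))%E.
Proof.
move=> mA; have := indic_fubini_tonelli P nu mA.
by rewrite indic_fubini_tonelli_FE// indic_fubini_tonelli_GE.
Qed.

Section square_measure.
Context {R : realType} {dT : measure_display} {T : measurableType dT}.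
Variable mu : {finite_measure set T -> \bar R}.

(* The library only makes products of probabilities canonically sigma-finite. *)
Definition square_measure : set (T * T) -> \bar R := product_measure1 mu mu.

HB.instance Definition _ := Measure.on square_measure.

Let square_measure_fin : fin_num_fun square_measure.
Proof.
apply: lty_fin_num_fun; rewrite -setXTT.
rewrite [X in (X < _)%E](_ : _ = mu setT * mu setT)%E; last exact: product_measure1E.
by apply: lte_mul_pinfty => //; rewrite ?ltry // ?fin_num_measure// -ge0_fin_numE// fin_num_measure.
Qed.

HB.instance Definition _ := Measure_isFinite.Build _ _ _ square_measure square_measure_fin.

End square_measure.

Section summable_sections.
Context {R : realType} {dU : measure_display} {U : measurableType dU}.
Variable mu : {finite_measure set U -> \bar R}.

(** The weighted sum of section masses has finite integral, so it is finite almost everywhere. Its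
    sublevel sets at integers exhaust [U] up to a null set, and one of them has positive mass. *)
Lemma positive_set_bounded_sections (a : nat -> R) (N : nat -> set (U * U)) :
  (0 < mu setT)%E -> (forall k, 0 <= a k) -> (forall k, measurable (N k)) ->
  (\sum_(0 <= k <oo) (a k)%:E * square_measure mu (N k) < +oo)%E ->
  exists (G : set U) (M : R), [/\ measurable G, (0 < mu G)%E, 0 <= M &
    forall k u, G u -> ((a k)%:E * mu (xsection (N k) u) <= M%:E)%E].
Proof.
move=> mu0 a0 mN finN.
pose g u := (\sum_(0 <= k <oo) (a k)%:E * mu (xsection (N k) u))%E.
have mNk k : measurable_fun setT (fun u => mu (xsection (N k) u)).
  exact: (measurable_fun_xsection mu (mN k)).
have mk k : measurable_fun setT (fun u => (a k)%:E * mu (xsection (N k) u))%E.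
  exact: emeasurable_funM.
have k0 k u : (0 <= (a k)%:E * mu (xsection (N k) u))%E by rewrite mule_ge0 ?lee_fin.
have mg : measurable_fun setT g by apply: ge0_emeasurable_sum.
have g0 u : (0 <= g u)%E by apply: nneseries_ge0.
have intg : (\int[mu]_u g u < +oo)%E.
  rewrite integral_nneseries//; apply: le_lt_trans finN.
  rewrite le_eqVlt; apply/orP; left; apply/eqP; apply: eq_eseriesr => k _.
  by rewrite ge0_integralZl_EFin.
have gk k u : ((a k)%:E * mu (xsection (N k) u) <= g u)%E.
  rewrite /g (@nneseriesD1 _ _ k)//; first by rewrite leeDl// nneseries_ge0.
pose G n := [set u | g u <= n%:R%:E]%E.
have mG n : measurable (G n).
  by rewrite -[G n]setTI; apply: emeasurable_fun_le.
have [[n Gn]|noG] := pselect (exists n, 0 < mu (G n))%E.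
  exists (G n), n%:R; split => // k u Gu; exact: le_trans (gk k u) Gu.
have nG n : mu.-negligible (G n).
  apply/negligibleP => //; apply/eqP; rewrite eq_le measure_ge0 andbT leNgt.
  by apply/negP => h; apply: noG; exists n.
have fing : {ae mu, forall u, [set: U] u -> g u \is a fin_num}.
  apply: integrable_ae => //; apply/integrableP; split => //.
  by under eq_integral => u _ do rewrite gee0_abs//.
have : mu.-negligible [set: U].
  apply: negligibleS (negligibleU fing (negligible_bigcup nG)) => u _ /=.
  have [gfin|] := boolP (g u \is a fin_num); last first.
    by move=> /negP h; left => /(_ Logic.I).
  right; exists (Num.trunc (fine (g u))).+1 => //.
  rewrite /G/= -(fineK gfin) lee_fin ltW//.
  by have /andP[] := truncn_itv (fine_ge0 (g0 u)).
by move=> /(negligibleP _ measurableT) E; move: mu0; rewrite E ltxx.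
Qed.

End summable_sections.

Lemma half_exp_powR {R : realType} (b : R) j : (2^-1 ^+ j) `^ b = (2 `^ b)^-1 ^+ j.
Proof.
have h0 : 0 <= 2^-1 :> R by rewrite invr_ge0.
elim: j => [|j IH]; first by rewrite !expr0 powR1.
by rewrite !exprS powRM// IH -powRN -[2^-1]powR_inv1// -powRrM mulN1r.
Qed.

(** * Potentials and energies for the parabolic metric *)

Section parabolic_potential.
Context {R : realType} {dU : measure_display} {U : measurableType dU}.
Variable mu : {finite_measure set U -> \bar R}.
Context {d : nat}.
Variables (H : R) (f : R -> 'rV[R]_d) (tau : U -> R).
Hypothesis H01 : 0 < H < 1.
Hypothesis mtau : measurable_fun setT tau.
Hypothesis mftau : forall i, measurable_fun setT (fun u => f (tau u) ord0 i).
Variables (beta C : R).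
Hypothesis mu_ball : forall t y rho, 0 < rho ->
  (mu (parabolic_ball H f tau t y rho) <= (C * rho `^ beta)%:E)%E.

Let H0 : 0 < H. Proof. by case/andP: H01. Qed.
Let half0 n : 0 < (2^-1 : R) ^+ n. Proof. by rewrite exprn_gt0// invr_gt0. Qed.

Definition close_pairs (rho : R) : set (U * U) :=
  [set z | parabolic_ball H f tau (tau z.1) (f (tau z.1)) rho z.2].

Let measurable_le (g h : U * U -> R) : measurable_fun setT g ->
  measurable_fun setT h -> measurable [set z | g z <= h z].
Proof.
move=> mg mh; rewrite -[X in measurable X]setTI.
by have mb := measurable_fun_ler mg mh; exact: (mb measurableT [set true] Logic.I).
Qed.

Lemma measurable_close_pairs rho : measurable (close_pairs rho).
Proof.
rewrite (_ : close_pairs rho = [set z | `|tau z.2 - tau z.1| <= rho] `&`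
  \bigcap_(i in [set: 'I_d]) [set z | `|f (tau z.2) ord0 i - f (tau z.1) ord0 i| <= rho `^ H]).
  apply: measurableI.
    apply: measurable_le => //; apply: measurableT_comp => //.
    by apply: measurable_funB; exact: measurableT_comp.
  apply: fin_bigcap_measurable; first exact: finite_finset.
  move=> i _; apply: measurable_le => //; apply: measurableT_comp => //.
  by apply: measurable_funB; exact: (measurableT_comp (mftau i)).
apply/seteqP; split => z /= [zt zf]; split => //; first by move=> i _; exact: zf.
by move=> i; exact: zf.
Qed.

Lemma square_measure_close_pairs rho : 0 < rho ->
  (square_measure mu (close_pairs rho) <= (C * rho `^ beta)%:E * mu setT)%E.
Proof.
move=> rho0.
have section_le u : (mu (xsection (close_pairs rho) u) <= (C * rho `^ beta)%:E)%E.
  rewrite (_ : xsection _ _ = parabolic_ball H f tau (tau u) (f (tau u)) rho) ?mu_ball//.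
  by apply/seteqP; split => v; rewrite /xsection/= inE.
rewrite -integral_cst//; apply: ge0_le_integral => // [|u _].
- by apply: measurable_fun_xsection; exact: measurable_close_pairs.
- exact: section_le.
Qed.

Definition potential_weight (b : R) (k : nat) : R := (2 `^ b) ^+ k.

Definition potential_set (k : nat) : set (U * U) :=
  if k is j.+1 then close_pairs (2^-1 ^+ j) else setT.

(* Comparable to 1 plus the Riesz kernel of order b for the parabolic metric. *)
Definition potential (b : R) (z : U * U) : \bar R :=
  (\sum_(0 <= k <oo) (potential_weight b k)%:E * (\1_(potential_set k) z)%:E)%E.

Lemma potential_weight_ge0 b k : 0 <= potential_weight b k.
Proof. by rewrite exprn_ge0// powR_ge0. Qed.

Lemma measurable_potential_set k : measurable (potential_set k).
Proof. by case: k => [|k] //=; exact: measurable_close_pairs. Qed.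

Let term_ge0 b k z : (0 <= (potential_weight b k)%:E * (\1_(potential_set k) z)%:E :> \bar R)%E.
Proof. by rewrite mule_ge0// lee_fin ?potential_weight_ge0. Qed.

Lemma potential_ge0 b z : (0 <= potential b z)%E.
Proof. exact: nneseries_ge0. Qed.

Lemma measurable_potential b : measurable_fun setT (potential b).
Proof.
apply: ge0_emeasurable_sum => // k _; apply: emeasurable_funM => //.
apply/measurable_EFinP; apply: measurable_indic; exact: measurable_potential_set.
Qed.

(** Pairs at parabolic scale 2^-j have mass of order 2^(-j beta) and weight of order 2^(j b), which
    gives a geometric series of ratio 2^(b - beta). *)
Lemma integral_potential_lty b : b < beta ->
  (\int[square_measure mu]_z potential b z < +oo)%E.
Proof.
move=> bb; apply: le_lt_trans (ge0_integral_le_series _ (measurable_potential b)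
  (potential_ge0 b) (potential_weight_ge0 b) measurable_potential_set (fun=> lexx _)) _.
have C0 : 0 <= C.
  have := le_trans (measure_ge0 _ _) (mu_ball 0 0 ltr01).
  by rewrite powR1 mulr1 lee_fin.
pose m := fine (mu setT); have mE : mu setT = m%:E by rewrite fineK// fin_num_measure.
have m0 : 0 <= m by rewrite fine_ge0.
pose K := fine (square_measure mu setT) + C * m * 2 `^ beta.
have SE : square_measure mu setT = (fine (square_measure mu setT))%:E.
  by rewrite fineK// fin_num_measure.
pose x : R := 2 `^ (b - beta); have x0 : 0 < x by exact: powR_gt0.
have x1 : x < 1.
  have : 1 `^ (beta - b) < 2 `^ (beta - b) :> R.
    by apply: gt0_ltr_powR; rewrite ?nnegrE ?subr_gt0// ltr1n.
  by rewrite powR1 /x -(opprB beta b) powRN => h; rewrite invf_lt1// powR_gt0.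
have K0 : 0 <= K.
  by rewrite addr_ge0 ?fine_ge0// mulr_ge0 ?powR_ge0// mulr_ge0.
have := geometric_eseries_le K0 (introT andP (conj x0 x1)).
move=> h; apply: le_lt_trans (le_trans _ h) (ltry _).
apply: lee_nneseries => k _; first by rewrite mule_ge0// lee_fin potential_weight_ge0.
rewrite /potential_weight; case: k => [|j] /=.
  by rewrite !expr0 mul1e mulr1 SE lee_fin lerDl mulr_ge0 ?powR_ge0// mulr_ge0.
apply: (@le_trans _ _ (((2 `^ b) ^+ j.+1)%:E * ((C * (2^-1 ^+ j) `^ beta)%:E * m%:E)))%E.
  apply: lee_wpmul2l; first by rewrite lee_fin exprn_ge0// powR_ge0.
  by rewrite -mE; exact: square_measure_close_pairs.
rewrite -!EFinM lee_fin.
apply: (@le_trans _ _ (C * m * 2 `^ beta * x ^+ j.+1)); last first.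
  by apply: ler_wpM2r; [exact/exprn_ge0/ltW|rewrite lerDr fine_ge0].
rewrite le_eqVlt; apply/orP; left; apply/eqP.
have -> : x = 2 `^ b * (2 `^ beta)^-1.
  by rewrite /x powRD ?pnatr_eq0 ?implybT// powRN.
rewrite half_exp_powR.
have := gt_eqF (powR_gt0 beta (ltr0Sn R 1)).
move: (2 `^ beta) (2 `^ b) => p r p0.
by rewrite exprMn [p^-1 ^+ j.+1]exprS; field; rewrite p0.
Qed.

(** One term is enough. With rho = M^(1/H) and 2^-(j+1) < rho <= 2^-j, the pair is close at scale
    2^-j, and the weight of index j+1 exceeds rho^(-b). For M >= 1 the term of index 0 does. *)
Lemma potential_ge b u v M : 0 < b -> 0 < M -> `|tau v - tau u| `^ H <= M ->
  (forall i, `|f (tau v) ord0 i - f (tau u) ord0 i| <= M) ->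
  ((M `^ (- (b / H)))%:E <= potential b (u, v))%E.
Proof.
move=> b0 M0 tM fM.
have ge_term k : potential_set k (u, v) -> ((potential_weight b k)%:E <= potential b (u, v))%E.
  move=> kuv; rewrite /potential (@nneseriesD1 _ _ k)//.
  by rewrite indicE mem_set// mule1 leeDl// nneseries_ge0.
have bH : 0 <= b / H by rewrite divr_ge0 ?ltW.
have [M1|M1] := leP 1 M.
  apply: le_trans (ge_term 0%N Logic.I); rewrite lee_fin /potential_weight expr0.
  by rewrite powRN invf_le1 ?powR_gt0// powR_ge1.
pose rho := M `^ H^-1; have rho0 : 0 < rho by exact: powR_gt0.
have rhoH : rho `^ H = M by rewrite -powRrM mulVf ?gt_eqF// powRr1// ltW.
have ex := half_exp_small rho0; case: (ex_minnP ex) => -[|j] jrho jmin.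
  have : rho `^ H < 1 by rewrite rhoH.
  rewrite expr0 in jrho; rewrite ltNge => /negP; case; rewrite powR_ge1// ltW//.
have rhoj : rho <= 2^-1 ^+ j by rewrite leNgt; apply/negP => /jmin; rewrite ltnn.
apply: (@le_trans _ _ (potential_weight b j.+1)%:E).
  rewrite lee_fin -rhoH -powRrM mulrN mulrCA divff ?gt_eqF// mulr1.
  rewrite /potential_weight powRN.
  have -> : (2 `^ b) ^+ j.+1 = ((2^-1 ^+ j.+1) `^ b)^-1 :> R.
    by rewrite half_exp_powR exprVn invrK.
  rewrite lef_pV2 ?posrE ?powR_gt0//.
  by apply: ge0_ler_powR; rewrite ?nnegrE ?(ltW b0) ?(ltW rho0) ?(ltW (half0 _)) ?(ltW jrho).
apply: ge_term; split => /=.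
  apply: le_trans rhoj; rewrite leNgt; apply/negP => h.
  by move: tM; rewrite -rhoH leNgt gt0_ltr_powR// nnegrE ltW.
move=> i; apply: le_trans (fM i) _; rewrite -rhoH.
by apply: ge0_ler_powR; rewrite ?nnegrE ?(ltW H0) ?(ltW rho0) ?(ltW (half0 _)).
Qed.

End parabolic_potential.

Section energy.
Context {R : realType} {disp : measure_display} {Omega : measurableType disp}.
Variables (P : probability Omega R) (d : nat) (H : R) (X : R -> Omega -> 'rV[R]_d).
Hypothesis d_gt0 : (0 < d)%N.
Hypothesis H01 : 0 < H < 1.
Hypothesis X_fbm : fractional_brownian_motion P H X.
Context {dU : measure_display} {U : measurableType dU}.
Variable mu : {finite_measure set U -> \bar R}.
Variables (f : R -> 'rV[R]_d) (tau : U -> R).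
Hypothesis mu_gt0 : (0 < mu setT)%E.
Hypothesis tau_ge0 : forall u, 0 <= tau u.
Hypothesis mtau : measurable_fun setT tau.
Hypothesis mftau : forall i, measurable_fun setT (fun u => f (tau u) ord0 i).
Variables (beta C : R).
Hypothesis mu_ball : forall t y rho, 0 < rho ->
  (mu (parabolic_ball H f tau t y rho) <= (C * rho `^ beta)%:E)%E.
Variables (timed : bool) (b : R).
Hypothesis b_gt0 : 0 < b.
Hypothesis b_lt : b < beta.
Hypothesis b_dim : if timed then d%:R <= b / H else b / H <= d%:R.

Let H0 : 0 < H. Proof. by case/andP: H01. Qed.
Let q0 : 0 < b / H. Proof. by rewrite divr_gt0. Qed.
Let half0 n : 0 < (2^-1 : R) ^+ n. Proof. by rewrite exprn_gt0// invr_gt0. Qed.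

Let sum_at (t : R) (w : Omega) (i : 'I_d) : R := (X t w + f t) ord0 i.

Definition near_pairs (k : nat) : set (Omega * (U * U)) :=
  [set z | (timed -> `|tau z.2.2 - tau z.2.1| <= 2^-1 ^+ k) /\
    forall i, `|sum_at (tau z.2.2) z.1 i - sum_at (tau z.2.1) z.1 i| <= 2^-1 ^+ k].

Let measurable_le {dT : measure_display} {T : measurableType dT} (g : T -> R) (r : R) :
  measurable_fun setT g -> measurable [set z | `|g z| <= r].
Proof.
move=> mg; rewrite -[X in measurable X]setTI.
have mb : measurable_fun setT (fun z => `|g z| <= r).
  by apply: measurable_fun_ler => //; exact: measurableT_comp.
exact: (mb measurableT [set true] Logic.I).
Qed.

Let comp_fbm i : fractional_brownian_motion_1d P H (fun t w => X t w ord0 i).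
Proof. by have [_] := X_fbm; exact. Qed.

Lemma measurable_near_pairs k : measurable (near_pairs k).
Proof.
have mX (i : 'I_d) (g : U * U -> U) : measurable_fun setT g ->
    measurable_fun setT (fun z : Omega * (U * U) => sum_at (tau (g z.2)) z.1 i).
  move=> mg; rewrite [X in measurable_fun _ X](_ : _ =
      (fun z => X (tau (g z.2)) z.1 ord0 i + f (tau (g z.2)) ord0 i)); last first.
    by apply/funext => z; rewrite /sum_at mxE.
  apply: measurable_funD.
    apply: (@measurable_fun_time_change _ _ _ _ _ (fun t w => X t w ord0 i) (tau \o g)).
    - by move=> t t0; exact: (fbm_measurable (comp_fbm i) t0).
    - by move=> w; exact: (@fbm_continuous _ _ _ _ _ _ (comp_fbm i)).
    - exact: measurableT_comp.
    - by move=> z; exact: tau_ge0.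
  exact: (measurableT_comp (mftau i) (measurableT_comp mg measurable_snd)).
rewrite (_ : near_pairs k =
  (if timed then [set z : Omega * (U * U) | `|tau z.2.2 - tau z.2.1| <= 2^-1 ^+ k] else setT) `&`
  \bigcap_(i in [set: 'I_d]) [set z : Omega * (U * U) |
     `|sum_at (tau z.2.2) z.1 i - sum_at (tau z.2.1) z.1 i| <= 2^-1 ^+ k]).
  apply: measurableI.
    case: (timed) => //; apply: measurable_le.
    apply: measurable_funB; apply: (measurableT_comp mtau).
      exact: (measurableT_comp measurable_snd measurable_snd).
    exact: (measurableT_comp measurable_fst measurable_snd).
  apply: fin_bigcap_measurable; first exact: finite_finset.
  move=> i _; apply: measurable_le; apply: measurable_funB.
    exact: (mX i snd measurable_snd).
  exact: (mX i fst measurable_fst).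
apply/seteqP; split => [z [zt zX]|z [zt zX]]; split.
- by move: zt; case: (timed) => //=; exact.
- by move=> i _; exact: zX.
- by move: zt; case: (timed) => //=.
- by move=> i; exact: zX.
Qed.

(** The event puts the increment of [X] in a box centred at minus the increment of [f]. The ball
    bound applies, and its factor M^(-b/H) is dominated by the potential. *)
Lemma near_pairs_prob : exists2 K, 0 <= K & forall k z,
  (P (ysection (near_pairs k) z) <=
   (K * (2^-1 ^+ k) `^ ball_exponent d H timed (b / H))%:E * potential H f tau b z)%E.
Proof.
have [K K0 bound] := fbm_ball_bound d_gt0 H01 X_fbm q0 b_dim.
exists (K + 1); first by rewrite addr_ge0.
move=> k [u v]; set r := 2^-1 ^+ k; set e := ball_exponent _ _ _ _.
have r0 : 0 < r := half0 k.
have pot0 := potential_ge0 H f tau b (u, v).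
have my : measurable (ysection (near_pairs k) (u, v)).
  exact: measurable_ysection (measurable_near_pairs k).
have re0 : 0 < r `^ e by exact: powR_gt0.
suff [M [M0 tM fM PM]] : exists M, [/\ 0 < M, `|tau v - tau u| `^ H <= M,
    forall i, `|f (tau v) ord0 i - f (tau u) ord0 i| <= M &
    (P (ysection (near_pairs k) (u, v)) <= ((K + 1) * (r `^ e * M `^ (- (b / H))))%:E)%E].
  apply: le_trans PM _; rewrite mulrA EFinM; apply: lee_wpmul2l.
    by rewrite lee_fin mulr_ge0 ?powR_ge0 ?addr_ge0.
  exact: potential_ge.
have [tuv|tuv] := eqVneq (tau u) (tau v).
  (* Equal times: this [M] makes r^e M^(-b/H) equal to 1, so the trivial bound on a probability
     suffices; hence the added 1 in the constant. *)
  exists ((r `^ e) `^ (b / H)^-1); split.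
  - exact: powR_gt0.
  - by rewrite tuv subrr normr0 powR0 ?gt_eqF// powR_ge0.
  - by move=> i; rewrite tuv subrr normr0 powR_ge0.
  - rewrite powRN -powRrM mulVf ?gt_eqF// powRr1 ?(ltW re0)// mulfV ?gt_eqF// mulr1.
    by apply: le_trans (probability_le1 _ my) _; rewrite lee_fin lerDr.
have [tclose|tfar] := pselect (timed -> `|tau v - tau u| <= r); last first.
  rewrite (_ : ysection _ _ = set0); last first.
    by rewrite -subset0 => w; rewrite /ysection/= inE => -[].
  (* The event is empty here, so any scale that dominates the pair is admissible. *)
  exists (Num.max 1 (Num.max (`|tau v - tau u| `^ H)
    (\sum_i `|f (tau v) ord0 i - f (tau u) ord0 i|))); split.
  - by rewrite lt_max ltr01.
  - by rewrite !le_max lexx !orbT.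
  - move=> i; rewrite !le_max; apply/orP; right; apply/orP; right.
    by rewrite (bigD1 i)//= lerDl sumr_ge0.
  - by rewrite measure0 lee_fin !mulr_ge0 ?powR_ge0// addr_ge0.
have r01 : 0 < r <= 1.
  by rewrite r0 exprn_ile1 ?invr_ge0// invf_le1// ler1n.
have [M [M0 tM fM PM]] := bound _ _ r
  (fun i => - (f (tau v) ord0 i - f (tau u) ord0 i)) (tau_ge0 u) (tau_ge0 v) tuv r01 tclose.
exists M; split => //; first by move=> i; have := fM i; rewrite normrN.
apply: (@le_trans _ _ (P (\bigcap_i ball_event X (tau u) (tau v) r
    (fun i => - (f (tau v) ord0 i - f (tau u) ord0 i)) i))).
  apply: le_measure; rewrite ?inE//.
    apply: fin_bigcap_measurable; first exact: finite_finset.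
    by move=> i _; exact: (measurable_ball_event X_fbm).
  move=> w; rewrite /ysection/= inE => -[_ /= wX] i _; rewrite /ball_event/increment/=.
  apply: le_trans (wX i); rewrite /sum_at !mxE le_eqVlt; apply/orP; left; apply/eqP.
  by congr `|_|; ring.
apply: le_trans PM _; rewrite lee_fin ler_wpM2r ?mulr_ge0 ?powR_ge0// lerDl//.
Qed.

Variable s : R.
Hypothesis s_lt : s < ball_exponent d H timed (b / H).

(** Weighting the scale 2^-k by 2^(k s), the expected mass of near pairs sums like 2^(k (s - e)),
    hence is almost surely summable. A part of [mu] then has sections bounded by a multiple of 2^(-k
    s) at every scale. *)
Lemma ae_positive_set : {ae P, forall w, exists (G : set U) (M : R),
  [/\ measurable G, (0 < mu G)%E, 0 <= M & forall k u, G u ->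
    (mu (xsection (xsection (near_pairs k) w) u) <= (M * (2^-1 ^+ k) `^ s)%:E)%E]}.
Proof.
have [K K0 PK] := near_pairs_prob.
have := s_lt; set e := ball_exponent d H timed (b / H) in PK *; move=> se.
pose a k : R := (2 `^ s) ^+ k.
have a0 k : 0 <= a k by rewrite exprn_ge0// powR_ge0.
pose S w := (\sum_(0 <= k <oo) (a k)%:E * square_measure mu (xsection (near_pairs k) w))%E.
have mNk k : measurable_fun setT (fun w => square_measure mu (xsection (near_pairs k) w)).
  exact: (measurable_fun_xsection (square_measure mu) (measurable_near_pairs k)).
have mk k : measurable_fun setT
    (fun w => (a k)%:E * square_measure mu (xsection (near_pairs k) w))%E.
  exact: emeasurable_funM.
have k0 k w : (0 <= (a k)%:E * square_measure mu (xsection (near_pairs k) w))%E.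
  by rewrite mule_ge0 ?lee_fin.
have mS : measurable_fun setT S by exact: ge0_emeasurable_sum.
have S0 w : (0 <= S w)%E by exact: nneseries_ge0.
have mpot : measurable_fun setT (potential H f tau b) by exact: measurable_potential.
have pot0 z : (0 <= potential H f tau b z)%E by exact: potential_ge0.
have := integral_potential_lty mtau mftau mu_ball b_lt.
set I := (\int[_]_z _)%E => Ioo.
have I0 : (0 <= I)%E by exact: integral_ge0.
pose x : R := 2 `^ (s - e).
have x0 : 0 < x by exact: powR_gt0.
have x1 : x < 1.
  have : 1 `^ (e - s) < 2 `^ (e - s) :> R.
    by apply: gt0_ltr_powR; rewrite ?nnegrE ?subr_gt0// ltr1n.
  by rewrite powR1 /x -(opprB e s) powRN => h; rewrite invf_lt1// powR_gt0.
have intk k : (\int[P]_w square_measure mu (xsection (near_pairs k) w) <=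
    (K * (2^-1 ^+ k) `^ e)%:E * I)%E.
  rewrite (fubini_sections P (square_measure mu) (measurable_near_pairs k)).
  rewrite -ge0_integralZl_EFin//; last by rewrite mulr_ge0 ?powR_ge0.
  apply: ge0_le_integral => //.
  - exact: (measurable_fun_ysection P (measurable_near_pairs k)).
  - exact: emeasurable_funM.
  - by move=> z _; exact: PK.
have intS : (\int[P]_w S w < +oo)%E.
  rewrite integral_nneseries//.
  have Ifin : I = (fine I)%:E by rewrite fineK// ge0_fin_numE.
  have KI : 0 <= K * fine I by rewrite mulr_ge0// fine_ge0.
  apply: le_lt_trans (le_trans _ (geometric_eseries_le KI (introT andP (conj x0 x1)))) (ltry _).
  apply: lee_nneseries => k _; first by move=> _; exact: integral_ge0.
  rewrite ge0_integralZl_EFin//.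
  apply: le_trans (lee_wpmul2l _ (intk k)) _; first by rewrite lee_fin.
  rewrite Ifin -!EFinM lee_fin half_exp_powR /a.
  have -> : x = 2 `^ s * (2 `^ e)^-1.
    by rewrite /x powRD ?pnatr_eq0 ?implybT// powRN.
  rewrite exprMn le_eqVlt; apply/orP; left; apply/eqP.
  by move: (_ ^+ k) (_ ^+ k) => y z; ring.
have : {ae P, forall w, [set: Omega] w -> S w \is a fin_num}.
  apply: integrable_ae => //; apply/integrableP; split => //.
  by under eq_integral => w _ do rewrite gee0_abs//.
apply: filterS => w /(_ Logic.I) Sfin.
have mN k : measurable (xsection (near_pairs k) w).
  exact: measurable_xsection (measurable_near_pairs k).
have : (S w < +oo)%E by rewrite -ge0_fin_numE.
move=> /(positive_set_bounded_sections mu_gt0 a0 mN)[G [M [mG G0 M0 GM]]].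
exists G, M; split => // k u Gu.
have ak : 0 < a k by rewrite exprn_gt0// powR_gt0.
have mxs : measurable (xsection (xsection (near_pairs k) w) u) by exact: measurable_xsection.
have := GM k u Gu; rewrite -(fineK (fin_num_measure mu _ mxs)) -EFinM !lee_fin.
by move=> h; rewrite half_exp_powR exprVn -/(a k) ler_pdivlMr// mulrC.
Qed.

End energy.

Section lower_bound.
Context {R : realType} {disp : measure_display} {Omega : measurableType disp}.
Variables (P : probability Omega R) (d : nat) (H : R) (X : R -> Omega -> 'rV[R]_d).
Variables (f : R -> 'rV[R]_d) (A : set R).
Hypothesis d_gt0 : (0 < d)%N.
Hypothesis H01 : 0 < H < 1.
Hypothesis X_fbm : fractional_brownian_motion P H X.
Hypothesis mA : measurable A.
Hypothesis A_ge0 : forall t, A t -> 0 <= t.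
Hypothesis mf : forall i, measurable_fun A (fun t => f t ord0 i).
Variable beta : R.
Hypothesis content_neq0 : parabolic_content H beta (graph_on A f) != 0%E.

Let H0 : 0 < H. Proof. by case/andP: H01. Qed.

(** The map [phi] stands for the path or its graph. The null set does not depend on [s0]: the
    dimension is an infimum, so every exponent up to [s] has to be excluded at once. *)
Lemma ae_hausdorff_measure_neq0 (timed : bool) (b s : R)
    (T : Type) (dist : T -> T -> R) (phi : Omega -> R -> T) :
  0 < b < beta -> (if timed then d%:R <= b / H else b / H <= d%:R) ->
  0 < s < ball_exponent d H timed (b / H) ->
  (forall w t u r, dist (phi w t) (phi w u) <= r ->
    (timed -> `|u - t| <= r) /\
    forall i, `|(X u w + f u) ord0 i - (X t w + f t) ord0 i| <= r) ->
  {ae P, forall w, forall s0, 0 < s0 <= s -> hausdorff_measure dist s0 (phi w @` A) <> 0%E}.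
Proof.
move=> /andP[b0 bb] b_dim /andP[s_gt0 s_lt] dist_phi.
have beta0 : 0 < beta by exact: lt_trans bb.
have [dU [U [mu [tau [C [mu0 mtau Atau mftau mu_ball]]]]]] :=
  frostman_graph H01 mA mf beta0 content_neq0.
have tau0 u : 0 <= tau u by exact: A_ge0.
have := ae_positive_set d_gt0 H01 X_fbm mu0 tau0 mtau mftau mu_ball b0 bb b_dim s_lt.
apply: filterS => w [G [M [mG G0 M0 GM]]] s0 s0s.
pose B k u := xsection (xsection (near_pairs X f tau timed k) w) u.
have mB k u : measurable (B k u).
  apply: measurable_xsection; apply: measurable_xsection.
  exact: (measurable_near_pairs X_fbm).
have phi_B k u v : dist (phi w (tau u)) (phi w (tau v)) <= 2^-1 ^+ k -> B k u v.
  by move=> /dist_phi[tuv Xuv]; apply/xsectionP/xsectionP; split.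
apply: (hausdorff_measure_neq0 s_gt0 mB phi_B s0s mG G0 M0 GM) => u.
by exists (tau u).
Qed.

End lower_bound.

(** * The dimension formulas *)

Lemma borel_measurable_coord {R : realType} {d : nat} (D : set R) (f : R -> 'rV[R]_d) i :
  borel_measurable_on D f -> measurable_fun D (fun t => f t ord0 i).
Proof.
move=> mf mD; apply: (measurability _ (RGenOpens.measurableE R)) => //.
move=> _ [_ [a [b ->] <-]].
have oB : open ((fun M : 'rV[R]_d => M ord0 i) @^-1` `]a, b[%classic).
  have /continuousP := @coord_continuous R 1 d ord0 i; apply; exact: interval_open.
exact: (mf mD _ (@sub_sigma_algebra _ setT _ _ oB)).
Qed.

Lemma ae_forall_countable {R : realType} {dT : measure_display} {T : measurableType dT}
    {mu : {measure set T -> \bar R}} {I : countType} (Q : I -> T -> Prop) :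
  (forall i, {ae mu, forall w, Q i w}) -> {ae mu, forall w, forall i, Q i w}.
Proof.
move=> aeQ; have := @ae_foralln _ _ _ mu
  (fun n w => if unpickle n is Some i then Q i w else True).
have h n : {ae mu, forall w, if unpickle n is Some i then Q i w else True}.
  by case: (unpickle n) => [i|]; [exact: aeQ|apply: aeW].
by move=> /(_ h); apply: filterS => w Qw i; have := Qw (pickle i); rewrite pickleK.
Qed.

Section dimension_bounds.
Context {R : realType}.
Implicit Types (h alpha : \bar R) (x y : R).

Lemma hausdorff_dim_ge0 {T : Type} (dist : T -> T -> R) E : (0 <= hausdorff_dim dist E)%E.
Proof. by apply: le_ereal_inf_tmp => _ [s [s0 _] <-]; rewrite lee_fin ltW. Qed.

Lemma hausdorff_dim_ge {T : Type} (dist : T -> T -> R) E (s : R) :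
  (forall s0, 0 < s0 <= s -> hausdorff_measure dist s0 E <> 0%E) ->
  (s%:E <= hausdorff_dim dist E)%E.
Proof.
move=> neq0; apply: le_ereal_inf_tmp => _ [r [r0 Er] <-].
rewrite lee_fin leNgt; apply/negP => rs.
by apply: (neq0 r) Er; rewrite r0 ltW.
Qed.

Lemma rat_below x y alpha : x < y -> (x%:E < alpha)%E ->
  exists q : rat, x < ratr q < y /\ ((ratr q : R)%:E < alpha)%E.
Proof.
move=> xy; case: alpha => [r| |] //.
- rewrite lte_fin => xr.
  have /rat_in_itvoo[q] : x < Num.min y r by rewrite lt_min xy.
  rewrite in_itv/= lt_min => /and3P[xq qy qr].
  by exists q; rewrite xq qy lte_fin.
- move=> _; have [q] := rat_in_itvoo xy; rewrite in_itv/= => xqy.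
  by exists q; rewrite ltry.
Qed.

Lemma parabolic_dim_gt {d : nat} (H x : R) (E : set (R * 'rV[R]_d)) : 0 < x ->
  (x%:E < parabolic_dim H E)%E -> exists2 b, x < b & parabolic_content H b E != 0%E.
Proof.
move=> x0 xE; have x1 : x < x + 1 by rewrite ltrDl.
have [q [/andP[xq _] qE]] := rat_below x1 xE.
exists (ratr q) => //; apply/eqP => q0; move: qE; rewrite ltNge => /negP; apply.
by apply: ereal_inf_lbound; exists (ratr q) => //; split => //; exact: lt_trans xq.
Qed.

Lemma le_div_limit h (b H : R) : 0 < H -> 0 < b ->
  (forall g : rat, 0 < (ratr g : R) < H -> (h <= (b / ratr g)%:E)%E) -> (h * H%:E <= b%:E)%E.
Proof.
move=> H0 b0 hle.
have [g /[dup] gH] := rat_in_itvoo H0; rewrite in_itv/= => /andP[g0 _].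
case: h hle => [r| |] hle; last by rewrite gt0_mulNye ?leNye.
- rewrite -EFinM lee_fin leNgt; apply/negP => brH.
  have r0 : 0 < r.
    by have := lt_trans b0 brH; rewrite pmulr_lgt0.
  have /rat_in_itvoo[k] : b / r < H by rewrite ltr_pdivrMr// mulrC.
  rewrite in_itv/= => /andP[bk kH].
  have k0 : 0 < ratr k :> R by rewrite (lt_trans _ bk)// divr_gt0.
  have := hle k; rewrite k0 kH lee_fin => /(_ isT).
  by rewrite leNgt ltr_pdivrMr// mulrC -ltr_pdivrMr// bk.
- by have := hle g; rewrite -[_ && _]/(_ \in `]_, _[) gH => /(_ isT).
Qed.

Lemma le_add_limit (d : nat) h (b H : R) : 0 < H -> (0 < d)%N ->
  (forall g : rat, 0 < (ratr g : R) < H -> (h <= (b + d%:R * (1 - ratr g))%:E)%E) ->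
  (h <= (b + d%:R * (1 - H))%:E)%E.
Proof.
move=> H0 d0 hle.
have d0' : 0 < d%:R :> R by rewrite ltr0n.
have [g] := rat_in_itvoo H0; rewrite in_itv/= => gH.
case: h hle => [r| |] hle; last by rewrite leNye.
- rewrite lee_fin leNgt; apply/negP => br.
  pose x := 1 - (r - b) / d%:R.
  have xH : x < H.
    rewrite ltrBlDr -ltrBlDl ltr_pdivlMr//; lra.
  have /rat_in_itvoo[k] : Num.max 0 x < H by rewrite gt_max H0 xH.
  rewrite in_itv/= gt_max => /andP[/andP[k0 xk] kH].
  have := hle k; rewrite k0 kH lee_fin => /(_ isT).
  move: xk; rewrite /x ltrBlDr -ltrBlDl ltr_pdivlMr// => h1 h2.
  lra.
- by have := hle g; rewrite gH => /(_ isT).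
Qed.

End dimension_bounds.

Section dimension_of_perturbed_fbm.
Context {R : realType} {disp : measure_display} {Omega : measurableType disp}.
Variables (P : probability Omega R) (d : nat) (H : R) (X : R -> Omega -> 'rV[R]_d).
Variables (f : R -> 'rV[R]_d) (A : set R).
Hypothesis d_gt0 : (0 < d)%N.
Hypothesis H01 : 0 < H < 1.
Hypothesis X_fbm : fractional_brownian_motion P H X.
Hypothesis A01 : A `<=` `[0, 1].

Let H0 : 0 < H. Proof. by case/andP: H01. Qed.
Let graph w := graph_on A (fun t => X t w + f t).
Let image w := (fun t => X t w + f t) @` A.
Let alpha := parabolic_dim H (graph_on A f).

Lemma ae_holder (g : R) : 0 < g < H -> {ae P, forall w, exists N C, 0 <= C /\
  forall s t i, 0 <= s <= 1 -> 0 <= t <= 1 -> `|t - s| <= 2^-1 ^+ N ->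
    `|X t w ord0 i - X s w ord0 i| <= C * `|t - s| `^ g}.
Proof.
move=> gH; have [_ comp_fbm] := X_fbm.
have /choice[C CP] : forall i, exists C, 0 <= C /\ {ae P, forall w, exists N, forall s t,
    0 <= s <= 1 -> 0 <= t <= 1 -> `|t - s| <= 2^-1 ^+ N ->
    `|X t w ord0 i - X s w ord0 i| <= C * `|t - s| `^ g}.
  by move=> i; have [C C0 CP] := fbm_holder gH (comp_fbm i); exists C.
have := ae_forall_countable (fun i => (CP i).2).
apply: filterS => w /choice[N NP].
have C0 i : 0 <= C i by have [] := CP i.
exists (\max_i N i)%N, (\sum_i C i); split; first exact: sumr_ge0.
move=> s t i s01 t01 ts; apply: le_trans (NP i s t s01 t01 _) _.
  apply: le_trans ts _; apply: ler_wiXn2l; rewrite ?invr_ge0 ?invf_le1 ?ler1n//.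
  exact: leq_bigmax.
by apply: ler_wpM2r; [exact: powR_ge0|rewrite (bigD1 i)//= lerDl sumr_ge0].
Qed.

(** Chance enters only through Hölder continuity at rational exponents. Covers are then treated path
    by path, so the content exponent can be any real number. *)
Lemma ae_upper_bounds : {ae P, forall w,
  [/\ hausdorff_dim euclidean_dist (image w) * H%:E <= alpha,
      hausdorff_dim spacetime_dist (graph w) * H%:E <= alpha &
      hausdorff_dim spacetime_dist (graph w) <= alpha + (d%:R * (1 - H))%:E]%E}.
Proof.
have : {ae P, forall w, forall g : rat, 0 < (ratr g : R) < H -> exists N C, 0 <= C /\
    forall s t i, 0 <= s <= 1 -> 0 <= t <= 1 -> `|t - s| <= 2^-1 ^+ N ->
    `|X t w ord0 i - X s w ord0 i| <= C * `|t - s| `^ (ratr g)}.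
  apply: ae_forall_countable => g; have [gH|gH] := boolP (0 < (ratr g : R) < H).
    by have := ae_holder gH; apply: filterS.
  exact: aeW.
apply: filterS => w holder.
have dim_le (b : R) (g : rat) : 0 < b -> parabolic_content H b (graph_on A f) = 0%E ->
    0 < (ratr g : R) < H ->
    [/\ hausdorff_dim euclidean_dist (image w) <= (b / ratr g)%:E,
        hausdorff_dim spacetime_dist (graph w) <= (b / ratr g)%:E &
        hausdorff_dim spacetime_dist (graph w) <= (b + d%:R * (1 - ratr g))%:E]%E.
  move=> b0 fb gH; have [N [C [C0 Xw]]] := holder g gH.
  have [g0 gH'] := andP gH.
  have bg : 0 < b / ratr g :> R by rewrite divr_gt0.
  split.
  - apply: hausdorff_dim_le => //.
    apply: (hausdorff_measure_image_eq0 H01 gH b0 A01 C0 Xw fb (k := Num.sqrt d%:R)).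
      by rewrite sqrtr_gt0 ltr0n.
    by move=> t s r r0 _; exact: euclidean_dist_le.
  - apply: hausdorff_dim_le => //.
    apply: (hausdorff_measure_image_eq0 H01 gH b0 A01 C0 Xw fb (k := Num.sqrt d.+1%:R)
      (phi := fun t => (t, X t w + f t))).
      by rewrite sqrtr_gt0 ltr0n.
    by move=> t s r r0 tr Xr; exact: spacetime_dist_le.
  - apply: hausdorff_dim_le; last exact: (hausdorff_measure_graph_eq0 H01 gH b0 A01 C0 Xw fb).
    have [_ H1] := andP H01.
    by rewrite ltr_wpDr// mulr_ge0// subr_ge0 (ltW (lt_trans gH' H1)).
split.
- apply: le_ereal_inf_tmp => _ [b [b0 fb] <-]; apply: le_div_limit => // g gH.
  by have [] := dim_le b g b0 fb gH.
- apply: le_ereal_inf_tmp => _ [b [b0 fb] <-]; apply: le_div_limit => // g gH.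
  by have [] := dim_le b g b0 fb gH.
- rewrite -leeBlDr//; apply: le_ereal_inf_tmp => _ [b [b0 fb] <-]; rewrite leeBlDr//.
  rewrite -EFinD; apply: le_add_limit => // g gH.
  by have [] := dim_le b g b0 fb gH.
Qed.

Hypothesis mA : measurable A.
Hypothesis f_borel : borel_measurable_on `[0, 1] f.

Let ae_dim_ge (timed : bool) (T : Type) (dist : T -> T -> R) (phi : Omega -> R -> T) :
  (forall w t u r, dist (phi w t) (phi w u) <= r ->
    (timed -> `|u - t| <= r) /\
    forall i, `|(X u w + f u) ord0 i - (X t w + f t) ord0 i| <= r) ->
  {ae P, forall w, forall b s : rat, 0 < (ratr b : R) -> ((ratr b)%:E < alpha)%E ->
    (if timed then d%:R <= ratr b / H else ratr b / H <= d%:R) ->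
    0 < (ratr s : R) < ball_exponent d H timed (ratr b / H) ->
    ((ratr s : R)%:E <= hausdorff_dim dist (phi w @` A))%E}.
Proof.
move=> dist_phi.
have mf i : measurable_fun A (fun t => f t ord0 i).
  by apply: measurable_funS (borel_measurable_coord i f_borel).
have A0 t : A t -> 0 <= t by move=> /A01; rewrite /= in_itv/= => /andP[].
apply: ae_forall_countable => b; apply: ae_forall_countable => s.
have [b0|?] := boolP (0 < (ratr b : R)); last exact: aeW.
have [ba|?] := boolP ((ratr b)%:E < alpha)%E; last exact: aeW.
have [bd|nbd] := pselect (if timed then d%:R <= ratr b / H else ratr b / H <= d%:R); last exact: aeW.
have [s0|?] := boolP (0 < ratr s < ball_exponent d H timed (ratr b / H)); last exact: aeW.
have [beta bb content_neq0] := parabolic_dim_gt b0 ba.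
have := ae_hausdorff_measure_neq0 d_gt0 H01 X_fbm mA A0 mf content_neq0
  (introT andP (conj b0 bb)) bd s0 dist_phi.
by apply: filterS => w neq0 _ _ _ _; exact: hausdorff_dim_ge.
Qed.

Let coord_le (p q : 'rV[R]_d) (e : R) i : 0 <= e ->
  `|q ord0 i - p ord0 i| <= Num.sqrt (e + \sum_(j < d) (p ord0 j - q ord0 j) ^+ 2).
Proof.
move=> e0; rewrite distrC -sqrtr_sqr ler_wsqrtr// (bigD1 i)//= addrCA lerDl.
by rewrite addr_ge0// sumr_ge0// => j _; exact: sqr_ge0.
Qed.

(** Valid for every distance that dominates displacements in space. If the dimension were a smaller
    r, a rational b between r H and min (alpha, d H) and a rational s between r and b / H would
    contradict the energy bound. *)
Lemma ae_dim_ge_untimed (T : Type) (dist : T -> T -> R) (phi : Omega -> R -> T) :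
  (forall w t u r, dist (phi w t) (phi w u) <= r ->
    forall i, `|(X u w + f u) ord0 i - (X t w + f t) ord0 i| <= r) ->
  {ae P, forall w, (Order.min (alpha * (H^-1)%:E) (d%:R)%:E <=
    hausdorff_dim dist (phi w @` A))%E}.
Proof.
move=> dist_phi; have := @ae_dim_ge false T dist phi.
have h w t u r : dist (phi w t) (phi w u) <= r -> (false -> `|u - t| <= r) /\
    forall i, `|(X u w + f u) ord0 i - (X t w + f t) ord0 i| <= r.
  by move=> /dist_phi.
move=> /(_ h); apply: filterS => w; have := hausdorff_dim_ge0 dist (phi w @` A).
case: hausdorff_dim => [r| |] //; rewrite ?leey// lee_fin => r0 dim_ge.
rewrite leNgt; apply/negP; rewrite lt_min lte_fin lte_pdivlMr// -EFinM => /andP[ra rd].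
have rdH : r * H < d%:R * H by rewrite ltr_pM2r.
have [b [/andP[rb bd] ba]] := rat_below rdH ra.
have b0 : 0 < ratr b :> R by rewrite (le_lt_trans _ rb)// mulr_ge0// ltW.
have /rat_in_itvoo[s] : r < ratr b / H by rewrite ltr_pdivlMr.
rewrite in_itv/= => /andP[rs sb].
have := dim_ge b s b0 ba; rewrite /= ler_pdivrMr// (ltW bd) sb (le_lt_trans r0 rs).
by rewrite lee_fin leNgt rs => /(_ isT isT).
Qed.

(** Above d H there is room for b with b / H >= d, and the graph exponent at q = b / H is b + d (1 -
    H). *)
Lemma ae_graph_dim_ge : {ae P, forall w, ((d%:R * H)%:E < alpha ->
  alpha + (d%:R * (1 - H))%:E <= hausdorff_dim spacetime_dist (graph w))%E}.
Proof.
have h w t u r : spacetime_dist (t, X t w + f t) (u, X u w + f u) <= r ->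
    (true -> `|u - t| <= r) /\
    forall i, `|(X u w + f u) ord0 i - (X t w + f t) ord0 i| <= r.
  move=> tur; split => [_|i].
    apply: le_trans tur; rewrite distrC -sqrtr_sqr ler_wsqrtr//= lerDl.
    by rewrite sumr_ge0// => j _; exact: sqr_ge0.
  by apply: le_trans tur; apply: coord_le; exact: sqr_ge0.
have := @ae_dim_ge true _ spacetime_dist (fun w t => (t, X t w + f t)) h.
apply: filterS => w.
rewrite -/(graph_on A (fun t => X t w + f t)) -/(graph w).
have := hausdorff_dim_ge0 spacetime_dist (graph w).
case: hausdorff_dim => [r| |] //; rewrite ?leey// lee_fin => r0 dim_ge da.
rewrite leNgt; apply/negP => ra.
have [y xy ya] : exists2 y, Num.max (d%:R * H) (r - d%:R * (1 - H)) < y & (y%:E < alpha)%E.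
  have x_lt : ((Num.max (d%:R * H) (r - d%:R * (1 - H)))%:E < alpha)%E.
    by rewrite /Num.max; case: ifP => // _; rewrite EFinB lteBlDr.
  have x1 := ltrDl (Num.max (d%:R * H) (r - d%:R * (1 - H))) 1; rewrite ltr01 in x1.
  by have [q [/andP[xq _] qa]] := rat_below x1 x_lt; exists (ratr q).
have [b [/andP[xb _] ba]] : exists q : rat, Num.max (d%:R * H) (r - d%:R * (1 - H)) < ratr q < y /\
    ((ratr q : R)%:E < alpha)%E.
  by apply: rat_below => //; apply: lt_trans ya; rewrite lte_fin.
move: xb; rewrite gt_max => /andP[db rb].
have b0 : 0 < ratr b :> R by rewrite (le_lt_trans _ db)// mulr_ge0// ltW.
have bH : H * (ratr b / H) = ratr b by rewrite mulrC divfK// gt_eqF.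
have /rat_in_itvoo[s] : r < ratr b + d%:R * (1 - H) by rewrite -ltrBlDr.
rewrite in_itv/= => /andP[rs sb].
have := dim_ge b s b0 ba; rewrite /= bH ler_pdivlMr// (ltW db) sb (le_lt_trans r0 rs).
by rewrite lee_fin leNgt rs => /(_ isT isT).
Qed.

Lemma ae_dimensions : {ae P, forall w,
  hausdorff_dim spacetime_dist (graph w) =
    Order.min (alpha * (H^-1)%:E)%E (alpha + (d%:R * (1 - H))%:E)%E /\
  hausdorff_dim euclidean_dist (image w) =
    Order.min (alpha * (H^-1)%:E)%E (d%:R)%:E}.
Proof.
have image_ge := @ae_dim_ge_untimed _ euclidean_dist (fun w t => X t w + f t).
have graph_ge := @ae_dim_ge_untimed _ spacetime_dist (fun w t => (t, X t w + f t)).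
have h1 w t u r : euclidean_dist (X t w + f t) (X u w + f u) <= r ->
    forall i, `|(X u w + f u) ord0 i - (X t w + f t) ord0 i| <= r.
  move=> tur i; apply: le_trans tur; have := coord_le (X t w + f t) (X u w + f u) i (lexx 0).
  by rewrite add0r.
have h2 w t u r : spacetime_dist (t, X t w + f t) (u, X u w + f u) <= r ->
    forall i, `|(X u w + f u) ord0 i - (X t w + f t) ord0 i| <= r.
  by move=> tur i; apply: le_trans tur; apply: coord_le; exact: sqr_ge0.
near=> w.
have [up1 up2 up3] : [/\ hausdorff_dim euclidean_dist (image w) * H%:E <= alpha,
    hausdorff_dim spacetime_dist (graph w) * H%:E <= alpha &
    hausdorff_dim spacetime_dist (graph w) <= alpha + (d%:R * (1 - H))%:E]%E.
  by near: w; exact: ae_upper_bounds.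
have gr : ((d%:R * H)%:E < alpha ->
    alpha + (d%:R * (1 - H))%:E <= hausdorff_dim spacetime_dist (graph w))%E.
  by near: w; exact: ae_graph_dim_ge.
have gr_ge : (Order.min (alpha * (H^-1)%:E) (d%:R)%:E <=
    hausdorff_dim spacetime_dist (graph w))%E.
  by near: w; exact: graph_ge h2.
have im_ge : (Order.min (alpha * (H^-1)%:E) (d%:R)%:E <=
    hausdorff_dim euclidean_dist (image w))%E.
  by near: w; exact: image_ge h1.
split; apply/le_anti/andP; split.
- by rewrite le_min lee_pdivlMr// up2 up3.
(* When alpha <= d H, the bound min (alpha / H, d) for the graph is already alpha / H. *)
- have [da|ad] := ltP (d%:R * H)%:E alpha.
    by rewrite ge_min gr// orbT.
  have aH : (alpha * (H^-1)%:E <= d%:R%:E)%E by rewrite lee_pdivrMr// -EFinM.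
  by rewrite ge_min; move: gr_ge; rewrite (min_l aH) => ->.
- rewrite le_min lee_pdivlMr// up1/=.
  (* Nullity is known only for exponents strictly above d, so the bound by d is reached through d +
     e. *)
  apply/lee_addgt0Pr => e e0; apply: hausdorff_dim_le; first by rewrite ltr_wpDl.
  by apply: hausdorff_measure_euclidean_eq0; rewrite ltrDl.
- exact: im_ge.
Unshelve. all: by end_near. Qed.

End dimension_of_perturbed_fbm.

Theorem theorem1p2 (R : realType) (disp : measure_display)
    (Omega : measurableType disp) (P : probability Omega R)
    (d : nat) (H : R) (X : R -> Omega -> 'rV[R]_d)
    (f : R -> 'rV[R]_d) (A : set R)
    (d_gt0 : (0 < d)%N) (H01 : 0 < H < 1)
    (X_fbm : fractional_brownian_motion P H X)
    (f_borel : borel_measurable_on `[0, 1] f)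
    (A_borel : measurable A) (A01 : A `<=` `[0, 1]) :
  let alpha := parabolic_dim H (graph_on A f) in
  {ae P, forall w : Omega,
    hausdorff_dim spacetime_dist (graph_on A (fun t => X t w + f t)) =
      Order.min (alpha * (H^-1)%:E)%E (alpha + (d%:R * (1 - H))%:E)%E /\
    hausdorff_dim euclidean_dist ((fun t => X t w + f t) @` A) =
      Order.min (alpha * (H^-1)%:E)%E (d%:R)%:E}.
Proof. exact: ae_dimensions. Qed.
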